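(* Let $k(x,y)=\tfrac13+\tfrac12(x^2+y^2)-\max(x,y)$ on $[0,1]^2$, let $(\gamma_u)_{u\in\mathcal U}$ be product weights, $\boldsymbol a=(\tfrac12,\tfrac12,\dots)$, and let $\$(\nu)=O(\nu^s)$ for some $s>0$. Consider the algorithms $$Q(f)=\sum_{k=1}^mQ_{v_k,\boldsymbol a}(f-\Psi_{k-1}f),\qquad v_k=[L_k],$$ where $Q_{v_k,\boldsymbol a}=Q_{v_k,n_k}\circ\Psi_k$ and $Q_{v_k,n_k}$ is the randomized quadrature based on a scrambled polynomial lattice rule in $[0,1)^{v_k}$ described in the context. Then for every arbitrarily small $\delta>0$ there exist constants $C$ and $N_0$ such that for every $N\ge N_0$ one can choose $m$, $L_1<\dots<L_m$ and $n_1\ge\dots\ge n_m$ such that $Q$ has cost at most $N$ in the variable subspace sampling model and satisfies the following. If $s\ge\frac23$: $$e(Q,B(K))^2\le CN^{-3+\delta}\ \text{ if }\mathrm{decay}_{\boldsymbol\gamma}\ge1+3s,\qquad e(Q,B(K))^2\le CN^{-\frac{\mathrm{decay}_{\boldsymbol\gamma}-1}{s}+\delta}\ \text{ if }1+3s>\mathrm{decay}_{\boldsymbol\gamma}>1.$$ If $\frac23>s>0$: $$e(Q,B(K))^2\le CN^{-3+\delta}\ \text{ if }\mathrm{decay}_{\boldsymbol\gamma}\ge3,$$ $$e(Q,B(K))^2\le CN^{-\mathrm{decay}_{\boldsymbol\gamma}+\delta}\ \text{ if }3>\mathrm{decay}_{\boldsymbol\gamma}>\tfrac1{1-s},$$ $$e(Q,B(K))^2\le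 CN^{-\frac{\mathrm{decay}_{\boldsymbol\gamma}-1}{s}+\delta}\ \text{ if }\tfrac1{1-s}\ge\mathrm{decay}_{\boldsymbol\gamma}>1.$$
   Context: **Function spaces.** $[n]=\{1,\dots,n\}$; $\mathcal U$ is the set of finite subsets of $\mathbb N$. $D=[0,1]$, $\rho$ is Lebesgue measure on $[0,1]$, $\mu$ the product measure on $[0,1]^{\mathbb N}$. Weights $\boldsymbol\gamma=(\gamma_u)_{u\in\mathcal U}$ are non-negative, $\gamma_\emptyset=1$, $\sum_{u\in\mathcal U}\gamma_u<\infty$; product weights: $\gamma_u=\prod_{j\in u}\gamma_j$ with $\gamma_1\ge\gamma_2\ge\cdots\ge0$. $k_u(\boldsymbol x,\boldsymbol y)=\prod_{j\in u}k(x_j,y_j)$ ($k_\emptyset=1$), $H_u$ is the reproducing kernel Hilbert space with kernel $k_u$ (its elements depend only on the coordinates in $u$), with norm $\|f\|_{k_u}^2=\int_{[0,1]^u}(f^{(u)})^2$, $f^{(u)}$ the weak mixed first derivative in the variables in $u$. $K=\sum_{u\in\mathcal U}\gamma_uk_u$, defined on the set $\mathfrak X$ of all $\boldsymbol x\in[0,1]^{\mathbb N}$ with $\sum_u\gamma_uk_u(\boldsymbol x,\boldsymbol x)<\infty$; $B(K)$ is the closed unit ball of the reproducing kernel Hilbert space $H(K)$. $I(f)=\int f\,d\mu$. **Decay.** $\widehat\gamma_u=\gamma_uk(\frac12,\frac12)^{|u|}$; $u_1,u_2,\dots$ orders the (infinitely many) non-empty $u$ with $\gamma_u>0$ so that $\widehat\gamma_{u_1}\ge\widehat\gamma_{u_2}\ge\cdots$;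 $\mathrm{decay}_{\boldsymbol\gamma}=\sup\{q\in\mathbb R:\lim_{j\to\infty}\widehat\gamma_{u_j}j^q=0\}$. **Scrambled polynomial lattice rules.** Let $b$ be prime, $M\in\mathbb N$, $\mathbb Z_b$ the field with $b$ elements, $p(x)\in\mathbb Z_b[x]$ with $\deg p=M$, $\boldsymbol q=(q_j)_{j\in v}$ with $q_j\in\mathbb Z_b[x]$, $v$ a finite index set. Let $\nu_M(\sum_{l\ge w}t_lx^{-l})=\sum_{l=\max(1,w)}^Mt_lb^{-l}$ on formal Laurent series over $\mathbb Z_b$. For $0\le h<b^M$ with $h=\sum_{r<M}h_rb^r$ put $\overline h(x)=\sum_{r<M}h_rx^r$ and $\boldsymbol x_h=(\nu_M(\overline hq_j/p))_{j\in v}\in[0,1)^v$. These $b^M$ points form a polynomial lattice point set. Owen scrambling replaces each point $\boldsymbol x$ with $x_j=\sum_l\xi_{j,l}b^{-l}$ by $\boldsymbol y$ with $y_j=\sum_l\eta_{j,l}b^{-l}$, $\eta_{j,1}=\pi_j(\xi_{j,1})$, $\eta_{j,l}=\pi_{j,\xi_{j,1},\dots,\xi_{j,l-1}}(\xi_{j,l})$ ($l\ge2$), all $\pi$'s being mutually independent uniformly random permutations of $\{0,\dots,b-1\}$ (the same for all points of the point set). For $n_k=b^{M_k}$, $Q_{v_k,n_k}(f)=\frac1{n_k}\sum_{i=1}^{n_k}f(\boldsymbol x_i)$, with $\{\boldsymbol x_i\}\subset[0,1)^{v_k}$ a scrambled polynomial lattice point set (which exists) such that for all $1\le\tau<3$,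 all $\emptyset\ne u\subseteq v_k$ with $\gamma_u>0$ and $f_u\in H_u$: $\mathrm{Var}(Q_{v_k,n_k}(f_u))\le\big(\sum_{z_u\in w\subseteq[z_u]}\gamma_w^{1/\tau}C_{b,1/\tau}^{|w|}\big)^\tau\gamma_u^{-1}(n_k-1)^{-\tau}\|f_u\|_{k_u}^2$, where $z_u=\max u$ and $C_{b,\lambda}=\max\big(\frac{b-1}{3^\lambda}\frac{b^{3\lambda-1}}{b^{3\lambda-1}-1},\frac{b^{2\lambda}}{(b+1)^\lambda3^\lambda}\big)$. For general $n$ with $b^M\le n<b^{M+1}$ one uses the rule with $b^M$ points and gives the superfluous points weight zero. **Multilevel algorithm.** $v_0=\emptyset$; $(\boldsymbol x_v;\boldsymbol a)$ has coordinates $x_j$, $j\in v$, and $a_j$, $j\notin v$; $(\Psi_kf)(\boldsymbol x)=f(\boldsymbol x_{v_k};\boldsymbol a)$ for $k\ge1$ (regarded as a function on $[0,1]^{v_k}$ when $Q_{v_k,n_k}$ is applied), $\Psi_0=0$. The summands in $Q(f)$ are independent. **Cost and error.** $\$:\mathbb N\cup\{0\}\to[0,\infty)$ is monotone increasing. For strictly increasing sequences $\mathbf v=(v_i')$ of non-empty sets in $\mathcal U$ and an anchor $\boldsymbol a\in\mathfrak X$, $c_{\mathbf v,\boldsymbol a}(\boldsymbol x)=\inf\{\$(|v_i'|):x_j=a_j\ \forall j\notin v_i'\}$ ($\inf\emptyset=\infty$). The cost of $Q$ in the variable subspace sampling model is $\inf_{\mathbf v,\boldsymbol a}\sup_{f\in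 B(K)}\mathbb E(\text{sum of }c_{\mathbf v,\boldsymbol a}(\boldsymbol x)\text{ over the evaluation points used by }Q)$. $e(Q,B(K))=\big(\sup_{f\in B(K)}\mathbb E((I(f)-Q(f))^2)\big)^{1/2}$. *)

(* Defs.v *)
From HB Require Import structures.
From mathcomp Require Import all_boot all_order all_algebra all_fingroup.
From mathcomp Require Import finmap.
From mathcomp Require Import all_classical all_reals all_analysis.

Set Implicit Arguments.
Unset Strict Implicit.
Unset Printing Implicit Defensive.

Import Order.TTheory GRing.Theory Num.Theory.
Import numFieldNormedType.Exports.

Local Open Scope classical_set_scope.
Local Open Scope ring_scope.

(* Coordinates are numbered from 0: the coordinate x_j (j >= 1) of the usual
   notation is [x (j - 1)], and the set [n] = {1, ..., n} is [initseg n]. *)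

Definition initseg (n : nat) : {fset nat} := [fset i in iota 0 n]%fset.

(* [splice v x a] is the point (x_v; a). *)
Definition splice (R : realType) (v : {fset nat}) (x a : nat -> R) : nat -> R :=
  fun j => if j \in v then x j else a j.

(* Reproducing kernel Hilbert spaces.  A function on X `<=` T is represented by
   its extension by 0 to T. *)
Record is_rkhs (R : realType) (T : Type) (X : set T) (K : T -> T -> R)
    (H : set (T -> R)) (ip : (T -> R) -> (T -> R) -> R) : Prop := IsRkhs {
  rkhs_dom : forall f, H f -> f \_ X = f;
  rkhs_zero : H (fun=> 0);
  rkhs_lin : forall (c : R) f g, H f -> H g -> H (fun x => c * f x + g x);
  rkhs_ip_sym : forall f g, H f -> H g -> ip f g = ip g f;
  rkhs_ip_lin : forall (c : R) f g h, H f -> H g -> H h ->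
    ip (fun x => c * f x + g x) h = c * ip f h + ip g h;
  rkhs_ip_ge0 : forall f, H f -> 0 <= ip f f;
  rkhs_ip_def : forall f, H f -> ip f f = 0 -> f = (fun=> 0);
  rkhs_complete : forall F : nat -> T -> R, (forall i, H (F i)) ->
    (forall e : R, 0 < e -> exists i0, forall i j, (i0 <= i)%N -> (i0 <= j)%N ->
       ip (F i \- F j) (F i \- F j) < e) ->
    exists2 f, H f & (fun i => ip (F i \- f) (F i \- f)) @ \oo --> (0 : R);
  rkhs_kernel : forall y, X y -> H ((fun x => K x y) \_ X);
  rkhs_repr : forall f y, H f -> X y -> ip f ((fun x => K x y) \_ X) = f y
}.

Definition rkhs_ball (R : realType) (T : Type) (X : set T) (K : T -> T -> R) :
    set (T -> R) :=
  [set f | exists H ip, [/\ is_rkhs X K H ip, H f & ip f f <= 1]].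

(* Sum of an absolutely summable family of reals. *)
Definition ssum (R : realType) (I : choiceType) (f : I -> R) : R :=
  fine (\esum_(i in [set: I]) (Num.max (f i) 0)%:E) -
  fine (\esum_(i in [set: I]) (Num.max (- f i) 0)%:E).

Definition kern (R : realType) (x y : R) : R :=
  3^-1 + 2^-1 * (x ^+ 2 + y ^+ 2) - Num.max x y.

Definition kern_prod (R : realType) (u : {fset nat}) (x y : nat -> R) : R :=
  \prod_(j <- u) kern (x j) (y j).

Definition weight (R : realType) (g : nat -> R) (u : {fset nat}) : R :=
  \prod_(j <- u) g j.

Definition cube (R : realType) : set (nat -> R) :=
  [set x | forall j, 0 <= x j <= 1].

Definition domK (R : realType) (g : nat -> R) : set (nat -> R) :=
  @cube R `&` [set x |
    (\esum_(u in [set: {fset nat}]) (weight g u * kern_prod u x x)%:E < +oo)%E].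

Definition kernK (R : realType) (g : nat -> R) (x y : nat -> R) : R :=
  ssum (fun u => weight g u * kern_prod u x y).

Definition ballK (R : realType) (g : nat -> R) : set ((nat -> R) -> R) :=
  rkhs_ball (domK g) (kernK g).

(* The product sigma-algebra on sequences of reals is generated by the
   cylinders. *)
Definition cylinders (R : realType) : set (set (nat -> R)) :=
  [set C | exists j (A : set R), measurable A /\ C = [set x | A (x j)]].

Definition is_product_lebesgue (R : realType)
    (mu : {measure set (g_sigma_algebraType (@cylinders R)) -> \bar R}) : Prop :=
  forall (n : nat) (A : nat -> set R), (forall i, measurable (A i)) ->
    mu [set x : nat -> R | forall i, (i < n)%N -> A i (x i)] =
    (\prod_(i < n) (@lebesgue_measure R) (A i `&` `[0%R, 1%R]))%E.

Definition integral_mu (R : realType) (g : nat -> R)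
    (mu : {measure set (g_sigma_algebraType (@cylinders R)) -> \bar R})
    (f : (nat -> R) -> R) : R :=
  Rintegral mu (domK g) f.

Definition hat_weight (R : realType) (g : nat -> R) (u : {fset nat}) : R :=
  weight g u * kern 2^-1 2^-1 ^+ #|` u|%fset.

(* [u i] is the set u_(i+1) of the usual notation. *)
Definition decreasing_enum (R : realType) (g : nat -> R) (u : nat -> {fset nat}) :
    Prop :=
  [/\ injective u,
      range u = [set w : {fset nat} | w <> fset0 /\ 0 < weight g w] &
      forall i j, (i <= j)%N -> hat_weight g (u j) <= hat_weight g (u i)].

Definition decay (R : realType) (g : nat -> R) (u : nat -> {fset nat}) : \bar R :=
  ereal_sup [set q%:E | q in [set q : R |
    (fun i => hat_weight g (u i) * i.+1%:R `^ q) @ \oo --> (0 : R)]].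

(* For l >= 1, the coefficient of x^(-l) in the Laurent expansion of r / p: it is
   the constant coefficient of the polynomial part of x^l r / p, which is the
   quotient in the Euclidean division of x^l r by p. *)
Definition laurent_coef (F : fieldType) (r p : {poly F}) (l : nat) : F :=
  ((r * 'X^l) %/ p)`_0.

Definition nu_map (R : realType) (b M : nat) (r p : {poly 'F_b}) : R :=
  \sum_(1 <= l < M.+1) (laurent_coef r p l : nat)%:R / b%:R ^+ l.

(* A natural number is reduced modulo b by the cast to 'F_b. *)
Definition hbar (b M h : nat) : {poly 'F_b} :=
  \poly_(r < M) ((h %/ b ^ r)%N%:R : 'F_b).

Definition lattice_point (R : realType) (b M : nat) (p : {poly 'F_b})
    (q : nat -> {poly 'F_b}) (h : nat) : nat -> R :=
  fun j => nu_map R M (hbar b M h * q j) p.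

(* The l-th digit (l >= 1) of the terminating base b expansion of x in [0, 1). *)
Definition digit (R : realType) (b : nat) (x : R) (l : nat) : 'F_b :=
  (Num.truncn (x * b%:R ^+ l))%:R.

(* [sigma [:: xi_1; ...; xi_(l-1)]] is the permutation applied to the l-th digit;
   [sigma [::]] is the one applied to the first digit. *)
Definition scramble (R : realType) (b : nat) (sigma : seq 'F_b -> {perm 'F_b})
    (x : R) : R :=
  limn (series (fun i =>
    ((sigma [seq digit b x l | l <- iota 1 i] (digit b x i.+1) : 'F_b) : nat)%:R
      / b%:R ^+ i.+1 : R)).

(* The h-th scrambled point in [0, 1]^[L], with the coordinates outside [L],
   which are irrelevant, set to 0. *)
Definition scrambled_point (R : realType) (L b M : nat)
    (pq : {poly 'F_b} * (nat -> {poly 'F_b}))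
    (sigma : nat -> seq 'F_b -> {perm 'F_b}) (h : nat) : nat -> R :=
  splice (initseg L)
    (fun j => scramble (sigma j) (lattice_point R M pq.1 pq.2 h j)) (fun=> 0).

(* For b^M <= n < b^(M+1), the n - b^M superfluous points have weight 0. *)
Definition rule_value (R : realType) (L b M : nat)
    (pq : {poly 'F_b} * (nat -> {poly 'F_b}))
    (sigma : nat -> seq 'F_b -> {perm 'F_b}) (f : (nat -> R) -> R) : R :=
  (b ^ M)%N%:R^-1 * \sum_(h < b ^ M) f (scrambled_point R L M pq sigma h).

(* [perms k j s] is the permutation attached to the summand k of the algorithm, the
   coordinate j and the digit prefix s. *)
Definition uniform_scrambling (R : realType) (d : measure_display)
    (Omega : measurableType d) (P : probability Omega R) (b : nat)
    (perms : nat -> nat -> seq 'F_b -> Omega -> {perm 'F_b}) : Prop :=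
  [/\ forall k j s (A : {set {perm 'F_b}}),
        measurable [set w | perms k j s w \in A],
      forall k j s (t : {perm 'F_b}),
        P [set w | perms k j s w = t] = ((b`!)%:R^-1)%:E &
      forall (J : {fset nat * nat * seq 'F_b})
          (A : nat * nat * seq 'F_b -> {set {perm 'F_b}}),
        P [set w | forall i, i \in J -> perms i.1.1 i.1.2 i.2 w \in A i] =
        (\prod_(i <- J) P [set w | perms i.1.1 i.1.2 i.2 w \in A i])%E].

Definition constC (R : realType) (b : nat) (lam : R) : R :=
  Num.max
    ((b%:R - 1) / 3 `^ lam *
      (b%:R `^ (3 * lam - 1) / (b%:R `^ (3 * lam - 1) - 1)))
    (b%:R `^ (2 * lam) / ((b%:R + 1) `^ lam * 3 `^ lam)).

(* The sum over all w with z_u \in w `<=` [z_u], z_u = max u; with coordinates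
   numbered from 0, the set [z_u] is [initseg z.+1]. *)
Definition weight_sum (R : realType) (g : nat -> R) (b : nat) (tau : R)
    (u : {fset nat}) : R :=
  let z := \max_(j <- u) j in
  \sum_(w <- fpowerset (initseg z.+1) | z \in w)
    weight g w `^ tau^-1 * constC b tau^-1 ^+ #|` w|%fset.

(* [pq] is a generating vector over [L] with b^M points whose scrambled lattice
   rule has the required variance decay. *)
Definition good_rule (R : realType) (g : nat -> R) (d : measure_display)
    (Omega : measurableType d) (P : probability Omega R) (b L M : nat)
    (perms : nat -> seq 'F_b -> Omega -> {perm 'F_b})
    (pq : {poly 'F_b} * (nat -> {poly 'F_b})) : Prop :=
  size pq.1 = M.+1 /\
  forall (tau : R) (u : {fset nat})
      (H : set ((nat -> R) -> R)) ip (f : (nat -> R) -> R),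
    1 <= tau < 3 -> u <> fset0 -> (u `<=` initseg L)%fset -> 0 < weight g u ->
    is_rkhs (@cube R) (kern_prod u) H ip -> H f ->
    (variance P (fun w => rule_value L M pq (fun j s => perms j s w) f) <=
     (weight_sum g b tau u `^ tau * (weight g u)^-1 *
      ((b ^ M)%N%:R - 1) `^ (- tau) * ip f f)%:E)%E.

Definition Psi (R : realType) (a : nat -> R) (L : nat -> nat) (k : nat)
    (f : (nat -> R) -> R) : (nat -> R) -> R :=
  if k is 0 then (fun=> 0) else fun x => f (splice (initseg (L k)) x a).

Definition multilevel (R : realType) (Omega : Type) (b : nat)
    (perms : nat -> nat -> seq 'F_b -> Omega -> {perm 'F_b})
    (rule : nat -> nat -> {poly 'F_b} * (nat -> {poly 'F_b}))
    (a : nat -> R) (m : nat) (L n : nat -> nat)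
    (f : (nat -> R) -> R) (w : Omega) : R :=
  \sum_(1 <= k < m.+1)
    let M := trunc_log b (n k) in
    rule_value (L k) M (rule (L k) M) (fun j s => perms k j s w)
      (Psi a L k (f \- Psi a L k.-1 f)).

(* The points at which [multilevel] evaluates f: for each node x of the k-th rule
   these are (x_(v_k); a) and, if k > 1, also (x_(v_(k-1)); a). *)
Definition multilevel_points (R : realType) (Omega : Type) (b : nat)
    (perms : nat -> nat -> seq 'F_b -> Omega -> {perm 'F_b})
    (rule : nat -> nat -> {poly 'F_b} * (nat -> {poly 'F_b}))
    (a : nat -> R) (m : nat) (L n : nat -> nat)
    (f : (nat -> R) -> R) (w : Omega) : seq (nat -> R) :=
  flatten [seq
    let M := trunc_log b (n k) in
    flatten [seq
      let x := scrambled_point R (L k) M (rule (L k) M)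
                 (fun j s => perms k j s w) h in
      splice (initseg (L k)) x a ::
        (if (1 < k)%N then [:: splice (initseg (L k.-1)) x a] else [::])
    | h <- iota 0 (b ^ M)]
  | k <- iota 1 m].

Definition point_cost (R : realType) (dollar : nat -> R) (v : nat -> {fset nat})
    (a x : nat -> R) : \bar R :=
  ereal_inf [set (dollar #|` v i|%fset)%:E | i in
    [set i | forall j, j \notin v i -> x j = a j]].

Definition strictly_increasing_sets (v : nat -> {fset nat}) : Prop :=
  (forall i, v i <> fset0) /\ (forall i, (v i `<` v i.+1)%fset).

(* Cost in the variable subspace sampling model of a randomized algorithm that
   evaluates the input f at the points [pts f w]. *)
Definition var_cost (R : realType) (g : nat -> R) (d : measure_display)
    (Omega : measurableType d) (P : probability Omega R) (dollar : nat -> R)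
    (pts : ((nat -> R) -> R) -> Omega -> seq (nat -> R)) : \bar R :=
  ereal_inf [set t : \bar R | exists v a,
    [/\ strictly_increasing_sets v, domK g a &
     t = ereal_sup [set (\int[P]_w (\sum_(x <- pts f w) point_cost dollar v a x))%E
                   | f in ballK g]]].

Definition worst_error (R : realType) (g : nat -> R)
    (mu : {measure set (g_sigma_algebraType (@cylinders R)) -> \bar R})
    (d : measure_display) (Omega : measurableType d) (P : probability Omega R)
    (Q : ((nat -> R) -> R) -> Omega -> R) : \bar R :=
  poweR (ereal_sup
    [set expectation P (fun w => (integral_mu g mu f - Q f w) ^+ 2)
    | f in ballK g]) 2^-1.

(* Main.v *)
(* Since [K(x, y) = \prod_j (1 + g_j k(x_j, y_j))], [K((x_[L]; a), y)] is the kernel of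
   the first [L] coordinates times a function of [y] alone.
   The bias [I f - f(x_[L]; a)] and the components [G_w] of the difference of two
   successive levels are then controlled by domination of positive semidefinite
   kernels: if [B K - \sum_w o_w b_w(x) b_w(y) K_w] is positive semidefinite, then the
   components satisfy [\sum_w o_w |G_w|^2 <= B |f|^2].  The constants [B] are given by
   [\prod_(j >= L) (1 + g_j / 12) - 1], which is of the order of [\sum_(j >= L) g_j].
   Under the scrambling every single point is uniform and [k] integrates to 0 in
   each variable, so the rules applied to distinct nonempty components, or in
   distinct summands, are uncorrelated and the variances add up; a component not
   supported in the previous level carries a small weight, the others a small norm.
   Since the singletons are among the sets of positive weight, [g_j = O(j^-q)] for
   every [q < decay].  With [X] a multiple of the budget, [L_k ~ X^(k / (s m))] and
   [n_k ~ X^(1 - k / m)] give every summand cost of order [X], and the error rate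
   tends to the claimed one as [m] grows. *)

Require Import Defs.
From HB Require Import structures.
From mathcomp Require Import all_boot all_order all_algebra all_fingroup.
From mathcomp Require Import finmap.
From mathcomp Require Import all_classical all_reals all_analysis.
From mathcomp Require Import measurable_realfun.
From mathcomp Require Import ring lra zify.

Set Implicit Arguments.
Unset Strict Implicit.
Unset Printing Implicit Defensive.

Import Order.TTheory GRing.Theory Num.Theory.
Import numFieldNormedType.Exports.

Local Open Scope classical_set_scope.
Local Open Scope ring_scope.

(** * Limits of real sequences *)

Section RealSequences.
Context {R : realType}.
Implicit Types (u v : nat -> R).

(** The space of [K] is only given through the axioms of [is_rkhs], so the estimates are proved for
    finite combinations of kernel sections, where they are inequalities between quadratic forms, and
    reach [f] by density. Measurability of [f] and of its components is obtained in the same spirit: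
    scrambled points are cut after n digits, which leaves finitely many uniform permutations, and
    the product measure is replaced by a uniform grid; bounded convergence leads back. In both cases
    the vanishing integral of k enters as the bound 1/n for its means over the grid of step 1/n. The
    two values of [o_w] are majorants of the factor in the variance bound of the rule: that factor
    is at most D g_z with z = max w, and z >= L_(k-1) as soon as w leaves the previous level. The
    attainable rate is min(3, decay, (decay - 1) / s) up to delta: 3 is the limit for tau,
    [tau < decay] makes the series of g_j^(1/tau) converge, and a truncation error of order L^(1 -
    decay) is paid with L^s per point. The five cases say where each of the three terms is the
    smallest. *)

Lemma cvgn_sum (I : Type) (l : seq I) (P : pred I) (F : I -> nat -> R) (L : I -> R) :
  (forall i, P i -> F i @ \oo --> L i) ->
  (fun n => \sum_(i <- l | P i) F i n) @ \oo --> \sum_(i <- l | P i) L i.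
Proof.
move=> h; elim: l => [|i l IH].
  by rewrite big_nil; under eq_fun do rewrite big_nil; exact: cvg_cst.
rewrite big_cons; under eq_fun do rewrite big_cons.
by case: ifPn => // Pi; apply: cvgD => //; exact: h.
Qed.

Lemma cvgn_prod (I : Type) (l : seq I) (F : I -> nat -> R) (L : I -> R) :
  (forall i, F i @ \oo --> L i) ->
  (fun n => \prod_(i <- l) F i n) @ \oo --> \prod_(i <- l) L i.
Proof.
move=> h; elim: l => [|i l IH].
  by rewrite big_nil; under eq_fun do rewrite big_nil; exact: cvg_cst.
by rewrite big_cons; under eq_fun do rewrite big_cons; apply: cvgM.
Qed.

Lemma cvgn_le n0 u v l m : (forall n, (n0 <= n)%N -> u n <= v n) ->
  u @ \oo --> l -> v @ \oo --> m -> l <= m.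
Proof.
move=> h ul vm; apply: (ler_cvg_to ul vm).
by near=> n; apply: h; near: n; exact: nbhs_infty_ge.
Unshelve. all: by end_near. Qed.

Lemma cvgn_leP n0 u l c : (forall n, (n0 <= n)%N -> u n <= c) -> u @ \oo --> l -> l <= c.
Proof. by move=> h ul; exact: cvgn_le h ul (cvg_cst _). Qed.

Lemma cvgn_geP n0 u l c : (forall n, (n0 <= n)%N -> c <= u n) -> u @ \oo --> l -> c <= l.
Proof. by move=> h ul; exact: cvgn_le h (cvg_cst _) ul. Qed.

Lemma cvgnP u l : u @ \oo --> l <->
  (forall e, 0 < e -> exists n0, forall n, (n0 <= n)%N -> `|u n - l| < e).
Proof.
split=> [/cvgrPdist_lt h e e0|h].
  have [n0 _ hn] := h e e0; exists n0 => n ?; rewrite distrC; exact: hn.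
apply/cvgrPdist_lt => e e0; have [n0 hn] := h e e0.
by exists n0 => // n /= ?; rewrite distrC; exact: hn.
Qed.

Lemma cvgn_squeeze0 u v : (forall n, `|u n| <= v n) -> v @ \oo --> (0 : R) ->
  u @ \oo --> (0 : R).
Proof.
move=> h /cvgnP hv; apply/cvgnP => e /hv[n0 hn]; exists n0 => n n0n.
by rewrite subr0; apply: le_lt_trans (h n) _; apply: le_lt_trans (hn _ n0n); rewrite subr0 ler_norm.
Qed.

Lemma cvgn_unique u (l m : R) : u @ \oo --> l -> u @ \oo --> m -> l = m.
Proof. by move=> ul um; exact: cvg_unique ul um. Qed.

Lemma cvgn_ext u v (l : R) : (forall n, u n = v n) -> u @ \oo --> l -> v @ \oo --> l.
Proof. by move=> /funext ->. Qed.

Lemma cvgn_sqr0 u : (fun n => u n ^+ 2) @ \oo --> (0 : R) -> u @ \oo --> (0 : R).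
Proof.
move=> /cvgnP h; apply/cvgnP => e e0; have [n0 hn] := h _ (exprn_gt0 2 e0).
exists n0 => n /hn; rewrite !subr0 normrX ltr_pXn2r// nnegrE//; exact: ltW.
Qed.

Lemma cvgn_cauchy u :
  (forall e, 0 < e -> exists n0, forall i j, (n0 <= i)%N -> (n0 <= j)%N -> `|u i - u j| < e) ->
  exists l : R, u @ \oo --> l.
Proof.
move=> h; suff cu : cvg (u @ \oo) by exists (lim (u @ \oo)); exact: cu.
suff : cauchy (u @ \oo) by exact: cauchy_cvg.
apply: cauchy_exP => e e0.
have [n0 hn] := h e e0; exists (u n0); exists n0 => // n /= n0n.
by rewrite /ball /=; exact: hn.
Qed.

Lemma harmonic_small (e : R) : 0 < e -> exists n0 : nat, forall n, (n0 <= n)%N -> n.+1%:R^-1 < e.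
Proof.
move=> e0; have /cvgnP/(_ e e0)[n0 h] := @cvg_harmonic R; exists n0 => n /h.
by rewrite subr0 ger0_norm// invr_ge0.
Qed.

End RealSequences.

(** * Positive semidefinite kernels and their Hilbert spaces *)

Section FormalCombinations.
Context {R : realType} {T : Type}.
Implicit Types (K : T -> T -> R) (s t r : seq (R * T)) (c : R) (x y : T).

(** A list of pairs (coefficient, point) stands for a combination of sections of [K], addition being
    concatenation; [cform] is the inner product of two such combinations in the Hilbert space of
    [K]. *)
Definition cform K s t : R := \sum_(p <- s) \sum_(q <- t) p.1 * q.1 * K p.2 q.2.
Definition cscale c s : seq (R * T) := [seq (c * p.1, p.2) | p <- s].
Definition csub s t := s ++ cscale (-1) t.
Definition ceval K s x : R := \sum_(p <- s) p.1 * K p.2 x.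

(** Symmetry is demanded separately because a real quadratic form does not see the antisymmetric
    part of a kernel. *)
Definition psd K : Prop := (forall x y, K x y = K y x) /\ (forall s, 0 <= cform K s s).

Lemma cform_catl K s s' t : cform K (s ++ s') t = cform K s t + cform K s' t.
Proof. by rewrite /cform big_cat. Qed.

Lemma cform_catr K s t t' : cform K s (t ++ t') = cform K s t + cform K s t'.
Proof. by rewrite /cform -big_split; apply: eq_bigr => p _; rewrite big_cat. Qed.

Lemma cform_scalel K c s t : cform K (cscale c s) t = c * cform K s t.
Proof.
rewrite /cform big_map mulr_sumr; apply: eq_bigr => p _ /=.
by rewrite mulr_sumr; apply: eq_bigr => q _; ring.
Qed.

Lemma cform_scaler K c s t : cform K s (cscale c t) = c * cform K s t.
Proof.
rewrite /cform mulr_sumr; apply: eq_bigr => p _ /=.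
by rewrite big_map mulr_sumr; apply: eq_bigr => q _ /=; ring.
Qed.

Lemma cform_sub K s t s' t' : cform K (csub s t) (csub s' t') =
  cform K s s' - cform K s t' - cform K t s' + cform K t t'.
Proof.
by rewrite /csub cform_catl !cform_catr !cform_scalel !cform_scaler; ring.
Qed.

Lemma cform_subl K s t s' : cform K (csub s t) s' = cform K s s' - cform K t s'.
Proof. by rewrite /csub cform_catl cform_scalel; ring. Qed.

Lemma cform_subr K s t s' : cform K s' (csub s t) = cform K s' s - cform K s' t.
Proof. by rewrite /csub cform_catr cform_scaler; ring. Qed.

Lemma cform_nill K t : cform K [::] t = 0.
Proof. by rewrite /cform big_nil. Qed.

Lemma cformC K s t : (forall x y, K x y = K y x) -> cform K s t = cform K t s.
Proof.
move=> KC; rewrite /cform exchange_big; apply: eq_bigr => p _; apply: eq_bigr => q _.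
by rewrite KC; ring.
Qed.

Lemma cform_point K s x : cform K s [:: (1, x)] = ceval K s x.
Proof. by apply: eq_bigr => p _; rewrite big_seq1 mulr1. Qed.

Lemma cform_points K x y : cform K [:: (1, x)] [:: (1, y)] = K x y.
Proof. by rewrite cform_point /ceval big_seq1 mul1r. Qed.

Lemma cform_ceval K s t : cform K s t = \sum_(q <- t) q.1 * ceval K s q.2.
Proof.
rewrite /cform exchange_big; apply: eq_bigr => q _; rewrite mulr_sumr.
by apply: eq_bigr => p _; ring.
Qed.

Lemma ceval_cat K s t x : ceval K (s ++ t) x = ceval K s x + ceval K t x.
Proof. by rewrite /ceval big_cat. Qed.

Lemma ceval_scale K c s x : ceval K (cscale c s) x = c * ceval K s x.
Proof. by rewrite -!cform_point cform_scalel. Qed.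

Lemma cform_add K1 K2 s t :
  cform (fun x y => K1 x y + K2 x y) s t = cform K1 s t + cform K2 s t.
Proof.
rewrite /cform -big_split; apply: eq_bigr => p _ /=.
by rewrite -big_split; apply: eq_bigr => q _ /=; ring.
Qed.

Lemma cform_cmul K c s t : cform (fun x y => c * K x y) s t = c * cform K s t.
Proof.
rewrite /cform mulr_sumr; apply: eq_bigr => p _ /=.
by rewrite mulr_sumr; apply: eq_bigr => q _ /=; ring.
Qed.

Lemma cform_kernelB K1 K2 s t :
  cform (fun x y => K1 x y - K2 x y) s t = cform K1 s t - cform K2 s t.
Proof.
rewrite -mulN1r -cform_cmul -cform_add; congr cform.
by apply/funext => x; apply/funext => y; rewrite mulN1r.
Qed.

Lemma cform_sum (I : Type) (l : seq I) (K : I -> T -> T -> R) s t :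
  cform (fun x y => \sum_(i <- l) K i x y) s t = \sum_(i <- l) cform (K i) s t.
Proof.
elim: l => [|i l IH].
  by rewrite big_nil /cform big1 // => p _; rewrite big1 // => q _; rewrite big_nil mulr0.
rewrite big_cons -IH -cform_add; congr cform.
by apply/funext => x; apply/funext => y; rewrite big_cons.
Qed.

(** Passing from K(x, y) to b(x) b(y) K(x, y) only rescales the coefficients, so such a weighting
    preserves positivity. *)
Definition cweight (b : T -> R) s : seq (R * T) := [seq (p.1 * b p.2, p.2) | p <- s].

Lemma cform_weight K b s t :
  cform (fun x y => b x * b y * K x y) s t = cform K (cweight b s) (cweight b t).
Proof.
rewrite /cform big_map; apply: eq_bigr => p _ /=.
by rewrite big_map; apply: eq_bigr => q _ /=; ring.
Qed.

Lemma cform_cvg (K : nat -> T -> T -> R) K' s t :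
  (forall x y, (fun n => K n x y) @ \oo --> K' x y) ->
  (fun n => cform (K n) s t) @ \oo --> cform K' s t.
Proof.
move=> h; apply: cvgn_sum => p _; apply: cvgn_sum => q _.
by apply: cvgM; [exact: cvg_cst | exact: h].
Qed.

End FormalCombinations.

(** A nonnegative quadratic polynomial has no positive discriminant. This yields both Cauchy-Schwarz
    inequalities and, with [a = 0], the vanishing of the first-order term at a minimum. *)
Lemma disc_le (F : realFieldType) (a b d : F) : 0 <= d ->
  (forall c, 0 <= a + 2 * c * b + c ^+ 2 * d) -> b ^+ 2 <= a * d.
Proof.
rewrite le_eqVlt => /orP[/eqP<- h|d0 h].
  have [->|b0] := eqVneq b 0; first by rewrite expr0n mulr0.
  have := h (- (a + 1) / (2 * b)).
  have -> : a + 2 * (- (a + 1) / (2 * b)) * b + (- (a + 1) / (2 * b)) ^+ 2 * 0 = -1.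
    by field.
  by rewrite ler0N1.
have := h (- b / d).
have -> : a + 2 * (- b / d) * b + (- b / d) ^+ 2 * d = (a * d - b ^+ 2) / d.
  by field; rewrite gt_eqF.
by rewrite pmulr_lge0 ?invr_gt0// subr_ge0.
Qed.

Section PsdTheory.
Context {R : realType} {T : Type}.
Implicit Types (K D : T -> T -> R) (s t r : seq (R * T)) (c : R) (x y : T).

Lemma psd_cauchy_schwarz K s t : psd K ->
  cform K s t ^+ 2 <= cform K s s * cform K t t.
Proof.
move=> [KC K0]; apply: disc_le => // c.
have := K0 (s ++ cscale c t).
rewrite cform_catl !cform_catr !cform_scalel !cform_scaler (cformC _ _ KC).
by congr (_ <= _); rewrite (cformC t s KC); ring.
Qed.

(** By the parallelogram law the two sides differ by the squared norm of s + t - 2 r. This takes the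
    place of the triangle inequality, in terms of squares only. *)
Lemma psd_sub2 K s t r : psd K ->
  cform K (csub s t) (csub s t) <=
  2 * cform K (csub s r) (csub s r) + 2 * cform K (csub r t) (csub r t).
Proof.
move=> [KC K0]; have := K0 (csub (s ++ t) (cscale 2 r)).
rewrite !cform_sub !cform_catl !cform_catr !cform_scaler !cform_scalel.
rewrite (cformC t s KC) (cformC r s KC) (cformC r t KC).
lra.
Qed.

Lemma psd_sub_le K s t : psd K ->
  cform K s s <= 2 * cform K (csub s t) (csub s t) + 2 * cform K t t.
Proof.
move=> [KC K0]; have := K0 (csub s (cscale 2 t)).
rewrite !cform_sub !cform_scaler !cform_scalel.
rewrite (cformC t s KC).
lra.
Qed.

Lemma psd_diag_ge0 K x : psd K -> 0 <= K x x.
Proof. by move=> [_ /(_ [:: (1, x)])]; rewrite cform_points. Qed.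

Lemma psd_add K1 K2 : psd K1 -> psd K2 -> psd (fun x y => K1 x y + K2 x y).
Proof.
move=> [C1 P1] [C2 P2]; split=> [x y|s]; first by rewrite C1 C2.
by rewrite cform_add addr_ge0.
Qed.

Lemma psd_cmul K c : 0 <= c -> psd K -> psd (fun x y => c * K x y).
Proof.
move=> c0 [C P]; split=> [x y|s]; first by rewrite C.
by rewrite cform_cmul mulr_ge0.
Qed.

Lemma psd_weight K (b : T -> R) : psd K -> psd (fun x y => b x * b y * K x y).
Proof.
move=> [C P]; split=> [x y|s]; first by rewrite C (mulrC (b x)).
by rewrite cform_weight.
Qed.

Lemma psd_rank1 (b : T -> R) : psd (fun x y => b x * b y).
Proof.
split=> [x y|s]; first by rewrite mulrC.
have -> : cform (fun x y => b x * b y) s s = (\sum_(p <- s) p.1 * b p.2) ^+ 2.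
  rewrite expr2 mulr_suml; apply: eq_bigr => p _; rewrite mulr_sumr.
  by apply: eq_bigr => q _; ring.
exact: sqr_ge0.
Qed.

Lemma psd_cst c : 0 <= c -> psd (fun _ _ : T => c).
Proof.
move=> c0; have := psd_cmul c0 (psd_rank1 (fun=> 1)).
by congr psd; apply/funext => x; apply/funext => y; rewrite !mulr1.
Qed.

Lemma psd_sum (I : Type) (l : seq I) (K : I -> T -> T -> R) :
  (forall i, psd (K i)) -> psd (fun x y => \sum_(i <- l) K i x y).
Proof.
move=> h; split=> [x y|s]; first by apply: eq_bigr => i _; rewrite (h i).1.
by rewrite cform_sum sumr_ge0// => i _; exact: (h i).2.
Qed.

Lemma psd_cvg (K : nat -> T -> T -> R) K' : (forall n, psd (K n)) ->
  (forall x y, (fun n => K n x y) @ \oo --> K' x y) -> psd K'.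
Proof.
move=> h hc; split=> [x y|s].
  have := hc y x; under eq_fun do rewrite (h _).1.
  by move=> hyx; exact: cvg_unique (hc x y) hyx.
exact: (@cvgn_geP _ 0 _ _ 0 (fun n _ => (h n).2 s) (@cform_cvg _ _ _ _ s s hc)).
Qed.

(** The Schur complement at [p], that is the kernel of the functions vanishing at [p]; its
    positivity is Cauchy-Schwarz against the section at [p]. *)
Lemma psd_pivot K p : psd K -> psd (fun x y => K x y - K x p * K p y / K p p).
Proof.
move=> pK; have [KC K0] := pK; split=> [x y|s].
  by rewrite (KC x y) (KC x p) (KC p y) (mulrC (K p x)).
pose e := ceval K s p.
have -> : cform (fun x y => K x y - K x p * K p y / K p p) s s =
          cform K s s - e ^+ 2 / K p p.
  rewrite /cform (eq_bigr (fun i => \sum_(q <- s) i.1 * q.1 * K i.2 q.2 -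
     \sum_(q <- s) (i.1 * K i.2 p) * (q.1 * K q.2 p) / K p p)); last first.
    move=> i _; rewrite -sumrB; apply: eq_bigr => q _; rewrite (KC p q.2); ring.
  rewrite sumrB; congr (_ - _); rewrite /e /ceval expr2 !mulr_suml.
  by apply: eq_bigr => i _; rewrite mulr_sumr mulr_suml.
have := psd_cauchy_schwarz s [:: (1, p)] pK; rewrite cform_point cform_points -/e.
have := psd_diag_ge0 p pK; rewrite le_eqVlt => /orP[/eqP<-|p0].
  by rewrite invr0 !mulr0 subr0 => _; exact: K0.
by rewrite subr_ge0 ler_pdivrMr.
Qed.

(* Gaussian elimination on the first kernel, one point of the combination at a
   time; when [K1 p p = 0] the pivot step is still correct since [x / 0 = 0]. *)
Lemma psd_mul K1 K2 : psd K1 -> psd K2 -> psd (fun x y => K1 x y * K2 x y).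
Proof.
move=> pK1 pK2; split=> [x y|s]; first by rewrite pK1.1 pK2.1.
elim: s K1 pK1 => [|[c p] s IH] K1 pK1; first by rewrite cform_nill.
have [C1 _] := pK1.
pose K1' x y := K1 x y - K1 x p * K1 p y / K1 p p.
have K1'p y : K1' p y = 0.
  rewrite /K1'; have [p0|p0] := eqVneq (K1 p p) 0; last by field.
  have := psd_cauchy_schwarz [:: (1, p)] [:: (1, y)] pK1.
  rewrite !cform_points p0 mul0r => h.
  have : K1 p y ^+ 2 == 0 by rewrite eq_le h sqr_ge0.
  by rewrite sqrf_eq0 => /eqP->; rewrite !(mulr0, mul0r, subr0).
have -> : (fun x y => K1 x y * K2 x y) =
    (fun x y => (K1 p p)^-1 * (K1 x p * K1 y p * K2 x y) + K1' x y * K2 x y).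
  by apply/funext => x; apply/funext => y; rewrite /K1' (C1 p y); ring.
rewrite cform_add cform_cmul cform_weight addr_ge0//.
  by rewrite mulr_ge0 ?invr_ge0 ?psd_diag_ge0//; exact: pK2.2.
have -> : cform (fun x y => K1' x y * K2 x y) ((c, p) :: s) ((c, p) :: s) =
          cform (fun x y => K1' x y * K2 x y) s s.
  rewrite /cform big_cons big1 ?add0r => [|q _]; last by rewrite K1'p mul0r mulr0.
  apply: eq_bigr => q _; rewrite big_cons /=.
  by rewrite [K1' _ p](psd_pivot p pK1).1 -/(K1' p q.2) K1'p; ring.
by apply: IH; exact: psd_pivot.
Qed.

Lemma psd_prod (I : Type) (l : seq I) (K : I -> T -> T -> R) :
  (forall i, psd (K i)) -> psd (fun x y => \prod_(i <- l) K i x y).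
Proof.
move=> h; elim: l => [|i l IH].
  have := @psd_cst 1 ler01; congr psd.
  by apply/funext => x; apply/funext => y; rewrite big_nil.
have := psd_mul (h i) IH; congr psd.
by apply/funext => x; apply/funext => y; rewrite big_cons.
Qed.

End PsdTheory.

(** * Construction of the Hilbert space of a kernel *)

Section MooreAronszajn.
Context {R : realType} {T : Type} (X : set T) (K : T -> T -> R).
Let U := {x : T | X x}.
(** Positivity is only available for points of [X], so formal combinations carry points of the
    subtype. *)
Definition subkernel (x y : {x : T | X x}) : R := K (sval x) (sval y).
Local Notation KU := subkernel.
Hypothesis KU_psd : psd KU.
Implicit Types (s t : nat -> seq (R * U)) (f : T -> R).

Let Qd (s t : seq (R * U)) : R := cform KU (csub s t) (csub s t).

Let QdC a b : Qd a b = Qd b a.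
Proof. by rewrite /Qd !cform_sub; ring. Qed.

Let Qd_ge0 a b : 0 <= Qd a b.
Proof. exact: KU_psd.2. Qed.

Let Qd_triangle a b c : Qd a b <= 2 * Qd a c + 2 * Qd c b.
Proof. exact: psd_sub2. Qed.

Let Cauchy s : Prop := forall e, 0 < e -> exists n0, forall i j,
  (n0 <= i)%N -> (n0 <= j)%N -> Qd (s i) (s j) < e.

(** The completion is realized by functions: a Cauchy sequence of combinations stands for its
    pointwise limit, extended by 0 outside [X]. *)
Let represents s f : Prop := [/\ Cauchy s, f \_ X = f &
  forall x : U, (fun n => ceval KU (s n) x) @ \oo --> f (sval x)].

Let ma_space : set (T -> R) := [set f | exists s, represents s f].

(** The limit is picked by choice among all representing sequences; [cform_cvg_unique] shows that
    they all give the same value. *)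
Let ma_ip f h : R := xget 0 [set r | exists s t, [/\ represents s f, represents t h &
  (fun n => cform KU (s n) (t n)) @ \oo --> r]].

Let Cauchy_bounded s : Cauchy s ->
  exists n0, exists2 M, 0 < M & forall i, (n0 <= i)%N -> cform KU (s i) (s i) <= M.
Proof.
move=> /(_ 1 ltr01)[n0 hn]; exists n0, (2 + 2 * cform KU (s n0) (s n0)).
  by rewrite ltr_wpDr// mulr_ge0// KU_psd.2.
move=> i hi; apply: le_trans (psd_sub_le (s i) (s n0) KU_psd) _.
by rewrite lerD2r; have := hn i n0 hi (leqnn _); rewrite /Qd; lra.
Qed.

(** Split the squared norm of [s i] into its products with a fixed [s N] and with the small
    difference of the two. The first is a finite combination of point values, which tend to 0. Hence
    the norm depends on the represented function only. *)
Let Cauchy_null s : Cauchy s -> (forall x, (fun n => ceval KU (s n) x) @ \oo --> (0 : R)) ->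
  (fun n => cform KU (s n) (s n)) @ \oo --> (0 : R).
Proof.
move=> cs h; have [n1 [M M0 hM]] := Cauchy_bounded cs.
apply/cvgnP => e e0.
have e2 : 0 < e / 2 by rewrite divr_gt0.
have [n0 hn0] := cs ((e / 2) ^+ 2 / M) (divr_gt0 (exprn_gt0 _ e2) M0).
pose N := maxn n0 n1.
have c0 : (fun n => cform KU (s n) (s N)) @ \oo --> (0 : R).
  have : (fun n => \sum_(q <- s N) q.1 * ceval KU (s n) q.2) @ \oo -->
         \sum_(q <- s N) q.1 * 0.
    by apply: cvgn_sum => q _; apply: cvgM; [exact: cvg_cst|exact: h].
  under eq_fun do rewrite -cform_ceval.
  by rewrite [X in _ --> X -> _]big1// => q _; rewrite mulr0.
have /cvgnP/(_ _ e2)[n2 hn2] := c0; exists (maxn N n2) => i.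
rewrite !geq_max -andbA => /and3P[i0 i1 i2].
rewrite subr0 ger0_norm ?KU_psd.2//.
have -> : cform KU (s i) (s i) =
          cform KU (s i) (s N) + cform KU (s i) (csub (s i) (s N)).
  by rewrite cform_subr; ring.
rewrite [ltRHS](splitr e) ltrD//.
  by apply: le_lt_trans (ler_norm _) _; have := hn2 _ i2; rewrite subr0.
apply: le_lt_trans (ler_norm _) _.
rewrite -(@ltr_pXn2r _ 2)// ?nnegrE ?(ltW e2)// real_normK ?num_real//.
apply: le_lt_trans (psd_cauchy_schwarz _ _ KU_psd) _.
apply: (@le_lt_trans _ _ (M * Qd (s i) (s N))).
  by rewrite ler_wpM2r//; [exact: Qd_ge0|exact: hM].
by rewrite mulrC -ltr_pdivlMr//; apply: hn0 => //; rewrite leq_max leqnn.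
Qed.

Let Cauchy_lin (c : R) s t : Cauchy s -> Cauchy t -> Cauchy (fun n => cscale c (s n) ++ t n).
Proof.
move=> cs ct e e0.
have e4 : 0 < e / (4 * (c ^+ 2 + 1)) by rewrite divr_gt0// mulr_gt0// ltr_wpDl// sqr_ge0.
have e8 : 0 < e / 4 by rewrite divr_gt0.
have [n1 h1] := cs _ e4; have [n2 h2] := ct _ e8.
exists (maxn n1 n2) => i j; rewrite !geq_max => /andP[i1 i2] /andP[j1 j2].
have := h1 i j i1 j1; have := h2 i j i2 j2.
have := KU_psd.2 (csub (cscale c (csub (s i) (s j))) (csub (t i) (t j))).
have -> : Qd (cscale c (s i) ++ t i) (cscale c (s j) ++ t j) =
   2 * (c ^+ 2 * Qd (s i) (s j)) + 2 * Qd (t i) (t j) -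
   cform KU (csub (cscale c (csub (s i) (s j))) (csub (t i) (t j)))
            (csub (cscale c (csub (s i) (s j))) (csub (t i) (t j))).
  rewrite /Qd !cform_sub !cform_catl !cform_catr !cform_scalel !cform_scaler
    !cform_subl !cform_subr.
  ring.
move=> hq hA; rewrite ltr_pdivlMr; last by rewrite mulr_gt0// ltr_wpDl// sqr_ge0.
move=> hB; have := Qd_ge0 (s i) (s j); nra.
Qed.

Let represents_lin (c : R) s t f h : represents s f -> represents t h ->
  represents (fun n => cscale c (s n) ++ t n) (fun x => c * f x + h x).
Proof.
move=> [cs fX hs] [ct hX ht]; split; first exact: Cauchy_lin.
  apply/funext => x; rewrite /patch; case: ifPn => // xX.
  by rewrite -fX -hX /patch (negbTE xX) mulr0 addr0.
move=> x; under eq_fun do rewrite ceval_cat ceval_scale.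
by apply: cvgD => //; apply: cvgM; [exact: cvg_cst|].
Qed.

Let cform_cvg_ex s t : Cauchy s -> Cauchy t ->
  exists r : R, (fun n => cform KU (s n) (t n)) @ \oo --> r.
Proof.
move=> cs ct; apply: cvgn_cauchy => e e0.
have [n1 [M M0 hM]] := Cauchy_bounded cs.
have [n2 [M' M'0 hM']] := Cauchy_bounded ct.
have e2 : 0 < e / 2 by rewrite divr_gt0.
have [n3 h3] := cs ((e / 2) ^+ 2 / M') (divr_gt0 (exprn_gt0 _ e2) M'0).
have [n4 h4] := ct ((e / 2) ^+ 2 / M) (divr_gt0 (exprn_gt0 _ e2) M0).
exists (maxn (maxn n1 n2) (maxn n3 n4)) => i j.
rewrite !geq_max => /andP[/andP[i1 i2] /andP[i3 i4]] /andP[/andP[j1 j2] /andP[j3 j4]].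
have -> : cform KU (s i) (t i) - cform KU (s j) (t j) =
   cform KU (csub (s i) (s j)) (t i) + cform KU (s j) (csub (t i) (t j)).
  by rewrite cform_subl cform_subr; ring.
apply: le_lt_trans (ler_normD _ _) _; rewrite [ltRHS](splitr e) ltrD//.
  rewrite -(@ltr_pXn2r _ 2)// ?nnegrE ?(ltW e2)// real_normK ?num_real//.
  apply: le_lt_trans (psd_cauchy_schwarz _ _ KU_psd) _.
  apply: (@le_lt_trans _ _ (Qd (s i) (s j) * M')).
    by rewrite ler_wpM2l//; [exact: Qd_ge0|exact: hM'].
  by rewrite -ltr_pdivlMr//; apply: h3.
rewrite -(@ltr_pXn2r _ 2)// ?nnegrE ?(ltW e2)// real_normK ?num_real//.
apply: le_lt_trans (psd_cauchy_schwarz _ _ KU_psd) _.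
apply: (@le_lt_trans _ _ (M * Qd (t i) (t j))).
  by rewrite ler_wpM2r//; [exact: Qd_ge0|exact: hM].
by rewrite mulrC -ltr_pdivlMr//; apply: h4.
Qed.

Let represents_diff_null s s' f : represents s f -> represents s' f ->
  (fun n => Qd (s n) (s' n)) @ \oo --> (0 : R).
Proof.
move=> [cs fX hs] [cs' _ hs'].
have cn : forall n, csub (s n) (s' n) = s n ++ cscale (-1) (s' n) by [].
have E : (fun n => Qd (s n) (s' n)) =
  (fun n => cform KU (cscale (-1) (s' n) ++ s n) (cscale (-1) (s' n) ++ s n)).
  by apply/funext => n; rewrite /Qd cform_sub !cform_catl !cform_catr !cform_scalel
    !cform_scaler; ring.
rewrite E; apply: Cauchy_null; first exact: Cauchy_lin.
move=> x; under eq_fun do rewrite ceval_cat ceval_scale mulN1r addrC.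
by rewrite -(subrr (f (sval x))); apply: cvgB.
Qed.

Let cform_cvg_unique s s' t t' f h (r : R) : represents s f -> represents s' f ->
  represents t h -> represents t' h ->
  (fun n => cform KU (s n) (t n)) @ \oo --> r -> (fun n => cform KU (s' n) (t' n)) @ \oo --> r.
Proof.
move=> sf s'f th t'h hr.
have d1 := represents_diff_null sf s'f; have d2 := represents_diff_null th t'h.
have [n1 [M M0 hM]] : exists n0, exists2 M : R, 0 < M &
  forall i, (n0 <= i)%N -> cform KU (s' i) (s' i) <= M by case: s'f => /Cauchy_bounded.
have [n2 [M' M'0 hM']] : exists n0, exists2 M : R, 0 < M &
  forall i, (n0 <= i)%N -> cform KU (t i) (t i) <= M by case: th => /Cauchy_bounded.
apply/cvgnP => e e0.
have e3 : 0 < e / 3 by rewrite divr_gt0.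
have /cvgnP/(_ _ e3)[n3 h3] := hr.
have /cvgnP/(_ _ (divr_gt0 (exprn_gt0 2 e3) M'0))[n4 h4] := d1.
have /cvgnP/(_ _ (divr_gt0 (exprn_gt0 2 e3) M0))[n5 h5] := d2.
exists (maxn (maxn (maxn n1 n2) (maxn n3 n4)) n5) => i; rewrite !geq_max.
move=> /andP[/andP[/andP[i1 i2] /andP[i3 i4]] i5].
have -> : cform KU (s' i) (t' i) - r = (cform KU (s i) (t i) - r) -
   cform KU (csub (s i) (s' i)) (t i) - cform KU (s' i) (csub (t i) (t' i)).
  by rewrite cform_subl cform_subr; ring.
have -> : e = e / 3 + e / 3 + e / 3 by field.
apply: le_lt_trans (ler_normB _ _) _; rewrite ltrD//.
  apply: le_lt_trans (ler_normB _ _) _; rewrite ltrD//; first exact: h3.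
  rewrite -(@ltr_pXn2r _ 2)// ?nnegrE ?(ltW e3)// real_normK ?num_real//.
  apply: le_lt_trans (psd_cauchy_schwarz _ _ KU_psd) _.
  apply: (@le_lt_trans _ _ (Qd (s i) (s' i) * M')).
    by rewrite ler_wpM2l//; [exact: Qd_ge0|exact: hM'].
  by rewrite -ltr_pdivlMr//; have := h4 _ i4; rewrite subr0 ger0_norm//; exact: Qd_ge0.
rewrite -(@ltr_pXn2r _ 2)// ?nnegrE ?(ltW e3)// real_normK ?num_real//.
apply: le_lt_trans (psd_cauchy_schwarz _ _ KU_psd) _.
apply: (@le_lt_trans _ _ (M * Qd (t i) (t' i))).
  by rewrite ler_wpM2r//; [exact: Qd_ge0|exact: hM].
by rewrite mulrC -ltr_pdivlMr//; have := h5 _ i5; rewrite subr0 ger0_norm//; exact: Qd_ge0.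
Qed.

Let ma_ipE s t f h : represents s f -> represents t h ->
  (fun n => cform KU (s n) (t n)) @ \oo --> ma_ip f h.
Proof.
move=> sf th; rewrite /ma_ip; case: xgetP => [r -> [s' [t' [s'f t'h hr]]]|].
  exact: (cform_cvg_unique s'f sf t'h th hr).
have [r hr] : exists r : R, (fun n => cform KU (s n) (t n)) @ \oo --> r.
  by case: sf th => cs _ _ [ct _ _]; exact: cform_cvg_ex.
by move=> /(_ r)[]; exists s, t.
Qed.

Let represents_cst (a : seq (R * U)) f : f \_ X = f ->
  (forall x : U, f (sval x) = ceval KU a x) -> represents (fun=> a) f.
Proof.
move=> fX h; split => //.
  by move=> e e0; exists 0%N => i j _ _; rewrite (_ : Qd a a = 0)//; rewrite /Qd cform_sub; ring.
by move=> x; rewrite h; exact: cvg_cst.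
Qed.

Let represents_kernel y (Xy : X y) :
  represents (fun=> [:: (1, exist _ y Xy)]) ((fun x => K x y) \_ X).
Proof.
apply: represents_cst.
  by apply/funext => x; rewrite /patch; case: (x \in X).
move=> x; rewrite /patch mem_set; last exact: (svalP x).
by rewrite -cform_point cform_points KU_psd.1.
Qed.


Let represents_zero : represents (fun=> [::]) (fun=> 0).
Proof.
apply: represents_cst; first by apply/funext => x; rewrite /patch; case: (x \in X).
by move=> x; rewrite /ceval big_nil.
Qed.

Let represents_sub s t f h : represents s f -> represents t h ->
  represents (fun n => cscale (-1) (s n) ++ t n) (fun x => h x - f x).
Proof.
move=> sf th; have := represents_lin (-1) sf th; congr represents.
by apply/funext => x; rewrite mulN1r addrC.
Qed.

Let ma_ip_dist s t f h : represents s f -> represents t h ->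
  (fun n => Qd (s n) (t n)) @ \oo --> ma_ip (f \- h) (f \- h).
Proof.
move=> sf th.
rewrite (_ : (fun n => _) = (fun n =>
    cform KU (cscale (-1) (t n) ++ s n) (cscale (-1) (t n) ++ s n))).
  exact: ma_ipE (represents_sub th sf) (represents_sub th sf).
apply/funext => n.
by rewrite /Qd cform_sub !cform_catl !cform_catr !cform_scalel !cform_scaler; ring.
Qed.

Let ma_complete (F : nat -> T -> R) : (forall i, ma_space (F i)) ->
  (forall e : R, 0 < e -> exists i0, forall i j, (i0 <= i)%N -> (i0 <= j)%N ->
     ma_ip (F i \- F j) (F i \- F j) < e) ->
  exists2 f, ma_space f & (fun i => ma_ip (F i \- f) (F i \- f)) @ \oo --> (0 : R).
Proof.
move=> /choice[S hS] hF.
(* Diagonal argument: one combination [c i] within 1/(i+1) of [F i] in squared distance; the limit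
   will be the function represented by the sequence [c]. *)
have /choice[c hc] (i : nat) : exists a : seq (R * U), exists n0, forall n, (n0 <= n)%N ->
    Qd (S i n) a < i.+1%:R^-1.
  have [cS _ _] := hS i; have [n0 h] := cS i.+1%:R^-1 ltac:(by rewrite invr_gt0).
  by exists (S i n0), n0 => n hn; exact: h.
have cc : Cauchy c.
  move=> e e0; have e12 : 0 < e / 12 by rewrite divr_gt0.
  have [i0 hi0] := hF _ e12; have [i1 hi1] := harmonic_small e12.
  exists (maxn i0 i1) => i j; rewrite !geq_max => /andP[ii0 ii1] /andP[ji0 ji1].
  (* This tolerance forces the squared distance of the approximants of [F i] and [F j] below e /
     12. *)
  have /cvgnP/(_ (e / 12 - ma_ip (F i \- F j) (F i \- F j))) := ma_ip_dist (hS i) (hS j).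
  rewrite subr_gt0 => /(_ (hi0 _ _ ii0 ji0))[n1 h1].
  have [n2 h2] := hc i; have [n3 h3] := hc j.
  pose n := maxn n1 (maxn n2 n3).
  have := h1 n (leq_maxl _ _); have := h2 n ltac:(by rewrite !leq_max leqnn !orbT).
  have := h3 n ltac:(by rewrite !leq_max leqnn !orbT).
  have := hi1 _ ii1; have := hi1 _ ji1.
  have := Qd_triangle (c i) (c j) (S i n); have := Qd_triangle (S i n) (c j) (S j n).
  rewrite (QdC (c i) (S i n)) ltr_norml.
  move=> t1 t2 hj hi /lt_trans/(_ hj) qj /lt_trans/(_ hi) qi /andP[_ hq].
  move: t1 t2 qj qi hq; clear -e0; move: (ma_ip _ _) (Qd _ _) (Qd _ _) (Qd _ _) (Qd _ _) (Qd _ _).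
  by move=> *; lra.
have /choice[f0 hf0] (x : U) : exists l : R, (fun n => ceval KU (c n) x) @ \oo --> l.
  have cx : Cauchy (fun=> [:: (1, x)]).
    by move=> e e0; exists 0%N => i j _ _; rewrite (_ : Qd _ _ = 0)//; rewrite /Qd cform_sub; ring.
  have [r] := cform_cvg_ex cc cx; under eq_fun do rewrite cform_point.
  by exists r.
pose f y := if pselect (X y) is left Xy then f0 (exist _ y Xy) else 0.
have cf : represents c f.
  split => //.
    apply/funext => y; rewrite /patch /f; case: ifPn => // /negP; rewrite inE => nXy.
    by case: pselect.
  move=> [y Xy]; rewrite /f /=; case: pselect => // Xy'.
  by rewrite (Prop_irrelevance Xy' Xy); exact: hf0.
exists f; first by exists c.
apply/cvgnP => e e0; have e8 : 0 < e / 8 by rewrite divr_gt0.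
have [n0 hn0] := cc _ e8; have [i1 hi1] := harmonic_small e8.
exists (maxn n0 i1) => i; rewrite !geq_max => /andP[ii0 ii1].
have hd := ma_ip_dist (hS i) cf.
have d0 : 0 <= ma_ip (F i \- f) (F i \- f).
  by apply: (@cvgn_geP _ 0 _ _ 0 _ hd) => n _; exact: Qd_ge0.
rewrite subr0 ger0_norm//; apply: (@le_lt_trans _ _ (e / 2)); last by lra.
have [n1 h1] := hc i.
apply: (@cvgn_leP _ (maxn n0 n1) _ _ _ _ hd) => n; rewrite geq_max => /andP[nn0 nn1].
have := Qd_triangle (S i n) (c n) (c i); have := lt_trans (h1 _ nn1) (hi1 _ ii1).
have := hn0 _ _ ii0 nn0; move: (Qd _ _) (Qd _ _) (Qd _ _).
by move=> *; lra.
Qed.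

(** The variance bound in [good_rule] speaks of elements of a given space with kernel [kern_prod w];
    existence of such a space makes the bound applicable to the components. *)
Theorem moore_aronszajn : exists H ip, is_rkhs X K H ip.
Proof.
exists ma_space, ma_ip; split.
- by move=> f [s []].
- by exists (fun=> [::]); exact: represents_zero.
- by move=> c f h [s sf] [t th]; eexists; exact: represents_lin sf th.
- move=> f h [s sf] [t th]; apply: (cvgn_unique (ma_ipE sf th)).
  under eq_fun do rewrite (cformC _ _ KU_psd.1).
  exact: ma_ipE.
- move=> c f h k [s sf] [t th] [r rk].
  apply: (cvgn_unique (ma_ipE (represents_lin c sf th) rk)).
  under eq_fun do rewrite cform_catl cform_scalel.
  apply: cvgD; last exact: ma_ipE.
  by apply: cvgM; [exact: cvg_cst|exact: ma_ipE].
- move=> f [s sf]; apply: (@cvgn_geP _ 0 _ _ 0 _ (ma_ipE sf sf)) => n _.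
  exact: KU_psd.2.
- move=> f [s sf] f0; apply/funext => x.
  have [_ fX hs] := sf.
  have [Xx|nXx] := pselect (X x); last first.
    by rewrite -fX /patch; case: ifPn => //; rewrite inE.
  pose u : U := exist _ x Xx.
  have : f x ^+ 2 <= 0.
    have := ma_ipE sf sf; rewrite f0 => h0.
    have h1 : (fun n => ceval KU (s n) u ^+ 2) @ \oo --> f x ^+ 2 by exact: cvgM.
    have h2 : (fun n => cform KU (s n) (s n) * KU u u) @ \oo --> (0 : R).
      by rewrite -[0](mul0r (KU u u)); apply: cvgM => //; exact: cvg_cst.
    apply: (@cvgn_le _ 0 _ _ _ _ _ h1 h2) => n _.
    by have := psd_cauchy_schwarz (s n) [:: (1, u)] KU_psd; rewrite cform_point cform_points.
  move=> h; have : f x ^+ 2 == 0 by rewrite eq_le h sqr_ge0.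
  by rewrite sqrf_eq0 => /eqP.
- exact: ma_complete.
- by move=> y Xy; eexists; exact: represents_kernel.
- move=> f y [s sf] Xy; apply: (cvgn_unique (ma_ipE sf (represents_kernel Xy))).
  under eq_fun do rewrite cform_point.
  by case: sf => _ _ /(_ (exist _ y Xy)).
Qed.

End MooreAronszajn.

(** * Consequences of the reproducing property *)

Section RkhsTheory.
Context {R : realType} {T : Type} (X : set T) (K : T -> T -> R).
Context (H : set (T -> R)) (ip : (T -> R) -> (T -> R) -> R).
Hypothesis rk : is_rkhs X K H ip.
Let U := {x : T | X x}.
Local Notation KU := (@subkernel R T X K).
Implicit Types (f g h : T -> R) (s t : seq (R * U)).

Definition ksection y : T -> R := (fun x => K x y) \_ X.

Lemma ksectionE x y : X x -> ksection y x = K x y.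
Proof. by move=> Xx; rewrite /ksection /patch mem_set. Qed.

Lemma rkhs_sub f g : H f -> H g -> H (f \- g).
Proof.
move=> Hf Hg; have := rkhs_lin rk (-1) Hg Hf; congr H.
by apply/funext => x /=; rewrite mulN1r addrC.
Qed.

Lemma rkhs_scale c f : H f -> H (fun x => c * f x).
Proof.
move=> Hf; have := rkhs_lin rk c Hf (rkhs_zero rk); congr H.
by apply/funext => x /=; rewrite addr0.
Qed.

Lemma ip_subl f g h : H f -> H g -> H h -> ip (f \- g) h = ip f h - ip g h.
Proof.
move=> Hf Hg Hh; have := rkhs_ip_lin rk (-1) Hg Hf Hh.
rewrite mulN1r addrC => <-; congr ip.
by apply/funext => x /=; rewrite mulN1r addrC.
Qed.

Lemma ip_zerol h : H h -> ip (fun=> 0) h = 0.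
Proof.
move=> Hh; have := rkhs_ip_lin rk (-1) (rkhs_zero rk) (rkhs_zero rk) Hh.
rewrite [X in _ = X](_ : _ = 0); last by rewrite mulN1r addNr.
move=> e; rewrite -[RHS]e; congr ip.
by apply/funext => x; rewrite mulr0 addr0.
Qed.

Lemma ip_scalel c f h : H f -> H h -> ip (fun x => c * f x) h = c * ip f h.
Proof.
move=> Hf Hh; have := rkhs_ip_lin rk c Hf (rkhs_zero rk) Hh.
rewrite ip_zerol// addr0 => <-; congr ip.
by apply/funext => x /=; rewrite addr0.
Qed.

Lemma ip_subr f g h : H f -> H g -> H h -> ip h (f \- g) = ip h f - ip h g.
Proof.
move=> Hf Hg Hh; rewrite (rkhs_ip_sym rk)//; last exact: rkhs_sub.
by rewrite ip_subl// !(rkhs_ip_sym rk _ Hh).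
Qed.

Lemma ip_sub2 f g : H f -> H g ->
  ip (f \- g) (f \- g) = ip f f - 2 * ip f g + ip g g.
Proof.
move=> Hf Hg; have Hfg := rkhs_sub Hf Hg.
rewrite ip_subl// !ip_subr// (rkhs_ip_sym rk Hg Hf); ring.
Qed.

Lemma rkhs_cauchy_schwarz f g : H f -> H g -> ip f g ^+ 2 <= ip f f * ip g g.
Proof.
move=> Hf Hg; apply: disc_le => [|c]; first exact: (rkhs_ip_ge0 rk).
have Hcg := rkhs_scale c Hg.
have Hl : H (fun x => c * g x + f x) by exact: (rkhs_lin rk).
have := rkhs_ip_ge0 rk Hl.
rewrite (rkhs_ip_lin rk)// (rkhs_ip_sym rk Hg)// (rkhs_ip_sym rk Hf Hl).
rewrite !(rkhs_ip_lin rk)// (rkhs_ip_sym rk Hg Hf).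
by congr (_ <= _); ring.
Qed.

Lemma ip_sub_le f g : H f -> H g ->
  ip (f \- g) (f \- g) <= 2 * ip f f + 2 * ip g g.
Proof.
move=> Hf Hg; have Hg' := rkhs_scale (-1) Hg.
have := rkhs_ip_ge0 rk (rkhs_sub Hf Hg'); rewrite !ip_sub2//.
rewrite (rkhs_ip_sym rk Hf Hg') !ip_scalel// (rkhs_ip_sym rk Hg Hg') ip_scalel//.
rewrite (rkhs_ip_sym rk Hg Hf); move: (ip _ _) (ip _ _) (ip _ _) => a1 a2 a3; lra.
Qed.

Definition felem s : T -> R := fun x => \sum_(p <- s) p.1 * ksection (sval p.2) x.

Lemma rkhs_felem s : H (felem s).
Proof.
rewrite /felem; elim: s => [|p s IH].
  have := rkhs_zero rk; congr H; apply/funext => x; by rewrite big_nil.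
have := rkhs_lin rk p.1 (rkhs_kernel rk (svalP p.2)) IH; congr H.
by apply/funext => x; rewrite big_cons.
Qed.

Lemma ip_felem f s : H f -> ip f (felem s) = \sum_(p <- s) p.1 * f (sval p.2).
Proof.
move=> Hf; elim: s => [|p s IH].
  rewrite big_nil (rkhs_ip_sym rk)//; last exact: rkhs_felem.
  rewrite -(ip_zerol Hf); congr ip; apply/funext => x; by rewrite /felem big_nil.
have Hk := rkhs_kernel rk (svalP p.2).
rewrite big_cons -IH -(rkhs_repr rk Hf (svalP p.2)) (rkhs_ip_sym rk Hf (rkhs_felem _)).
rewrite (rkhs_ip_sym rk Hf Hk) (rkhs_ip_sym rk Hf (rkhs_felem _)).
rewrite -(rkhs_ip_lin rk)//; last exact: rkhs_felem.
by congr ip; apply/funext => x; rewrite /felem big_cons.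
Qed.

Lemma rkhs_kernelC x y : X x -> X y -> K x y = K y x.
Proof.
move=> Xx Xy; have Kx := rkhs_kernel rk Xx; have Ky := rkhs_kernel rk Xy.
have := rkhs_repr rk Ky Xx; rewrite (rkhs_ip_sym rk)// (rkhs_repr rk)//.
by rewrite -!/(ksection _) !ksectionE.
Qed.

Lemma ip_felem2 s t : ip (felem s) (felem t) = cform KU s t.
Proof.
rewrite (ip_felem _ (rkhs_felem s)) /cform exchange_big; apply: eq_bigr => q _.
rewrite /felem mulr_sumr; apply: eq_bigr => p _.
rewrite ksectionE; last exact: (svalP q.2).
by rewrite /subkernel (rkhs_kernelC (svalP q.2) (svalP p.2)); ring.
Qed.

Lemma rkhs_psd : psd KU.
Proof.
split=> [x y|s]; first exact: rkhs_kernelC (svalP x) (svalP y).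
by rewrite -ip_felem2; apply: (rkhs_ip_ge0 rk); exact: rkhs_felem.
Qed.

Lemma rkhs_comb_le f s : H f ->
  (\sum_(p <- s) p.1 * f (sval p.2)) ^+ 2 <= ip f f * cform KU s s.
Proof.
by move=> Hf; rewrite -ip_felem// -ip_felem2 rkhs_cauchy_schwarz//; exact: rkhs_felem.
Qed.

Lemma rkhs_eval_le f x : H f -> X x -> f x ^+ 2 <= ip f f * K x x.
Proof.
move=> Hf Xx; have := rkhs_comb_le [:: (1, exist _ x Xx)] Hf.
by rewrite cform_points big_seq1 mul1r.
Qed.

Lemma felem_eval s x (Xx : X x) : felem s x = ceval KU s (exist _ x Xx).
Proof.
apply: eq_bigr => p _; rewrite ksectionE// /subkernel /=.
by rewrite (rkhs_kernelC Xx (svalP p.2)).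
Qed.

Lemma rkhs_cvg_eval (F : nat -> T -> R) f x : (forall n, H (F n)) -> H f -> X x ->
  (fun n => ip (F n \- f) (F n \- f)) @ \oo --> (0 : R) ->
  (fun n => F n x) @ \oo --> f x.
Proof.
move=> HF Hf Xx h.
have c0 : (fun n => F n x - f x) @ \oo --> (0 : R).
  apply: cvgn_sqr0.
  apply: (@cvgn_squeeze0 _ _ (fun n => ip (F n \- f) (F n \- f) * K x x)) => [n|].
    rewrite ger0_norm ?sqr_ge0//.
    exact: (rkhs_eval_le (rkhs_sub (HF n) Hf) Xx).
  by rewrite -[0](mul0r (K x x)); apply: cvgM => //; exact: cvg_cst.
rewrite -[f x]add0r; under eq_fun do rewrite -[F _ x](subrK (f x)).
by apply: cvgD => //; exact: cvg_cst.
Qed.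

Lemma rkhs_cvg_norm (F : nat -> T -> R) f : (forall n, H (F n)) -> H f ->
  (fun n => ip (F n \- f) (F n \- f)) @ \oo --> (0 : R) ->
  (fun n => ip (F n) (F n)) @ \oo --> ip f f.
Proof.
move=> HF Hf h.
have c0 : (fun n => ip (F n \- f) f) @ \oo --> (0 : R).
  apply: cvgn_sqr0.
  apply: (@cvgn_squeeze0 _ _ (fun n => ip (F n \- f) (F n \- f) * ip f f)) => [n|].
    by rewrite ger0_norm ?sqr_ge0// rkhs_cauchy_schwarz//; exact: rkhs_sub.
  by rewrite -[0](mul0r (ip f f)); apply: cvgM => //; exact: cvg_cst.
rewrite (_ : (fun n => ip (F n) (F n)) = (fun n => ip (F n \- f) (F n \- f) +
   2 * ip (F n \- f) f + ip f f)); last first.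
  apply/funext => n; rewrite ip_sub2// ip_subl//; ring.
rewrite -[X in _ --> X](_ : 0 + 2 * 0 + ip f f = _); last by rewrite mulr0 !add0r.
apply: cvgD; last exact: cvg_cst.
by apply: cvgD => //; apply: cvgM => //; exact: cvg_cst.
Qed.

Definition approximates (s : nat -> seq (R * U)) f : Prop :=
  (fun n => ip (felem (s n) \- f) (felem (s n) \- f)) @ \oo --> (0 : R).

(* A minimizing sequence for the distance to the span of the kernel sections is
   Cauchy, and the limit agrees with [f] at every point by minimality. *)
Lemma rkhs_dense f : H f -> exists c : nat -> seq (R * U), approximates c f.
Proof.
move=> Hf.
pose D s := ip (f \- felem s) (f \- felem s).
have D0 s : 0 <= D s by apply: (rkhs_ip_ge0 rk); apply: rkhs_sub => //; exact: rkhs_felem.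
pose d := inf (range D).
have hd s : d <= D s.
  by apply: ge_inf; [exists 0 => _ [s' _ <-]|exists s].
have /choice[s hs] (n : nat) : exists s, D s < d + n.+1%:R^-1.
  have : has_inf (range D) by split; [exists (D [::]), [::] | exists 0 => _ [s' _ <-]].
  move=> /inf_adherent-/(_ n.+1%:R^-1)[]; first by rewrite invr_gt0.
  by move=> _ [s _ <-]; exists s.
have DE a : D a = ip f f - 2 * (\sum_(p <- a) p.1 * f (sval p.2)) + cform KU a a.
  by rewrite /D ip_sub2 ?ip_felem2 ?(ip_felem _ Hf)//; exact: rkhs_felem.
have HF i := rkhs_felem (s i).
have cF (e : R) : 0 < e -> exists i0, forall i j, (i0 <= i)%N -> (i0 <= j)%N ->
     ip (felem (s i) \- felem (s j)) (felem (s i) \- felem (s j)) < e.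
  move=> e0; have [i0 h0] := harmonic_small (divr_gt0 e0 (ltr0n _ 4) : 0 < e / 4).
  exists i0 => i j /h0 hi /h0 hj.
  rewrite ip_sub2// !ip_felem2.
  (* The midpoint has squared distance at least [d] too, so by the parallelogram law two
     near-minimizers are close to each other. *)
  have := hd (cscale (1 / 2) (s i ++ s j)).
  have := lt_trans (hs i) (ler_ltD (lexx d) hi).
  have := lt_trans (hs j) (ler_ltD (lexx d) hj).
  rewrite !DE big_map big_cat /= cform_scalel cform_scaler cform_catl !cform_catr.
  rewrite (cformC (s j) (s i) rkhs_psd.1).
  have lin (l : seq (R * U)) : \sum_(p <- l) 1 / 2 * p.1 * f (sval p.2) =
      1 / 2 * \sum_(p <- l) p.1 * f (sval p.2).
    by rewrite mulr_sumr; apply: eq_bigr => p _; rewrite mulrA.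
  rewrite !lin; lra.
have [p Hp hp] := rkhs_complete rk HF cF.
have fp x : X x -> f x = p x.
  move=> Xx; have : (p x - f x) ^+ 2 <= 0 * K x x.
    apply: disc_le => [|c].
      exact: (psd_diag_ge0 (exist _ x Xx : U) rkhs_psd).
    have hv := rkhs_cvg_eval HF Hp Xx hp.
    have h1 : (fun n => n.+1%:R^-1 + 2 * c * (felem (s n) x - f x) + c ^+ 2 * K x x) @ \oo -->
              0 + 2 * c * (p x - f x) + c ^+ 2 * K x x.
      apply: cvgD; last exact: cvg_cst.
      apply: cvgD; first exact: cvg_harmonic.
      apply: cvgM; first exact: cvg_cst.
      by apply: cvgB => //; exact: cvg_cst.
    apply: (@cvgn_geP _ 0 _ _ 0 _ h1) => n _.
    (* Moving [s n] by c times the section at x cannot bring the squared distance below [d]; in the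
       limit this is a nonnegative polynomial in c without constant term. *)
    have := hd (s n ++ cscale c [:: (1, exist _ x Xx)]); have := hs n.
    rewrite !DE cform_catl !cform_catr !cform_scalel !cform_scaler.
    rewrite (cformC [:: _] (s n) rkhs_psd.1) cform_points cform_point -felem_eval.
    rewrite big_cat big_map big_seq1 /subkernel /= mulr1.
    move: (ip f f) (\sum_(_ <- _) _) (felem _ _) (cform _ _ _) (K x x) n.+1%:R^-1 (f x).
    by move=> A S E Q k h y; lra.
  rewrite mul0r => h; have : (p x - f x) ^+ 2 == 0 by rewrite eq_le h sqr_ge0.
  by rewrite sqrf_eq0 subr_eq0 => /eqP.
exists s; rewrite /approximates (_ : f = p)//.
rewrite -(rkhs_dom rk Hf) -(rkhs_dom rk Hp); apply/funext => x; rewrite /patch.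
by case: ifPn => //; rewrite inE => /fp.
Qed.

End RkhsTheory.


Section Domination.
Context {R : realType} {T : Type} {I : eqType} (X : set T).
Context (K : T -> T -> R) (H : set (T -> R)) (ip : (T -> R) -> (T -> R) -> R).
Hypothesis rk : is_rkhs X K H ip.
Context (l : seq I) (k : I -> T -> T -> R) (Hk : I -> set (T -> R)).
Context (ipk : I -> (T -> R) -> (T -> R) -> R).
Hypothesis rkk : forall i, is_rkhs X (k i) (Hk i) (ipk i).
Context (om : I -> R) (b : I -> {x : T | X x} -> R) (B : R).
Hypothesis B_ge0 : 0 <= B.
Hypothesis om_gt0 : forall i, i \in l -> 0 < om i.
Hypothesis dom : psd (fun x y => B * subkernel K x y -
  \sum_(i <- l) om i * (b i x * b i y * subkernel (k i) x y)).

(** Positivity of the kernel difference, applied to s m - s n, shows that the weighted combinations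
    are Cauchy in every [Hk i]; applied to s n, it gives the norm inequality, which passes to the
    limits [G i]. All components share the one constant [B]. *)
Lemma rkhs_domination f s : H f -> approximates K ip s f ->
  exists G : I -> T -> R, [/\ forall i, i \in l -> Hk i (G i),
    forall i (x : {x : T | X x}), i \in l ->
      (fun n => ceval (subkernel (k i)) (cweight (b i) (s n)) x) @ \oo --> G i (sval x) &
    \sum_(i <- l) om i * ipk i (G i) (G i) <= B * ip f f].
Proof.
move=> Hf sf.
pose F i n := felem (k i) (cweight (b i) (s n)).
have HF i n : Hk i (F i n) by exact: (rkhs_felem (rkk i)).
pose S n := felem K (s n).
have HS n : H (S n) by exact: (rkhs_felem rk).
have domle (c : seq (R * {x : T | X x})) :
    \sum_(i <- l) om i * cform (subkernel (k i)) (cweight (b i) c) (cweight (b i) c) <=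
    B * cform (subkernel K) c c.
  have := dom.2 c.
  rewrite (_ : cform _ c c = B * cform (subkernel K) c c -
    \sum_(i <- l) om i * cform (subkernel (k i)) (cweight (b i) c) (cweight (b i) c)).
    by rewrite subr_ge0.
  under [in RHS]eq_bigr do rewrite -cform_weight -cform_cmul.
  by rewrite -cform_sum -cform_cmul -cform_kernelB.
have omle (c : seq (R * {x : T | X x})) i : i \in l ->
    om i * cform (subkernel (k i)) (cweight (b i) c) (cweight (b i) c) <=
    B * cform (subkernel K) c c.
  move=> il; apply: le_trans (domle c).
  rewrite (perm_big _ (perm_to_rem il)) big_cons lerDl.
  rewrite big_seq sumr_ge0// => j /mem_rem jl.
  by rewrite mulr_ge0 ?(ltW (om_gt0 jl))//; exact: (rkhs_psd (rkk j)).2.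
have FD i m n : ipk i (F i m \- F i n) (F i m \- F i n) =
    cform (subkernel (k i)) (cweight (b i) (csub (s m) (s n))) (cweight (b i) (csub (s m) (s n))).
  rewrite (ip_sub2 (rkk i))// !(ip_felem2 (rkk i)) /csub /cweight map_cat.
  have -> : [seq (p.1 * b i p.2, p.2) | p <- cscale (-1) (s n)] =
            cscale (-1) (cweight (b i) (s n)).
    by rewrite /cscale /cweight -!map_comp; apply: eq_map => p /=; congr pair; ring.
  rewrite -/(csub _ _) cform_sub (cformC (cweight _ (s n)) _ (rkhs_psd (rkk i)).1).
  ring.
have SD m n : ip (S m \- S n) (S m \- S n) =
    cform (subkernel K) (csub (s m) (s n)) (csub (s m) (s n)).
  rewrite (ip_sub2 rk)// !(ip_felem2 rk) cform_sub (cformC (s n) _ (rkhs_psd rk).1).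
  ring.
have cS (e : R) : 0 < e -> exists n0, forall m n, (n0 <= m)%N -> (n0 <= n)%N ->
    cform (subkernel K) (csub (s m) (s n)) (csub (s m) (s n)) < e.
  move=> e0; have /cvgnP/(_ _ (divr_gt0 e0 (ltr0n _ 4) : 0 < e / 4))[n0 h] := sf.
  exists n0 => m n m0 n0n; rewrite -SD.
  have Sm := rkhs_sub rk (HS m) Hf; have Sn := rkhs_sub rk (HS n) Hf.
  have := h _ m0; have := h _ n0n; rewrite !subr0.
  rewrite (ger0_norm (rkhs_ip_ge0 rk Sm)) (ger0_norm (rkhs_ip_ge0 rk Sn)) -/(S m) -/(S n).
  have -> : S m \- S n = (S m \- f) \- (S n \- f).
    by apply/funext => x /=; ring.
  have := ip_sub_le rk Sm Sn.
  move: (ip _ _) (ip _ _) (ip _ _) => a1 a2 a3; lra.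
have /choice[G hG] (i : I) : exists g, i \in l -> Hk i g /\
    (fun n => ipk i (F i n \- g) (F i n \- g)) @ \oo --> (0 : R).
  have [il|] := boolP (i \in l); last by exists (fun=> 0).
  have [|g Hg gc] := rkhs_complete (rkk i) (HF i); last by exists g.
    move=> e1 e0; have oi := om_gt0 il.
    (* [B + 1] stands in for [B], which may vanish. *)
    have [n0 h] := cS (e1 * om i / (B + 1))
      (divr_gt0 (mulr_gt0 e0 oi) (ltr_wpDl B_ge0 ltr01)).
    exists n0 => m n mn0 nn0; rewrite FD -(ltr_pM2r oi) (mulrC _ (om i)).
    apply: le_lt_trans (omle _ _ il) _.
    have := h _ _ mn0 nn0; rewrite ltr_pdivlMr ?(ltr_wpDl B_ge0 ltr01)//.
    apply: le_lt_trans; rewrite mulrDr mulr1 mulrC lerDl.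
    exact: (rkhs_psd rk).2.
exists G; split.
- by move=> i /hG[].
- move=> i [x Xx] il; have [HG cG] := hG i il.
  have := rkhs_cvg_eval (rkk i) (HF i) HG Xx cG.
  by rewrite /F; under eq_fun do rewrite (felem_eval (rkk i) _ Xx).
- have h1 : (fun n => \sum_(i <- l | i \in l) om i * ipk i (F i n) (F i n)) @ \oo -->
      \sum_(i <- l | i \in l) om i * ipk i (G i) (G i).
    apply: cvgn_sum => i il; have [HG cG] := hG i il.
    by apply: cvgM; [exact: cvg_cst|exact: (rkhs_cvg_norm (rkk i))].
  have h2 : (fun n => B * ip (S n) (S n)) @ \oo --> B * ip f f.
    by apply: cvgM; [exact: cvg_cst|exact: (rkhs_cvg_norm rk)].
  rewrite big_seq; apply: (@cvgn_le _ 0 _ _ _ _ _ h1 h2) => n _.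
  rewrite -big_seq (ip_felem2 rk); apply: le_trans (domle (s n)).
  by apply: ler_sum => i _; rewrite (ip_felem2 (rkk i)).
Qed.

End Domination.

(** * The kernel of the theorem and its weighted products *)

Section Kern.
Context {R : realType}.
Implicit Types (x y s t h : R).

Lemma kernC x y : kern x y = kern y x.
Proof. by rewrite /kern maxC (addrC (x ^+ 2)). Qed.

Lemma kern_le x y : 0 <= x <= 1 -> 0 <= y <= 1 -> `|kern x y| <= 3^-1.
Proof.
move=> /andP[x0 x1] /andP[y0 y1]; rewrite /kern ler_norml.
by case: (leP x y) => h; apply/andP; split; nra.
Qed.

Lemma kern_half : kern (2^-1 : R) 2^-1 = 12^-1.
Proof. by rewrite /kern maxxx; field. Qed.

Lemma kern_lip x x' y : 0 <= x <= 1 -> 0 <= x' <= 1 -> 0 <= y <= 1 ->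
  `|kern x y - kern x' y| <= `|x - x'|.
Proof.
wlog xx' : x x' / x <= x'.
  move=> H hx hx' hy; have [/H|/ltW/H] := leP x x'; first exact.
  by rewrite distrC [X in _ -> _ <= X]distrC; apply.
move=> /andP[x0 x1] /andP[x'0 x'1] /andP[y0 y1].
rewrite [X in _ <= X]distrC [X in _ <= X]ger0_norm ?subr_ge0// ler_norml /kern.
by case: (leP x y) => h1; case: (leP x' y) => h2; apply/andP; split; nra.
Qed.

(** An antiderivative of k(., y). It takes the value - y^2 / 2 at both 0 and 1, which is the
    vanishing of the integral of k. *)
Let kern_prim y t := t / 3 + t ^+ 3 / 6 + y ^+ 2 * t / 2
  - Num.max t y ^+ 2 / 2 - y * Num.min t y.

(** A first-order Taylor expansion with quadratic remainder; the cases say whether the corner of k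
    at y lies beyond the step, inside it or before it. *)
Let kern_prim_step y s h : 0 <= s -> 0 <= h -> s + h <= 1 -> 0 <= y <= 1 ->
  `|kern_prim y (s + h) - kern_prim y s - h * kern s y| <= h ^+ 2 / 2.
Proof.
move=> s0 h0 sh /andP[y0 y1].
have p0 : 0 <= h ^+ 2 * (3 * s + h) / 6.
  by rewrite divr_ge0// mulr_ge0 ?sqr_ge0// addr_ge0// mulr_ge0.
have p1 : h ^+ 2 * (3 * s + h) / 6 <= h ^+ 2 / 2.
  have -> : h ^+ 2 / 2 = h ^+ 2 * 3 / 6 by field.
  by rewrite ler_wpM2r// ler_wpM2l ?sqr_ge0//; lra.
case: (leP s y) => sy; case: (leP (s + h) y) => shy; rewrite /kern_prim /kern.
- rewrite (max_idPr sy) (max_idPr shy) (min_idPl sy) (min_idPl shy) ler_norml.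
  rewrite [X in _ <= X <= _](_ : _ = h ^+ 2 * (3 * s + h) / 6); last by field.
  by rewrite p1 andbT; lra.
- rewrite (max_idPr sy) (max_idPl (ltW shy)) (min_idPl sy) (min_idPr (ltW shy)) ler_norml.
  rewrite [X in _ <= X <= _](_ : _ = h ^+ 2 * (3 * s + h) / 6 - (s + h - y) ^+ 2 / 2);
    last by field.
  have : (s + h - y) ^+ 2 <= h ^+ 2 by rewrite ler_pXn2r ?nnegrE//; lra.
  by have := sqr_ge0 (s + h - y); move=> *; apply/andP; split; lra.
- by move: sy shy; lra.
- have sy' := ltW sy; have shy' := ltW shy.
  rewrite (max_idPl sy') (max_idPl shy') (min_idPr sy') (min_idPr shy') ler_norml.
  rewrite [X in _ <= X <= _](_ : _ = h ^+ 2 * (3 * s + h) / 6 - h ^+ 2 / 2); last by field.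
  by have := sqr_ge0 h; move=> *; apply/andP; split; lra.
Qed.

(** The antiderivative telescopes to 0 over [0, 1], and each of the n steps costs at most 1/(2 n^2).
    This discrete form of the vanishing integral serves the scrambling as well as the product
    measure. *)
Lemma kern_grid_mean n y : (0 < n)%N -> 0 <= y <= 1 ->
  `|n%:R^-1 * \sum_(i < n) kern (i%:R / n%:R) y| <= n%:R^-1.
Proof.
move=> n0 y01; have nR : 0 < n%:R :> R by rewrite ltr0n.
have tele : \sum_(i < n) (kern_prim y (i.+1%:R / n%:R) - kern_prim y (i%:R / n%:R)) = 0.
  rewrite -(big_mkord xpredT (fun i => kern_prim y (i.+1%:R / n%:R) - kern_prim y (i%:R / n%:R))).
  rewrite telescope_sumr// divff ?gt_eqF// mul0r /kern_prim.
  by case/andP: y01 => y0 y1; rewrite (max_idPl y1) (max_idPr y0) (min_idPr y1) (min_idPl y0); field.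
have -> : n%:R^-1 * \sum_(i < n) kern (i%:R / n%:R) y = - \sum_(i < n)
   (kern_prim y (i.+1%:R / n%:R) - kern_prim y (i%:R / n%:R) - n%:R^-1 * kern (i%:R / n%:R) y).
  by rewrite [in RHS]sumrB tele sub0r opprK mulr_sumr.
rewrite normrN; apply: le_trans (ler_norm_sum _ _ _) _.
rewrite [leRHS](_ : _ = \sum_(i < n) (n%:R^-1 ^+ 2)); last first.
  by rewrite sumr_const card_ord -mulr_natr; field; rewrite gt_eqF.
apply: ler_sum => i _; apply: (@le_trans _ _ (n%:R^-1 ^+ 2 / 2)); last first.
  by have := sqr_ge0 (n%:R^-1 : R); lra.
rewrite -natr1 mulrDl mul1r; apply: kern_prim_step => //.
rewrite -{2}(mul1r n%:R^-1) -mulrDl ler_pdivrMr// mul1r natr1 ler_nat.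
exact: ltn_ord.
Qed.

Let msum (l : seq (R * R)) := \sum_(p <- l) \sum_(q <- l) p.1 * q.1 * Num.min p.2 q.2.

Let msum_cons c x (l : seq (R * R)) : all (fun q => x <= q.2) l ->
  msum ((c, x) :: l) = c ^+ 2 * x + 2 * c * x * (\sum_(q <- l) q.1) + msum l.
Proof.
move=> /allP xl; rewrite /msum big_cons big_cons /= minxx.
have E1 : \sum_(q <- l) c * q.1 * Num.min x q.2 = c * x * \sum_(q <- l) q.1.
  rewrite mulr_sumr big_seq [RHS]big_seq; apply: eq_bigr => q /xl h.
  by rewrite (min_idPl h); ring.
have E2 : \sum_(p <- l) \sum_(q <- (c, x) :: l) p.1 * q.1 * Num.min p.2 q.2 =
   c * x * (\sum_(q <- l) q.1) +
   \sum_(p <- l) \sum_(q <- l) p.1 * q.1 * Num.min p.2 q.2.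
  rewrite -E1 -big_split /= big_seq [RHS]big_seq; apply: eq_bigr => p /xl h.
  by rewrite big_cons /= minC (min_idPl h); ring.
by rewrite E1 E2; ring.
Qed.

(* The left-hand side is [\int_z^1 (\sum_p p.1 1_(t < p.2) - C (1 - t))^2 dt]; the part
   of the integral up to the smallest point is an explicit sum of squares. *)
Let kern_potential_ge0 (C z : R) (l : seq (R * R)) :
  sorted (fun p q => p.2 <= q.2) l -> all (fun q => (z <= q.2) && (q.2 <= 1)) l -> z <= 1 ->
  0 <= msum l - z * (\sum_(p <- l) p.1) ^+ 2
    - 2 * C * (\sum_(p <- l) p.1 * p.2 - z * (\sum_(p <- l) p.1)
               - (\sum_(p <- l) p.1 * p.2 ^+ 2 - z ^+ 2 * (\sum_(p <- l) p.1)) / 2)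
    + C ^+ 2 * (1 - z) ^+ 3 / 3.
Proof.
elim: l z => [|[c x] l IH] z /= srt al z1.
  rewrite /msum !big_nil expr0n !(mulr0, subr0, mul0r) add0r.
  by rewrite divr_ge0// mulr_ge0 ?sqr_ge0// exprn_ge0// subr_ge0.
case/andP: al => /andP[zx x1] al.
have /allP xl : all (fun q => x <= q.2) l.
  have := srt; rewrite path_sortedE; first by case/andP.
  by move=> a b e; exact: le_trans.
have := IH x (path_sorted srt).
rewrite (_ : all _ l); last first.
  by apply/allP => q ql; rewrite xl//=; have /allP/(_ _ ql)/andP[] := al.
move=> /(_ isT x1) IHx; apply: le_trans IHx _.
rewrite msum_cons; last exact/allP.
rewrite !big_cons /= -subr_ge0.
move: (msum l) (\sum_(p <- l) p.1) (\sum_(p <- l) p.1 * p.2) (\sum_(p <- l) p.1 * p.2 ^+ 2).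
move=> m S1 S2 S3.
rewrite [X in 0 <= X](_ : _ = (x - z) * ((c + S1 - C * ((1 - z) - (x - z) / 2)) ^+ 2
   + C ^+ 2 * (x - z) ^+ 2 / 12)); last by field.
rewrite mulr_ge0 ?subr_ge0// addr_ge0 ?sqr_ge0// divr_ge0// mulr_ge0 ?sqr_ge0//.
Qed.

(** k(x, y) is the integral over t in [0, 1] of (1_(t < x) - (1 - t)) (1_(t < y) - (1 - t)); hence
    the quadratic form is the preceding expression with z = 0 and C the sum of the coefficients.
    Sorting the points prepares the induction behind that expression. *)
Lemma psd_kern (T : Type) (f : T -> R) : (forall a, 0 <= f a <= 1) ->
  psd (fun a b : T => kern (f a) (f b)).
Proof.
move=> f01; split=> [a b|c]; first exact: kernC.
pose l := [seq (p.1, f p.2) | p <- c].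
have -> : cform (fun a b : T => kern (f a) (f b)) c c =
    \sum_(p <- l) \sum_(q <- l) p.1 * q.1 * kern p.2 q.2.
  by rewrite big_map; apply: eq_bigr => p _; rewrite big_map.
have l01 : all (fun q => (0 <= q.2) && (q.2 <= 1)) l.
  by rewrite /l; elim: c {l} => //= p c ->; rewrite f01.
have tot : total (fun p q : R * R => p.2 <= q.2) by move=> p q; exact: le_total.
pose l' := sort (fun p q : R * R => p.2 <= q.2) l.
have ll' : perm_eq l' l by rewrite perm_sort.
have := @kern_potential_ge0 (\sum_(p <- l) p.1) 0 l' (sort_sorted tot l).
rewrite (perm_all _ ll') => /(_ l01 ler01).
rewrite /msum !(perm_big _ ll') /=.
congr (_ <= _).
have -> : \sum_(p <- l) \sum_(q <- l) p.1 * q.1 * kern p.2 q.2 =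
    \sum_(p <- l) \sum_(q <- l) p.1 * q.1 * Num.min p.2 q.2 +
    3^-1 * ((\sum_(p <- l) p.1) * (\sum_(p <- l) p.1)) -
    2 * (\sum_(p <- l) p.1) * (\sum_(p <- l) p.1 * p.2) +
    (\sum_(p <- l) p.1) * (\sum_(p <- l) p.1 * p.2 ^+ 2).
  have E p q : p.1 * q.1 * kern p.2 q.2 = p.1 * q.1 * Num.min p.2 q.2 +
      (3^-1 * (p.1 * q.1) - p.1 * p.2 * q.1 - p.1 * (q.1 * q.2) +
       2^-1 * (p.1 * p.2 ^+ 2 * q.1) + 2^-1 * (p.1 * (q.1 * q.2 ^+ 2))).
    by rewrite /kern; case: leP => _; field.
  under eq_bigr do under eq_bigr do rewrite E.
  under eq_bigr do rewrite !big_split /= !sumrN -!mulr_sumr.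
  rewrite !big_split /= !sumrN -!mulr_sumr -!mulr_suml.
  by field.
under eq_bigr => p _ do rewrite (perm_big _ ll').
by field.
Qed.

End Kern.

Section InitialSegments.
Local Open Scope fset_scope.

Lemma mem_initseg n j : (j \in initseg n) = (j < n)%N.
Proof. by rewrite /initseg !inE mem_iota. Qed.

Lemma card_initseg n : #|` initseg n| = n.
Proof. by rewrite /initseg card_fseq undup_id ?iota_uniq// size_iota. Qed.

Lemma initsegS n : initseg n.+1 = n |` initseg n.
Proof. by apply/fsetP => j; rewrite in_fset1U !mem_initseg ltnS leq_eqVlt. Qed.

Lemma initseg0 : initseg 0 = fset0.
Proof. by apply/fsetP => j; rewrite mem_initseg. Qed.

Lemma initseg_sub m n : (initseg m `<=` initseg n) = (m <= n)%N.
Proof.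
apply/fsubsetP/idP => [h|mn j].
  by case: m h => // m h; have := h m; rewrite !mem_initseg ltnSn; apply.
by rewrite !mem_initseg => /leq_trans; apply.
Qed.

Lemma sub_initseg (w : {fset nat}) n : (w `<=` initseg n) = (\max_(j <- w) j.+1 <= n)%N.
Proof.
apply/fsubsetP/bigmax_leqP_seq => [h j jw _|h j jw].
  by have := h j jw; rewrite mem_initseg.
by rewrite mem_initseg; apply: h.
Qed.

Lemma perm_fpowerset_initsegS n : perm_eq (fpowerset (initseg n.+1))
  (fpowerset (initseg n) ++ [seq n |` w | w : {fset nat} <- fpowerset (initseg n)]).
Proof.
have nw (w : {fset nat}) : w \in fpowerset (initseg n) -> n \notin w.
  by rewrite fpowersetE => /fsubsetP h; apply/negP => /h; rewrite mem_initseg ltnn.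
apply: uniq_perm; first exact: fset_uniq.
  rewrite cat_uniq fset_uniq /= map_inj_in_uniq ?fset_uniq ?andbT.
    apply/hasPn => _ /mapP[w wn ->]; apply/negP => /nw.
    by rewrite !inE eqxx.
  move=> v w /nw nv /nw nw' e; apply/fsetP => j; have [->|jn] := eqVneq j n.
    by rewrite (negbTE nv) (negbTE nw').
  by have /fsetP/(_ j) := e; rewrite !inE (negbTE jn).
move=> w; rewrite mem_cat fpowersetE; apply/idP/orP => [wn|[|]].
- have [nw'|nw'] := boolP (n \in w); last first.
    left; rewrite fpowersetE; apply/fsubsetP => j jw.
    have := fsubsetP wn _ jw; rewrite !mem_initseg ltnS leq_eqVlt => /orP[/eqP e|//].
    by rewrite -e jw in nw'.
  right; apply/mapP; exists (w `\ n); last by rewrite fsetD1K.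
  rewrite fpowersetE; apply/fsubsetP => j; rewrite in_fsetD1 => /andP[jn jw].
  have := fsubsetP wn _ jw; rewrite !mem_initseg ltnS leq_eqVlt.
  by rewrite (negbTE jn).
- by rewrite fpowersetE => /fsubset_trans; apply; rewrite initseg_sub.
- move=> /mapP[v vn ->]; rewrite initsegS.
  by apply: fsetUS; rewrite -fpowersetE.
Qed.

End InitialSegments.

(** * Sums over finite sets of coordinates and infinite products *)

Section PowersetSums.
Context {R : realType}.
Implicit Types (z : nat -> R).

Lemma big_fpowerset_initsegS (F : {fset nat} -> R) n :
  \sum_(w <- fpowerset (initseg n.+1)) F w =
  \sum_(w <- fpowerset (initseg n)) F w + \sum_(w <- fpowerset (initseg n)) F (n |` w)%fset.
Proof. by rewrite (perm_big _ (perm_fpowerset_initsegS n)) big_cat big_map. Qed.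

Lemma prod_fsetU1_initseg z n (w : {fset nat}) : w \in fpowerset (initseg n) ->
  \prod_(j <- (n |` w)%fset) z j = z n * \prod_(j <- w) z j.
Proof.
rewrite fpowersetE => /fsubsetP h; rewrite big_fsetU1//.
by apply/negP => /h; rewrite mem_initseg ltnn.
Qed.

Lemma sum_fpowerset_prod z n :
  \sum_(w <- fpowerset (initseg n)) \prod_(j <- w) z j = \prod_(j < n) (1 + z j).
Proof.
elim: n => [|n IH].
  by rewrite initseg0 fpowerset0 big_seq_fset1 big_seq_fset0 big_ord0.
rewrite big_fpowerset_initsegS big_ord_recr /= -IH mulrDr mulr1; congr (_ + _).
rewrite mulr_suml big_seq [RHS]big_seq; apply: eq_bigr => w /prod_fsetU1_initseg ->.
by rewrite mulrC.
Qed.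

Lemma weight_powR (g : nat -> R) (c e : R) (w : {fset nat}) : (forall j, 0 <= g j) ->
  weight g w `^ e * c ^+ #|` w|%fset = \prod_(j <- w) (c * g j `^ e).
Proof.
move=> g0; rewrite /weight; elim: (enum_fset w) => [|j l IH].
  by rewrite !big_nil powR1 mulr1.
by rewrite !big_cons powRM ?prodr_ge0// -IH /= exprS; ring.
Qed.

(** Every set in the sum consists of z and a subset of the coordinates below z, so the sum factors.
    It depends on w through z = max w only, which makes bounds uniform in w possible. *)
Lemma weight_sumE (g : nat -> R) b (tau : R) (w : {fset nat}) :
  (forall j, 0 <= g j) -> let z := \max_(j <- w) j in
  weight_sum g b tau w = constC b tau^-1 * g z `^ tau^-1 *
    \prod_(j < z) (1 + constC b tau^-1 * g j `^ tau^-1).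
Proof.
move=> g0 z; rewrite /weight_sum -/z.
under eq_bigr do rewrite weight_powR//.
rewrite big_mkcond big_fpowerset_initsegS.
rewrite big_seq big1 ?add0r => [|v]; last first.
  rewrite fpowersetE => /fsubsetP h; case: ifPn => // /h.
  by rewrite mem_initseg ltnn.
rewrite -(sum_fpowerset_prod (fun j => constC b tau^-1 * g j `^ tau^-1)) mulr_sumr.
rewrite big_seq [RHS]big_seq; apply: eq_bigr => v vz.
by rewrite !inE eqxx /= prod_fsetU1_initseg.
Qed.

(** Any finite family of finite sets lies in the powerset of some initial segment, so these
    powersets exhaust the supremum that defines the sum. *)
Lemma esum_cvg_fpowerset (h : {fset nat} -> R) : (forall w, 0 <= h w) ->
  (\esum_(w in [set: {fset nat}]) (h w)%:E < +oo)%E ->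
  (fun n => \sum_(w <- fpowerset (initseg n)) h w) @ \oo -->
  fine (\esum_(w in [set: {fset nat}]) (h w)%:E).
Proof.
move=> h0 hoo; set E := (\esum_(_ in _) _)%E.
have E0 : (0 <= E)%E by apply: esum_ge0 => w _; rewrite lee_fin.
have Efin : E \is a fin_num by rewrite ge0_fin_numE.
have sumE (l : {fset {fset nat}}) : ((\sum_(w <- l) h w)%:E <= E)%E.
  apply: esum_ge; exists [set` l].
    by split; [exact: finite_fset|].
  by rewrite -fsbig_seq ?fset_uniq// sumEFin.
apply/cvgnP => e e0.
have [A [finA _] hA] : exists2 A : set {fset nat}, fsets setT A &
    (E - e%:E < \sum_(w \in A) (h w)%:E)%E.
  have : (E - e%:E < E)%E by rewrite lteBlDr// lteDl// lte_fin.
  rewrite {2}/E /esum => /ereal_sup_gt[_ [A sA <-]] hA.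
  by exists A.
pose N := \max_(w <- fset_set A) \max_(j <- (w : {fset nat})) j.+1.
exists N => n Nn.
have le1 : \sum_(w <- fset_set A) h w <= \sum_(w <- fpowerset (initseg n)) h w.
  have sub : (fset_set A `<=` fpowerset (initseg n))%fset.
    apply/fsubsetP => w wA; rewrite fpowersetE sub_initseg (leq_trans _ Nn)//.
    exact: (leq_bigmax_seq (F := fun w : {fset nat} => \max_(j <- w) j.+1) w wA).
  rewrite (big_fsetID _ (mem (fset_set A)) (fpowerset (initseg n))) /=.
  rewrite (_ : [fset x in fpowerset (initseg n) | x \in fset_set A]%fset = fset_set A).
    by rewrite lerDl sumr_ge0.
  apply/fsetP => w; rewrite !inE /= andbC; case: (boolP (w \in fset_set A)) => //= wA.
  exact: (fsubsetP sub).
move: hA; rewrite fsbig_finite// sumEFin -(fineK Efin) -EFinB lte_fin => hA.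
have := sumE (fpowerset (initseg n)); rewrite -(fineK Efin) lee_fin => le2.
rewrite distrC ger0_norm ?subr_ge0// ltrBlDl -ltrBlDr.
exact: lt_le_trans hA le1.
Qed.

Lemma ssum_cvg_fpowerset (f : {fset nat} -> R) :
  (\esum_(w in [set: {fset nat}]) `|f w|%:E < +oo)%E ->
  (fun n => \sum_(w <- fpowerset (initseg n)) f w) @ \oo --> ssum f.
Proof.
move=> foo.
have lt_oo (h : {fset nat} -> R) : (forall w, 0 <= h w <= `|f w|) ->
    (\esum_(w in [set: {fset nat}]) (h w)%:E < +oo)%E.
  move=> hf; apply: le_lt_trans foo; apply: le_esum => w _.
  by rewrite lee_fin; case/andP: (hf w).
have p1 w : 0 <= Num.max (f w) 0 <= `|f w|.
  by rewrite le_max lexx orbT/= ge_max ler_norm normr_ge0.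
have p2 w : 0 <= Num.max (- f w) 0 <= `|f w|.
  by rewrite le_max lexx orbT/= ge_max -normrN ler_norm normr_ge0.
have h1 := esum_cvg_fpowerset (fun w => proj1 (andP (p1 w))) (lt_oo _ p1).
have h2 := esum_cvg_fpowerset (fun w => proj1 (andP (p2 w))) (lt_oo _ p2).
rewrite (_ : (fun n => _) = (fun n => \sum_(w <- fpowerset (initseg n)) Num.max (f w) 0 -
   \sum_(w <- fpowerset (initseg n)) Num.max (- f w) 0)); first exact: cvgB.
apply/funext => n /=; rewrite -sumrB; apply: eq_bigr => w _.
by case: (leP (f w) 0) => ?; case: (leP (- f w) 0) => ?; lra.
Qed.

(** The kernel, defined as a sum over all finite sets, thereby becomes a limit of finite products;
    its factorization and its positivity are read off from these products. *)
Lemma ssum_prod_cvg (G z : nat -> R) :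
  (\esum_(u in [set: {fset nat}]) (weight G u)%:E < +oo)%E ->
  (forall j, `|z j| <= G j) ->
  (fun n => \prod_(j < n) (1 + z j)) @ \oo --> ssum (fun u : {fset nat} => \prod_(j <- u) z j).
Proof.
move=> Goo zG; under eq_fun do rewrite -sum_fpowerset_prod.
apply: ssum_cvg_fpowerset; apply: le_lt_trans Goo; apply: le_esum => w _.
rewrite lee_fin normr_prod /weight; apply: ler_prod => j _.
by rewrite normr_ge0 zG.
Qed.

End PowersetSums.

Lemma cvgn_eq {R : realType} n0 (u v : nat -> R) (l m : R) :
  (forall n, (n0 <= n)%N -> u n = v n) -> u @ \oo --> l -> v @ \oo --> m -> l = m.
Proof.
move=> uv ul vm; apply/eqP; rewrite eq_le; apply/andP; split.
  by apply: (cvgn_le (n0 := n0) _ ul vm) => n /uv ->.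
by apply: (cvgn_le (n0 := n0) _ vm ul) => n /uv ->.
Qed.

(** The pivot cleared of its denominator: the later identities between kernels become polynomial. *)
Lemma psd_pivot_mul {R : realType} {T : Type} (K : T -> T -> R) p : psd K ->
  psd (fun x y => K p p * K x y - K p x * K p y).
Proof.
move=> pK; have [KC K0] := pK; split=> [x y|s]; first by rewrite (KC x) (mulrC (K p x)).
rewrite (_ : cform _ s s = K p p * cform K s s - ceval K s p ^+ 2).
  rewrite subr_ge0; have := psd_cauchy_schwarz s [:: (1, p)] pK.
  by rewrite cform_point cform_points mulrC.
have -> : ceval K s p ^+ 2 = cform (fun x y => K p x * K p y) s s.
  rewrite expr2 mulr_suml; apply: eq_bigr => i _; rewrite mulr_sumr; apply: eq_bigr => j _.
  by rewrite (KC i.2) (KC j.2); ring.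
by rewrite cform_kernelB cform_cmul.
Qed.

(** Setting weights to 0, instead of shifting indices, keeps the tail kernel an instance of [kernK]
    on the same cube. *)
Definition tailw {R : realType} (g : nat -> R) (L j : nat) : R := if (j < L)%N then 0 else g j.

Definition halves {R : realType} : nat -> R := fun=> 2^-1.

Definition midprod {R : realType} (g : nat -> R) (L1 L2 : nat) (x y : nat -> R) : R :=
  \prod_(L1 <= j < L2) (1 + g j * kern (x j) (y j)).

(** * Factorization and positivity of the weighted kernel *)

Section WeightedKernel.
Context {R : realType}.
Implicit Types (x y : nat -> R).

Lemma cube_halves : @cube R halves.
Proof. by move=> j; rewrite /halves; apply/andP; split; lra. Qed.

Lemma cube_splice v x y : @cube R x -> @cube R y -> @cube R (splice v x y).
Proof. by move=> hx hy j; rewrite /splice; case: ifP. Qed.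

Context (g : nat -> R).
Hypothesis g_ge0 : forall j, 0 <= g j.
Hypothesis g_summable : (\esum_(u in [set: {fset nat}]) (weight g u)%:E < +oo)%E.

Lemma weight_ge0 w : 0 <= weight g w.
Proof. by apply: prodr_ge0. Qed.

Lemma kern_prod_le w x y : @cube R x -> @cube R y -> `|kern_prod w x y| <= 1.
Proof.
move=> hx hy; rewrite normr_prod -[leRHS](@big1 R 1 *%R _ w xpredT (fun=> 1))//.
apply: ler_prod => j _; rewrite normr_ge0/= (le_trans (kern_le (hx j) (hy j)))//.
lra.
Qed.

(** The products of k are bounded by 1 on the cube and the weights are summable, so the sum defining
    the domain is finite at every point of the cube; in particular the anchor is admissible. *)
Lemma domK_cube : domK g = @cube R.
Proof.
apply/seteqP; split=> [x []//|x hx]; split => //=.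
apply: le_lt_trans g_summable; apply: le_esum => w _; rewrite lee_fin.
rewrite -[leRHS]mulr1 ler_wpM2l ?weight_ge0//.
exact: le_trans (ler_norm _) (kern_prod_le w hx hx).
Qed.

Lemma tailw_ge0 L j : 0 <= tailw g L j.
Proof. by rewrite /tailw; case: ifP. Qed.

Lemma tailw0 : tailw g 0 = g.
Proof. by apply/funext => j. Qed.

Lemma tailw_summable L : (\esum_(u in [set: {fset nat}]) (weight (tailw g L) u)%:E < +oo)%E.
Proof.
apply: le_lt_trans g_summable; apply: le_esum => w _; rewrite lee_fin.
apply: ler_prod => j _; rewrite tailw_ge0/=.
by rewrite /tailw; case: ifP.
Qed.

Lemma kernK_cvg L x y : @cube R x -> @cube R y ->
  (fun n => \prod_(0 <= j < n) (1 + tailw g L j * kern (x j) (y j))) @ \oo -->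
  kernK (tailw g L) x y.
Proof.
move=> hx hy; under eq_fun do rewrite big_mkord.
rewrite /kernK (_ : (fun u => _) =
  (fun u : {fset nat} => \prod_(j <- u) (tailw g L j * kern (x j) (y j)))).
  apply: (ssum_prod_cvg (tailw_summable L)) => j.
  rewrite normrM ger0_norm ?tailw_ge0// ler_piMr ?tailw_ge0//.
  by apply: le_trans (kern_le (hx j) (hy j)) _; lra.
by apply/funext => u; rewrite /weight /kern_prod -big_split.
Qed.

Lemma prod_tailw L n x y : (L <= n)%N ->
  \prod_(0 <= j < n) (1 + tailw g L j * kern (x j) (y j)) = midprod g L n x y.
Proof.
move=> Ln; rewrite (big_cat_nat (n := L))//= big_nat big1 ?mul1r => [|j /andP[_ jL]].
  by rewrite /midprod big_nat [RHS]big_nat; apply: eq_bigr => j /andP[Lj _];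
    rewrite /tailw ltnNge Lj.
by rewrite /tailw jL mul0r addr0.
Qed.

Lemma kernK_midprod_cvg L x y : @cube R x -> @cube R y ->
  (fun n => midprod g L (maxn L n) x y) @ \oo --> kernK (tailw g L) x y.
Proof.
move=> hx hy; apply/cvgnP => e e0.
have /cvgnP/(_ e e0)[n0 hn] := @kernK_cvg L _ _ hx hy.
exists (maxn n0 L) => n; rewrite geq_max => /andP[n0n Ln].
by rewrite (maxn_idPr Ln) -prod_tailw//; exact: hn.
Qed.

Lemma kernK_split L1 L2 x y : (L1 <= L2)%N -> @cube R x -> @cube R y ->
  kernK (tailw g L1) x y = midprod g L1 L2 x y * kernK (tailw g L2) x y.
Proof.
move=> L12 hx hy.
have h2 : (fun n => midprod g L1 L2 x y *
    \prod_(0 <= j < n) (1 + tailw g L2 j * kern (x j) (y j))) @ \oo -->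
    midprod g L1 L2 x y * kernK (tailw g L2) x y.
  by apply: cvgM; [exact: cvg_cst|exact: kernK_cvg].
apply: (cvgn_eq (n0 := L2) _ (@kernK_cvg L1 _ _ hx hy) h2) => n L2n.
rewrite !prod_tailw// ?(leq_trans L12)//.
by rewrite /midprod -big_cat_nat.
Qed.

Lemma midprod_splice L x y : midprod g 0 L (splice (initseg L) x halves) y = midprod g 0 L x y.
Proof.
rewrite /midprod big_nat [RHS]big_nat; apply: eq_bigr => j /andP[_ jL].
by rewrite /splice mem_initseg jL.
Qed.

Lemma kernK_splice_tail L x y :
  kernK (tailw g L) (splice (initseg L) x halves) y = kernK (tailw g L) halves y.
Proof.
rewrite /kernK; congr ssum; apply/funext => u; rewrite /weight /kern_prod -!big_split /=.
apply: eq_bigr => j _; rewrite /tailw /splice mem_initseg.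
by case: ifP => // _; rewrite !mul0r.
Qed.

Lemma kernK_splice L x y : @cube R x -> @cube R y ->
  kernK g (splice (initseg L) x halves) y =
  midprod g 0 L x y * kernK (tailw g L) halves y.
Proof.
move=> hx hy; rewrite -{1}tailw0 (kernK_split (leq0n L))//.
  by rewrite midprod_splice kernK_splice_tail.
exact: (cube_splice _ hx cube_halves).
Qed.

Lemma midprod_sum L x y : midprod g 0 L x y =
  \sum_(w <- fpowerset (initseg L)) weight g w * kern_prod w x y.
Proof.
rewrite /midprod big_mkord -(sum_fpowerset_prod (fun j => g j * kern (x j) (y j))).
by apply: eq_bigr => w _; rewrite big_split.
Qed.

Lemma midprod_halves L1 L2 : midprod g L1 L2 halves halves =
  \prod_(L1 <= j < L2) (1 + g j / 12).
Proof. by apply: eq_bigr => j _; rewrite /halves kern_half. Qed.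

Lemma midprod_halves_ge1 L1 L2 : 1 <= midprod g L1 L2 halves halves.
Proof.
rewrite midprod_halves big_seq.
apply: (big_ind (fun z => 1 <= z)) => // [a c a1 c1|j _].
  by rewrite -[1]mulr1 ler_pM.
by rewrite lerDl divr_ge0.
Qed.

Local Notation U := {x : nat -> R | @cube R x}.

Lemma psd_kern_coord j : psd (fun x y : U => kern (sval x j) (sval y j)).
Proof. by apply: psd_kern => x; exact: (svalP x). Qed.

Lemma psd_kern_prod w : psd (subkernel (X := @cube R) (kern_prod w)).
Proof. by apply: (@psd_prod R U nat w) => j; exact: psd_kern_coord. Qed.

Lemma psd_midprod L1 L2 : psd (subkernel (X := @cube R) (midprod g L1 L2)).
Proof.
apply: (@psd_prod R U nat (index_iota L1 L2)) => j.
apply: psd_add; first exact: psd_cst.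
by apply: psd_cmul => //; exact: psd_kern_coord.
Qed.

(** With P the product minus 1 so far and q the new term, the next value is P (1 + q) + q, a sum of
    products of positive kernels. *)
Lemma psd_midprod_sub1 L1 L2 :
  psd (fun x y : U => midprod g L1 L2 (sval x) (sval y) - 1).
Proof.
rewrite /midprod /index_iota; elim: (iota _ _) => [|j l IH].
  have := @psd_cst R U 0 (lexx 0); congr psd.
  by apply/funext => x; apply/funext => y; rewrite big_nil subrr.
have pj := psd_cmul (g_ge0 j) (psd_kern_coord j).
have := psd_add (psd_mul IH (psd_add (@psd_cst R U _ ler01) pj)) pj; congr psd.
by apply/funext => x; apply/funext => y; rewrite big_cons; ring.
Qed.

Lemma psd_kernK_tail L : psd (subkernel (X := @cube R) (kernK (tailw g L))).
Proof.
apply: (psd_cvg (K := fun n => subkernel (X := @cube R) (midprod g L (maxn L n)))) => [n|x y].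
  exact: psd_midprod.
exact: kernK_midprod_cvg (svalP x) (svalP y).
Qed.

Lemma psd_kernK_tail_sub1 L :
  psd (fun x y : U => kernK (tailw g L) (sval x) (sval y) - 1).
Proof.
apply: (psd_cvg (K := fun n (x y : U) => midprod g L (maxn L n) (sval x) (sval y) - 1)) => [n|x y].
  exact: psd_midprod_sub1.
by apply: cvgB; [exact: kernK_midprod_cvg (svalP x) (svalP y)|exact: cvg_cst].
Qed.

(** What anchoring leaves of the coordinates from [L] on, as a function of the second argument. Its
    value [kconst L] at the anchor is the product of 1 + g_j / 12 over j >= L. *)
Definition kappa L (x : U) : R := kernK (tailw g L) halves (sval x).
Definition kconst L : R := kernK (tailw g L) halves halves.

Lemma kconst_ge1 L : 1 <= kconst L.
Proof.
apply: (@cvgn_geP _ 0 _ _ 1 _ (@kernK_midprod_cvg L _ _ cube_halves cube_halves)) => n _.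
exact: midprod_halves_ge1.
Qed.

Lemma kconst_split L1 L2 : (L1 <= L2)%N ->
  kconst L1 = midprod g L1 L2 halves halves * kconst L2.
Proof. by move=> L12; apply: kernK_split => //; exact: cube_halves. Qed.

Lemma kconst_anti L1 L2 : (L1 <= L2)%N -> kconst L2 <= kconst L1.
Proof.
move=> /kconst_split ->; rewrite ler_peMl ?midprod_halves_ge1//.
by apply: le_trans (kconst_ge1 _).
Qed.

Let ahalf : U := exist _ halves cube_halves.

(** A section K(., y) has integral 1, whereas its anchored version has mean [kappa L y]; thus
    [kappa L - 1] represents the truncation bias. The difference is the pivot at the anchor of the
    tail kernel minus 1, plus two positive kernels with the factor [kconst L - 1]. *)
Lemma psd_bias L : psd (fun x y : U => (kconst L - 1) * kernK g (sval x) (sval y) -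
  (kappa L x - 1) * (kappa L y - 1)).
Proof.
have p1 := psd_pivot_mul ahalf (psd_kernK_tail_sub1 L).
have c1 : 0 <= kconst L - 1 by rewrite subr_ge0 kconst_ge1.
have p2 := psd_mul (psd_midprod_sub1 0 L) (psd_kernK_tail L).
have := psd_add (psd_add p1 (@psd_cst R U _ c1)) (psd_cmul c1 p2); congr psd.
apply/funext => x; apply/funext => y.
rewrite -{3}tailw0 (kernK_split (leq0n L) (svalP x) (svalP y)) /subkernel /kappa /kconst /=.
by ring.
Qed.

(** A set inside [L1] occurs at both levels and leaves a difference of the two factors; any other
    set occurs at the upper level alone. *)
Definition levelb L1 L2 (w : {fset nat}) (x : U) : R :=
  if (w `<=` initseg L1)%fset then kappa L2 x - kappa L1 x else kappa L2 x.

(** The two kinds of sets are dominated separately, and the free factors [o1], [o2] merge the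
    results. With M the product between the levels, [kappa L1] is M(a, .) times [kappa L2]; for sets
    inside [L1] this reduces the matter to the pivot of M - 1 and produces the small constant
    [kconst L1 - kconst L2]. *)
Lemma psd_level L1 L2 (o1 o2 : R) : (L1 <= L2)%N -> 0 <= o1 -> 0 <= o2 ->
  psd (fun x y : U => (o1 * (kconst L1 - kconst L2) + o2 * kconst L2) * subkernel (kernK g) x y -
    \sum_(w <- [seq w : {fset nat} <- fpowerset (initseg L2) | 0 < weight g w])
      weight g w * (if (w `<=` initseg L1)%fset then o1 else o2) *
      (levelb L1 L2 w x * levelb L1 L2 w y * subkernel (kern_prod w) x y)).
Proof.
move=> L12 o10 o20.
pose M (x y : U) := midprod g L1 L2 (sval x) (sval y).
have c20 : 0 <= kconst L2 by apply: le_trans (kconst_ge1 _).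
have m1 : 0 <= M ahalf ahalf - 1 by rewrite subr_ge0 midprod_halves_ge1.
have kap1 (x : U) : kappa L1 x = M ahalf x * kappa L2 x.
  by apply: kernK_split => //; [exact: cube_halves|exact: (svalP x)].
have D2 := psd_pivot_mul ahalf (psd_kernK_tail L2).
(* This is (M(a,a) - 1) M(x,y) - (M(a,x) - 1) (M(a,y) - 1): the added constant turns M - 1 into M in
   the first term. *)
have D1 := psd_add (psd_pivot_mul ahalf (psd_midprod_sub1 L1 L2)) (@psd_cst R U _ m1).
have D3 := psd_add (psd_weight (kappa L2) D1)
  (psd_cmul m1 (psd_mul (psd_midprod L1 L2) D2)).
have D4 := psd_mul (psd_midprod 0 L1) D3.
pose S P (x y : U) := \sum_(w <- fpowerset (initseg L2) | P w)
  weight g w * kern_prod w (sval x) (sval y).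
have pS P : psd (S P).
  have := psd_sum [seq w : {fset nat} <- fpowerset (initseg L2) | P w]
    (fun w => psd_cmul (weight_ge0 w) (psd_kern_prod w)).
  by congr psd; apply/funext => x; apply/funext => y; rewrite big_filter.
pose inL1 (w : {fset nat}) := (w `<=` initseg L1)%fset.
(* This equals [kconst L2] times the full kernel minus the contribution of the sets outside [L1]. *)
have D5 := psd_add (psd_mul (pS (predC inL1)) D2)
  (psd_cmul c20 (psd_mul (pS inL1) (psd_kernK_tail L2))).
have := psd_add (psd_cmul o10 D4) (psd_cmul o20 D5); congr psd.
apply/funext => x; apply/funext => y.
have S1 : S inL1 x y = midprod g 0 L1 (sval x) (sval y).
  rewrite midprod_sum /S -big_filter; apply: perm_big; apply: uniq_perm => //.
    by rewrite filter_uniq.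
  move=> w; rewrite mem_filter !fpowersetE /inL1; case: (boolP (w `<=` initseg L1)%fset) => //=.
  by move/fsubset_trans; apply; rewrite initseg_sub.
have SS : S inL1 x y + S (predC inL1) x y = midprod g 0 L2 (sval x) (sval y).
  by rewrite midprod_sum [RHS](bigID inL1).
have SK : kernK g (sval x) (sval y) =
    (S inL1 x y + S (predC inL1) x y) * kernK (tailw g L2) (sval x) (sval y).
  rewrite SS -{1}tailw0.
  exact: kernK_split (leq0n _) (svalP x) (svalP y).
have SK1 : (S inL1 x y + S (predC inL1) x y) = S inL1 x y * M x y.
  by rewrite SS S1 /M /midprod -big_cat_nat.
have E : \sum_(w <- [seq w : {fset nat} <- fpowerset (initseg L2) | 0 < weight g w])
      weight g w * (if (w `<=` initseg L1)%fset then o1 else o2) *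
      (levelb L1 L2 w x * levelb L1 L2 w y * subkernel (kern_prod w) x y) =
    o1 * (kappa L2 x - kappa L1 x) * (kappa L2 y - kappa L1 y) * S inL1 x y +
    o2 * kappa L2 x * kappa L2 y * S (predC inL1) x y.
  rewrite big_filter big_mkcond /=.
  rewrite (eq_bigr (fun w => weight g w * (if (w `<=` initseg L1)%fset then o1 else o2) *
      (levelb L1 L2 w x * levelb L1 L2 w y * subkernel (kern_prod w) x y))); last first.
    move=> w _; case: ifPn => //; rewrite -leNgt => w0.
    have -> : weight g w = 0 by apply/eqP; rewrite eq_le w0 weight_ge0.
    by rewrite !mul0r.
  rewrite (bigID inL1) /S !mulr_sumr; congr (_ + _); apply: eq_bigr => w.
    by rewrite /inL1 /levelb /= => ->; rewrite /subkernel; ring.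
  by rewrite /inL1 /levelb /= => /negbTE ->; rewrite /subkernel; ring.
rewrite E (kconst_split L12) -/(M ahalf ahalf) !kap1 /subkernel {1}SK -S1.
have -> : kernK (tailw g L2) halves (sval x) = kappa L2 x by [].
rewrite -/(kconst L2) -/(kappa L2 y) -/(M ahalf x) -/(M ahalf y) -/(M x y).
move: SK1.
move: (S inL1 x y) (S (predC inL1) x y) (M ahalf ahalf) (M ahalf x) (M ahalf y) (M x y)
  (kappa L2 x) (kappa L2 y) (kconst L2) (kernK (tailw g L2) (sval x) (sval y)).
move=> s1 s2 maa max may m kx ky c k e.
have -> : s2 = s1 * m - s1 by rewrite -e; ring.
by ring.
Qed.

End WeightedKernel.

(** * Components of the difference of two levels *)

Section LevelDecomposition.
Context {R : realType} (g : nat -> R).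
Hypothesis g_ge0 : forall j, 0 <= g j.
Hypothesis g_summable : (\esum_(u in [set: {fset nat}]) (weight g u)%:E < +oo)%E.
Local Notation U := {x : nat -> R | @cube R x}.
Context (H : set ((nat -> R) -> R)) (ip : ((nat -> R) -> R) -> ((nat -> R) -> R) -> R).
Hypothesis rk : is_rkhs (@cube R) (kernK g) H ip.
Context (Hk : {fset nat} -> set ((nat -> R) -> R)).
Context (ipk : {fset nat} -> ((nat -> R) -> R) -> ((nat -> R) -> R) -> R).
Hypothesis rkk : forall w, is_rkhs (@cube R) (kern_prod w) (Hk w) (ipk w).
Context (f : (nat -> R) -> R) (s : nat -> seq (R * U)).
Hypothesis Hf : H f.
Hypothesis sf : approximates (kernK g) ip s f.

Lemma approximates_eval (x : U) : (fun n => \sum_(p <- s n) p.1 * kernK g (sval x) (sval p.2)) @ \oo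
  --> f (sval x).
Proof.
apply: (cvgn_ext _ (rkhs_cvg_eval rk (fun n => rkhs_felem rk (s n)) Hf (svalP x) sf)) => n.
rewrite /felem; apply: eq_bigr => p _.
by rewrite ksectionE//; exact: (svalP x).
Qed.

Lemma approximates_anchored L (x : U) :
  (fun n => \sum_(p <- s n) p.1 * (midprod g 0 L (sval x) (sval p.2) * kappa g L p.2)) @ \oo
  --> f (splice (initseg L) (sval x) halves).
Proof.
have Xs := cube_splice (initseg L) (svalP x) (@cube_halves R).
have h := @approximates_eval (exist _ _ Xs); apply: (cvgn_ext _ h) => n; apply: eq_bigr => p _ /=.
by rewrite (kernK_splice g_ge0 g_summable L (svalP x) (svalP p.2)).
Qed.

(** Sets of weight 0 are left out: the domination asks for positive factors, and the variance bound
    of the rules for positive weights. *)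
Definition levellist L := [seq w : {fset nat} <- fpowerset (initseg L) | 0 < weight g w].

(** The domination theorem applied to [psd_level]. The last clause keeps the constant component as
    an explicit limit, so that over all levels these constants telescope into the bias. *)
Lemma level_decomposition L1 L2 (o1 o2 : R) : (L1 <= L2)%N -> 0 < o1 -> 0 < o2 ->
  exists G : {fset nat} -> (nat -> R) -> R,
  [/\ forall w, w \in levellist L2 -> Hk w (G w),
      forall x, cube x ->
        f (splice (initseg L2) x halves) - f (splice (initseg L1) x halves) =
        \sum_(w <- levellist L2) weight g w * G w x,
      \sum_(w <- levellist L2) weight g w * (if (w `<=` initseg L1)%fset then o1 else o2) *
         ipk w (G w) (G w) <=
       (o1 * (kconst g L1 - kconst g L2) + o2 * kconst g L2) * ip f f &
      forall x, cube x ->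
        (fun n => \sum_(p <- s n) p.1 * (kappa g L2 p.2 - kappa g L1 p.2)) @ \oo --> G fset0 x].
Proof.
move=> L12 o10 o20.
have B0 : 0 <= o1 * (kconst g L1 - kconst g L2) + o2 * kconst g L2.
  rewrite addr_ge0// mulr_ge0 ?(ltW o10) ?(ltW o20)//.
    by rewrite subr_ge0 kconst_anti.
  by apply: le_trans (kconst_ge1 g_ge0 g_summable _).
have om_gt0 w : w \in levellist L2 ->
    0 < weight g w * (if (w `<=` initseg L1)%fset then o1 else o2).
  by rewrite mem_filter => /andP[w0 _]; rewrite mulr_gt0//; case: ifP.
have [G [HG cG nG]] := rkhs_domination rk rkk B0 om_gt0
  (psd_level g_ge0 g_summable L12 (ltW o10) (ltW o20)) Hf sf.
exists G; split => //.
- move=> x Xx.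
  have h1 : (fun n => \sum_(p <- s n) p.1 * (midprod g 0 L2 x (sval p.2) * kappa g L2 p.2) -
      \sum_(p <- s n) p.1 * (midprod g 0 L1 x (sval p.2) * kappa g L1 p.2)) @ \oo -->
      f (splice (initseg L2) x halves) - f (splice (initseg L1) x halves).
    exact: cvgB (@approximates_anchored L2 (exist _ x Xx)) (@approximates_anchored L1 (exist _ x Xx)).
  have h2 : (fun n => \sum_(w <- levellist L2 | w \in levellist L2) weight g w *
      ceval (subkernel (kern_prod w)) (cweight (levelb g L1 L2 w) (s n)) (exist _ x Xx)) @ \oo -->
      \sum_(w <- levellist L2 | w \in levellist L2) weight g w * G w x.
    apply: cvgn_sum => w wl; apply: cvgM; first exact: cvg_cst.
    exact: (cG w (exist _ x Xx) wl).
  rewrite [RHS]big_seq; apply: (cvgn_eq (n0 := 0) _ h1 h2) => n _ /=.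
  rewrite -sumrB -big_seq.
  under [RHS]eq_bigr => w _ do rewrite /ceval big_map mulr_sumr.
  rewrite exchange_big; apply: eq_bigr => p _ /=.
  rewrite -mulrBr big_filter big_mkcond /=.
  rewrite (eq_bigr (fun w => p.1 * (levelb g L1 L2 w p.2 * (weight g w * kern_prod w x (sval p.2)))));
    last first.
    move=> w _; case: ifPn => [_|].
      rewrite /subkernel /=.
      have -> : kern_prod w (sval p.2) x = kern_prod w x (sval p.2).
        by apply: eq_bigr => j _; exact: kernC.
      by ring.
    rewrite -leNgt => w0.
    have -> : weight g w = 0 by apply/eqP; rewrite eq_le w0 weight_ge0.
    by rewrite mul0r !mulr0.
  rewrite -mulr_sumr; congr (_ * _).
  rewrite (eq_bigr (fun w => kappa g L2 p.2 * (weight g w * kern_prod w x (sval p.2)) -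
    kappa g L1 p.2 * (if (w `<=` initseg L1)%fset then weight g w * kern_prod w x (sval p.2) else 0)));
    last by move=> w _; rewrite /levelb; case: ifP => _; ring.
  rewrite sumrB -!mulr_sumr -midprod_sum -big_mkcond /=.
  rewrite -big_filter (_ : \sum_(w <- _) _ = midprod g 0 L1 x (sval p.2)); first by ring.
  rewrite midprod_sum; apply: perm_big; apply: uniq_perm.
  - exact: filter_uniq (fset_uniq _).
  - exact: fset_uniq.
  move=> w; rewrite mem_filter !fpowersetE.
  case: (boolP (w `<=` initseg L1)%fset) => //=.
  by move/fsubset_trans; apply; rewrite initseg_sub.
- move=> x Xx.
  have w0 : fset0 \in levellist L2.
    by rewrite mem_filter fpowersetE fsub0set /weight big_seq_fset0 ltr01.
  apply: (cvgn_ext _ (cG fset0 (exist _ x Xx) w0)) => n; rewrite /ceval big_map; apply: eq_bigr => p _ /=.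
  by rewrite /levelb fsub0set /subkernel /kern_prod big_seq_fset0 mulr1.
Qed.

Lemma bias_bound L (l : R) :
  (fun n => \sum_(p <- s n) p.1 * (kappa g L p.2 - 1)) @ \oo --> l ->
  l ^+ 2 <= (kconst g L - 1) * ip f f.
Proof.
move=> hl.
have h1 : (fun n => (\sum_(p <- s n) p.1 * (kappa g L p.2 - 1)) ^+ 2) @ \oo --> l ^+ 2.
  exact: cvgM.
have h2 : (fun n => (kconst g L - 1) * ip (felem (kernK g) (s n)) (felem (kernK g) (s n)))
    @ \oo --> (kconst g L - 1) * ip f f.
  apply: cvgM; first exact: cvg_cst.
  by apply: (rkhs_cvg_norm rk) => // n; exact: (rkhs_felem rk).
apply: (cvgn_le (n0 := 0) _ h1 h2) => n _.
rewrite (ip_felem2 rk) -subr_ge0.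
have := (psd_bias g_ge0 g_summable L).2 (s n); congr (_ <= _).
rewrite (_ : (_ ^+ 2) = cform (fun x y : U => (kappa g L x - 1) * (kappa g L y - 1)) (s n) (s n)).
  by rewrite cform_kernelB cform_cmul.
rewrite expr2 mulr_suml; apply: eq_bigr => p _; rewrite mulr_sumr; apply: eq_bigr => q _.
by ring.
Qed.

End LevelDecomposition.

Definition upd {R : realType} (x : nat -> R) (j : nat) (t : R) : nat -> R :=
  fun l => if l == j then t else x l.

(** * Continuity and grid means of the components *)

Section ComponentRegularity.
Context {R : realType} (w : {fset nat}).
Context (H : set ((nat -> R) -> R)) (ip : ((nat -> R) -> R) -> ((nat -> R) -> R) -> R).
Hypothesis rk : is_rkhs (@cube R) (kern_prod w) H ip.
Implicit Types (x y : nat -> R) (G : (nat -> R) -> R).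
Local Notation U := {x : nat -> R | @cube R x}.

Lemma cube_upd x j (t : R) : cube x -> 0 <= t <= 1 -> cube (upd x j t).
Proof. by move=> hx ht l; rewrite /upd; case: ifP. Qed.

Lemma component_local G x y : H G -> cube x -> cube y ->
  (forall j, j \in w -> x j = y j) -> G x = G y.
Proof.
move=> HG hx hy xy; rewrite -(rkhs_repr rk HG hx) -(rkhs_repr rk HG hy); congr ip.
congr patch; apply/funext => z; rewrite /kern_prod big_seq [RHS]big_seq.
by apply: eq_bigr => j /xy ->.
Qed.

Lemma component_bounded G x : H G -> cube x -> G x ^+ 2 <= ip G G.
Proof.
move=> HG hx; apply: le_trans (rkhs_eval_le rk HG hx) _.
rewrite ler_piMr ?(rkhs_ip_ge0 rk)//.
exact: le_trans (ler_norm _) (kern_prod_le w hx hx).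
Qed.

Lemma kern_prod_lip x x' y : cube x -> cube x' -> cube y ->
  `|kern_prod w x y - kern_prod w x' y| <= \sum_(j <- w) `|x j - x' j|.
Proof.
move=> hx hx' hy; rewrite /kern_prod; elim: (enum_fset w) => [|j l IH].
  by rewrite !big_nil subrr normr0.
rewrite !big_cons.
have -> : kern (x j) (y j) * \prod_(j0 <- l) kern (x j0) (y j0) -
          kern (x' j) (y j) * \prod_(j0 <- l) kern (x' j0) (y j0) =
  (kern (x j) (y j) - kern (x' j) (y j)) * \prod_(j0 <- l) kern (x j0) (y j0) +
  kern (x' j) (y j) * (\prod_(j0 <- l) kern (x j0) (y j0) - \prod_(j0 <- l) kern (x' j0) (y j0)).
  by ring.
apply: le_trans (ler_normD _ _) _; rewrite !normrM lerD//.
  rewrite -[leRHS]mulr1 ler_pM// ?kern_lip//.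
  rewrite normr_prod -[leRHS](@big1 R 1 *%R _ l xpredT (fun=> 1))//.
  apply: ler_prod => i _; rewrite normr_ge0/= (le_trans (kern_le (hx i) (hy i)))//.
  lra.
rewrite -[leRHS]mul1r ler_pM// (le_trans (kern_le (hx' j) (hy j)))//.
lra.
Qed.

(** The squared distance of two sections of [kern_prod w] is at most twice the l1 distance of the
    points. Hoelder continuity of order 1/2 suffices for following the truncation of digits. *)
Lemma component_holder G x y : H G -> cube x -> cube y ->
  (G x - G y) ^+ 2 <= ip G G * (2 * \sum_(j <- w) `|x j - y j|).
Proof.
move=> HG hx hy.
have := rkhs_comb_le rk [:: (1, exist _ x hx : U); (-1, exist _ y hy)] HG.
rewrite big_cons big_seq1 /= mul1r mulN1r => /le_trans; apply.
rewrite ler_wpM2l ?(rkhs_ip_ge0 rk)//.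
rewrite /cform !(big_cons, big_nil) /= /subkernel /=.
have h1 := le_trans (ler_norm _) (kern_prod_lip hx hy hx).
have h2 : kern_prod w y y - kern_prod w x y <= \sum_(j <- w) `|x j - y j|.
  by rewrite -opprB; apply: le_trans (kern_prod_lip hx hy hy); rewrite -normrN ler_norm.
lra.
Qed.

(** The mean over the grid is the inner product with a mean of kernel sections. The squared norm of
    the latter is a double grid mean of k times the product over the other coordinates, so it is at
    most 1/n. *)
Lemma component_grid_mean G x j n : H G -> cube x -> j \in w -> (0 < n)%N ->
  (n%:R^-1 * \sum_(i < n) G (upd x j (i%:R / n%:R))) ^+ 2 <= ip G G * n%:R^-1.
Proof.
move=> HG hx jw n0; have nR : 0 < n%:R :> R by rewrite ltr0n.
have i01 (i : 'I_n) : 0 <= (i%:R / n%:R : R) <= 1.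
  by rewrite divr_ge0//= ler_pdivrMr// mul1r ler_nat ltnW.
pose s := [seq (n%:R^-1 : R, exist _ _ (cube_upd j hx (i01 i)) : U) | i <- index_enum 'I_n].
have := rkhs_comb_le rk s HG; rewrite /s big_map -mulr_sumr => /le_trans; apply.
rewrite ler_wpM2l ?(rkhs_ip_ge0 rk)//.
rewrite /cform big_map; under eq_bigr do rewrite big_map.
rewrite /subkernel /=.
set Q := \prod_(l <- (w `\ j)%fset) kern (x l) (x l).
have E (t t' : R) : kern_prod w (upd x j t) (upd x j t') = kern t t' * Q.
  rewrite /kern_prod (big_fsetD1 j)//= /upd eqxx; congr (_ * _).
  by rewrite big_seq [RHS]big_seq; apply: eq_bigr => l; rewrite in_fsetD1 => /andP[/negbTE -> _].
under eq_bigr do under eq_bigr do rewrite E.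
have -> : \sum_(i < n) \sum_(i' < n)
    n%:R^-1 * n%:R^-1 * (kern (i%:R / n%:R) (i'%:R / n%:R) * Q) =
  n%:R^-1 * \sum_(i' < n) (n%:R^-1 * \sum_(i < n) kern (i%:R / n%:R) (i'%:R / n%:R)) * Q.
  rewrite exchange_big mulr_sumr; apply: eq_bigr => i' _.
  by rewrite !mulr_sumr mulr_suml mulr_sumr; apply: eq_bigr => i _; ring.
have Q1 : `|Q| <= 1 by exact: kern_prod_le.
apply: le_trans (ler_norm _) _; rewrite normrM ger0_norm ?invr_ge0//.
rewrite -ler_pdivlMl ?invr_gt0// invrK mulfV ?gt_eqF//.
apply: le_trans (ler_norm_sum _ _ _) _.
rewrite [leRHS](_ : 1 = \sum_(i' < n) n%:R^-1); last first.
  by rewrite sumr_const card_ord -[RHS]mulr_natr mulVf ?gt_eqF.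
apply: ler_sum => i' _; rewrite normrM -[leRHS]mulr1 ler_pM//.
exact: kern_grid_mean.
Qed.

End ComponentRegularity.

(** * Scrambling and uncorrelated components *)

Section BoundedMean.
Context {d} {T : measurableType d} {R : realType} (m : {measure set T -> \bar R}).
Hypothesis m1 : m setT = 1%E.
Implicit Types (X Y : T -> R).

Definition mean X : R := \int[m]_x X x.

(** A class closed under sums, products and bounded pointwise limits, in which integrability is
    automatic when the total mass is 1. *)
Definition bounded_rv X : Prop := measurable_fun setT X /\ exists M, forall w, `|X w| <= M.

Lemma bounded_rv_integrable X : bounded_rv X -> m.-integrable setT (EFin \o X).
Proof.
move=> [mX [M XM]].
have iM : m.-integrable setT (EFin \o (cst M : T -> R)).
  apply/integrableP; split; first exact/measurable_EFinP.
  rewrite (_ : (fun x => _) = cst (`|M|%:E)%E); last by apply/funext.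
  by rewrite integral_cst// m1 mule1 ltry.
apply: (le_integrable _ _ _ iM) => //; first exact/measurable_EFinP.
by move=> x _ /=; rewrite lee_fin; apply: le_trans (XM x) (ler_norm _).
Qed.

Lemma bounded_rv_cst c : bounded_rv (fun=> c).
Proof. by split => //; exists `|c|. Qed.

Lemma bounded_rvD X Y : bounded_rv X -> bounded_rv Y -> bounded_rv (fun w => X w + Y w).
Proof.
move=> [mX [M XM]] [mY [N YN]]; split; first exact: measurable_funD.
by exists (M + N) => w; apply: le_trans (ler_normD _ _) _; rewrite lerD.
Qed.

Lemma bounded_rvM X Y : bounded_rv X -> bounded_rv Y -> bounded_rv (fun w => X w * Y w).
Proof.
move=> [mX [M XM]] [mY [N YN]]; split; first exact: measurable_funM.
by exists (M * N) => w; rewrite normrM ler_pM.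
Qed.

Lemma bounded_rvZ c X : bounded_rv X -> bounded_rv (fun w => c * X w).
Proof. by move=> hX; apply: bounded_rvM => //; exact: bounded_rv_cst. Qed.

Lemma bounded_rv_sum (I : Type) (l : seq I) (X : I -> T -> R) :
  (forall i, bounded_rv (X i)) -> bounded_rv (fun w => \sum_(i <- l) X i w).
Proof.
move=> hX; elim: l => [|i l IH].
  by under eq_fun do rewrite big_nil; exact: bounded_rv_cst.
by under eq_fun do rewrite big_cons; exact: bounded_rvD.
Qed.

Lemma mean_cst c : mean (fun=> c) = c.
Proof. by rewrite /mean Rintegral_cst// m1 mulr1. Qed.

Lemma meanD X Y : bounded_rv X -> bounded_rv Y ->
  mean (fun w => X w + Y w) = mean X + mean Y.
Proof.
by move=> hX hY; rewrite /mean RintegralD//; exact: bounded_rv_integrable.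
Qed.

Lemma meanZ c X : bounded_rv X -> mean (fun w => c * X w) = c * mean X.
Proof.
by move=> hX; rewrite /mean RintegralZl//; exact: bounded_rv_integrable.
Qed.

Lemma mean_sum (I : Type) (l : seq I) (X : I -> T -> R) :
  (forall i, bounded_rv (X i)) -> mean (fun w => \sum_(i <- l) X i w) = \sum_(i <- l) mean (X i).
Proof.
move=> hX; elim: l => [|i l IH].
  by rewrite big_nil -[RHS]mean_cst; congr mean; apply/funext => w; rewrite big_nil.
rewrite big_cons -IH -meanD//; last exact: bounded_rv_sum.
by congr mean; apply/funext => w; rewrite big_cons.
Qed.

Lemma mean_le X Y : bounded_rv X -> bounded_rv Y -> (forall w, X w <= Y w) ->
  mean X <= mean Y.
Proof. by move=> hX hY XY; apply: le_Rintegral => //; exact: bounded_rv_integrable. Qed.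

Lemma mean_norm_le X (c : R) : bounded_rv X -> (forall w, `|X w| <= c) -> `|mean X| <= c.
Proof.
move=> hX Xc; rewrite ler_norml -{1}(mean_cst (- c)) -{2}(mean_cst c).
apply/andP; split; apply: mean_le => //; try exact: bounded_rv_cst.
  by move=> w; have := Xc w; rewrite ler_norml => /andP[].
by move=> w; have := Xc w; rewrite ler_norml => /andP[].
Qed.

Lemma mean_EFin X : bounded_rv X -> (\int[m]_w (X w)%:E)%E = (mean X)%:E.
Proof.
move=> hX; rewrite /mean /Rintegral fineK//.
by apply: integrable_fin_num => //; exact: bounded_rv_integrable.
Qed.

Lemma mean_bounded_cvg (X : nat -> T -> R) Y M : (forall n, bounded_rv (X n)) ->
  (forall n w, `|X n w| <= M) -> (forall w, (fun n => X n w) @ \oo --> Y w) ->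
  bounded_rv Y /\ (fun n => mean (X n)) @ \oo --> mean Y.
Proof.
move=> hX XM XY.
have hY : bounded_rv Y.
  split.
    by apply: (measurable_fun_cvg (h := X)) => [n|w _]; [exact: (hX n).1|exact: XY].
  exists M => w; apply: (cvgn_leP (n0 := 0) (u := fun n => `|X n w|)) => //.
  by apply: cvg_norm; exact: XY.
split => //.
have XYE w : (fun n => (X n w)%:E) @ \oo --> (Y w)%:E.
  by apply: cvg_EFin; [exact: nearW|exact: XY].
have [_ _ h] := @dominated_convergence _ T R m setT measurableT (fun n => EFin \o X n)
  (EFin \o Y) (EFin \o cst M)
  (fun n => (measurable_EFinP setT (X n)).2 (hX n).1) ((measurable_EFinP setT Y).2 hY.1)
  (aeW m (fun w _ => XYE w))
  (bounded_rv_integrable (bounded_rv_cst M))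
  (aeW m (fun w n _ => XM n w)).
rewrite /mean /Rintegral; apply: fine_cvg.
by rewrite fineK//; apply: integrable_fin_num => //; exact: bounded_rv_integrable.
Qed.

Lemma bounded_rv_indic (A : set T) : measurable A -> bounded_rv \1_A.
Proof.
move=> mA; split; first exact: measurable_indic.
by exists 1 => w; rewrite indicE normr_nat lern1 leq_b1.
Qed.

Lemma mean_indic (A : set T) : measurable A -> mean \1_A = fine (m A).
Proof. by move=> mA; rewrite /mean /Rintegral integral_indic// setIT. Qed.

Section UniformFinite.
Context {F : finType} (V : T -> F) (c : R).
Hypothesis mV : forall t, measurable [set w | V w = t].
Hypothesis uV : forall t, m [set w | V w = t] = c%:E.

Let finite_sumE (phi : F -> R) w :
  phi (V w) = \sum_(t : F) phi t * \1_[set w | V w = t] w.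
Proof.
rewrite (bigD1 (V w))//= indicE mem_set// mulr1 big1 ?addr0// => t /negP h.
by rewrite indicE memNset ?mulr0//= => e; apply: h; rewrite e.
Qed.

Lemma finite_bounded_rv (phi : F -> R) : bounded_rv (fun w => phi (V w)).
Proof.
under eq_fun do rewrite finite_sumE.
by apply: bounded_rv_sum => t; apply: bounded_rvZ; exact: bounded_rv_indic.
Qed.

Lemma mean_finite (phi : F -> R) :
  mean (fun w => phi (V w)) = c * \sum_(t : F) phi t.
Proof.
under [X in mean X]eq_fun do rewrite finite_sumE.
rewrite mean_sum => [|t]; last by apply: bounded_rvZ; exact: bounded_rv_indic.
rewrite mulr_sumr; apply: eq_bigr => t _.
by rewrite meanZ ?mean_indic ?uV ?(mulrC c)//; exact: bounded_rv_indic.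
Qed.

End UniformFinite.
End BoundedMean.

Section RandomPermutations.
Context {R : realType} {d : measure_display} {Omega : measurableType d}.
Context (P : probability Omega R) (b : nat).
Context (perms : nat -> nat -> seq 'F_b -> Omega -> {perm 'F_b}).
Hypothesis perms_uniform : uniform_scrambling P perms.
Local Notation idx := (nat * nat * seq 'F_b)%type.

Definition family (w : Omega) (i : idx) : {perm 'F_b} := perms i.1.1 i.1.2 i.2 w.

(** Such a functional is a function of the permutations indexed by [J], a uniformly distributed
    element of a finite set. *)
Definition depends_on (J : {fset idx}) (G : (idx -> {perm 'F_b}) -> R) : Prop :=
  forall sigma sigma', (forall i, i \in J -> sigma i = sigma' i) -> G sigma = G sigma'.

Let restr (J : {fset idx}) (w : Omega) : {ffun J -> {perm 'F_b}} :=
  [ffun k : J => family w (val k)].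

Let extend (J : {fset idx}) (t : {ffun J -> {perm 'F_b}}) (i : idx) : {perm 'F_b} :=
  if insub i is Some k then t k else 1%g.

Let cell (J : {fset idx}) (t : {ffun J -> {perm 'F_b}}) (i : idx) : {set {perm 'F_b}} :=
  [set u | if insub i is Some k then u == t k else true]%SET.

Let restr_set J t : [set w | restr J w = t] =
  [set w | forall i, i \in J -> perms i.1.1 i.1.2 i.2 w \in cell t i].
Proof.
apply/seteqP; split=> w /=.
  by move=> <- i iJ; rewrite inE insubT ffunE.
move=> h; apply/ffunP => k; rewrite ffunE.
by have := h (val k) (valP k); rewrite inE valK => /eqP.
Qed.

Let restr_measurable J t : measurable [set w | restr J w = t].
Proof.
rewrite restr_set; have [mP _ _] := perms_uniform.
rewrite (_ : [set w | _] = \bigcap_(i in [set` J])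
  [set w | perms i.1.1 i.1.2 i.2 w \in cell t i]).
  by apply: fin_bigcap_measurable; [exact: finite_fset|move=> i _; exact: mP].
by apply/seteqP; split=> w /= h i iJ; exact: h.
Qed.

Let restr_uniform J : exists c : R, forall t, P [set w | restr J w = t] = c%:E.
Proof.
exists (\prod_(i <- J) (b`!)%:R^-1) => t; rewrite restr_set.
have [_ uP iP] := perms_uniform; rewrite iP -prodEFin.
rewrite big_seq [RHS]big_seq; apply: eq_bigr => i iJ.
rewrite -(uP i.1.1 i.1.2 i.2 (t (FSetSub iJ))); congr (P _).
apply/seteqP; split=> w /=.
  by rewrite inE insubT => /eqP.
by move=> e; rewrite inE insubT e.
Qed.

Let extend_restr J G w : depends_on J G -> G (family w) = G (extend (restr J w)).
Proof. by move=> hG; apply: hG => i iJ; rewrite /extend insubT ffunE. Qed.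

Lemma family_bounded_rv J G : depends_on J G -> bounded_rv (fun w => G (family w)).
Proof.
move=> hG; under eq_fun do rewrite (extend_restr _ hG).
exact: (finite_bounded_rv (@restr_measurable J) (fun t => G (extend t))).
Qed.

(** Right multiplication by fixed permutations is a bijection of the equally likely configurations
    on [J]. In the product [tau] acts after the random permutation, that is on the scrambled
    digit. *)
Lemma family_mean_shift J G (tau : idx -> {perm 'F_b}) : depends_on J G ->
  mean P (fun w => G (family w)) = mean P (fun w => G (fun i => family w i * tau i)%g).
Proof.
move=> hG; have [c hc] := restr_uniform J.
have P1 := probability_setT P.
have hG' : depends_on J (fun sigma => G (fun i => sigma i * tau i)%g).
  by move=> s s' ss'; apply: hG => i iJ; rewrite ss'.
under eq_fun do rewrite (extend_restr _ hG).
under [in RHS]eq_fun do rewrite (extend_restr _ hG').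
rewrite (mean_finite P1 (@restr_measurable J) hc (fun t => G (extend t))).
rewrite (mean_finite P1 (@restr_measurable J) hc (fun t => G (fun i => extend t i * tau i)%g)).
congr (_ * _).
pose h (t : {ffun J -> {perm 'F_b}}) : {ffun J -> {perm 'F_b}} :=
  [ffun k : J => (t k * tau (val k))%g : {perm 'F_b}].
have hi : injective h.
  move=> t t' /ffunP e; apply/ffunP => k; have := e k; rewrite !ffunE; exact: mulIg.
rewrite (reindex_inj hi) /=.
apply: eq_bigr => t _; apply: hG => i iJ.
by rewrite /extend insubT ffunE.
Qed.

End RandomPermutations.

(** * Base b digit expansions *)

Section Digits.
Context {R : realType} (b : nat).
Hypothesis b_prime : prime b.
Implicit Types (eta : nat -> 'F_b).

Lemma Fp_ltn (a : 'F_b) : (a < b)%N.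
Proof. by have := ltn_ord a; rewrite {2}Fp_cast. Qed.

Let b_gt1 : (1 < b)%N := prime_gt1 b_prime.

Let bR_gt0 : 0 < b%:R :> R.
Proof. by rewrite ltr0n ltnW. Qed.

Definition digit_sum eta (n : nat) : R := \sum_(0 <= i < n) (eta i : nat)%:R / b%:R ^+ i.+1.

Lemma digit_sumS eta n : digit_sum eta n.+1 = digit_sum eta n + (eta n : nat)%:R / b%:R ^+ n.+1.
Proof. by rewrite /digit_sum big_nat_recr. Qed.

(** A digit is at most b - 1, so the partial sum plus b^-n, its room for the missing digits, never
    increases. *)
Let digit_sum_upper eta n : digit_sum eta n.+1 + b%:R ^- n.+1 <= digit_sum eta n + b%:R ^- n.
Proof.
rewrite digit_sumS -addrA lerD2l -{2}[_ ^- n.+1]mul1r -mulrDl natr1.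
rewrite exprS invfM mulrA mulrC ler_piMr ?invr_ge0 ?exprn_ge0 ?(ltW bR_gt0)//.
by rewrite ler_pdivrMr// mul1r ler_nat Fp_ltn.
Qed.

Lemma digit_sum_le eta m n : (m <= n)%N ->
  digit_sum eta m <= digit_sum eta n <= digit_sum eta m + b%:R ^- m - b%:R ^- n.
Proof.
elim: n => [|n IH]; first by rewrite leqn0 => /eqP ->; rewrite addrK lexx.
rewrite leq_eqVlt => /orP[/eqP ->|]; first by rewrite addrK lexx.
rewrite ltnS => /IH /andP[h1 h2]; apply/andP; split.
  by rewrite digit_sumS (le_trans h1)// lerDl.
by have := digit_sum_upper eta n; lra.
Qed.

Lemma digit_sum_cvg eta : exists l : R, [/\ digit_sum eta @ \oo --> l, 0 <= l <= 1 &
  forall n, `|digit_sum eta n - l| <= b%:R ^- n].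
Proof.
have s0 : digit_sum eta 0 = 0 by rewrite /digit_sum big_geq.
have p0 n : 0 <= b%:R ^- n :> R by rewrite invr_ge0 exprn_ge0// ltW.
have ub n : digit_sum eta n <= 1.
  have /andP[_] := digit_sum_le eta (leq0n n); rewrite s0 expr0 invr1.
  by have := p0 n; lra.
have nd : nondecreasing_seq (digit_sum eta).
  by move=> m n mn; have /andP[] := digit_sum_le eta mn.
have [l hl] : exists l : R, digit_sum eta @ \oo --> l.
  exists (limn (digit_sum eta)); apply: nondecreasing_is_cvgn => //.
  by exists 1 => _ [n _ <-].
exists l; split => //.
  apply/andP; split; first by apply: (cvgn_geP (n0 := 0) _ hl) => n _; rewrite -s0 nd.
  by apply: (cvgn_leP (n0 := 0) _ hl).
move=> n; rewrite distrC ger0_norm ?subr_ge0; last first.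
  by apply: (cvgn_geP (n0 := n) _ hl) => m; exact: nd.
rewrite lerBlDl; apply: (cvgn_leP (n0 := n) _ hl) => m nm.
by have /andP[_] := digit_sum_le eta nm; have := p0 m; lra.
Qed.

Lemma inv_expn_cvg0 (M : R) : (fun n => M * b%:R ^- n) @ \oo --> (0 : R).
Proof.
apply: (@cvgn_squeeze0 _ _ (fun n => `|M| * harmonic n)) => [n|].
  rewrite normrM ler_wpM2l// ger0_norm ?invr_ge0 ?exprn_ge0 ?(ltW bR_gt0)//.
  rewrite /harmonic /= lef_pV2 ?posrE ?ltr0n ?exprn_gt0//.
  by rewrite -natrX ler_nat ltn_expl.
rewrite -[X in _ --> X](mulr0 `|M|); apply: cvgM; first exact: cvg_cst.
exact: cvg_harmonic.
Qed.

Let sum_base_digits (n i : nat) :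
  (\sum_(r < n) (i %/ b ^ r %% b) * b ^ r = i %% b ^ n)%N.
Proof.
elim: n => [|n IH]; first by rewrite big_ord0 modn1.
rewrite big_ord_recr /= IH modn_divl expnS [in RHS](divn_eq (i %% _) (b ^ n)).
by rewrite addnC modn_dvdm ?dvdn_mull.
Qed.

(** Adding every vector of digits modulo b to a fixed one runs exactly once through all strings of
    length n, hence through the grid of step b^-n. *)
Lemma sum_digit_shift eta n (psi : R -> R) :
  \sum_(delta : {ffun 'I_n -> 'F_b})
     psi (\sum_(j < n) ((eta j + delta j)%R : nat)%:R / b%:R ^+ j.+1) =
  \sum_(i < b ^ n) psi (i%:R / (b ^ n)%N%:R).
Proof.
(* Position j has weight b^-(j+1), so the digits of i are read from the most significant one. *)
pose D (i : nat) (j : 'I_n) : 'F_b := (i %/ b ^ (n - j.+1))%N%:R.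
have DE i j : (D i j : nat) = (i %/ b ^ (n - j.+1) %% b)%N.
  by rewrite /D val_Fp_nat.
have DS (i : 'I_(b ^ n)) : \sum_(j < n) (D i j : nat)%:R / b%:R ^+ j.+1 = i%:R / (b ^ n)%N%:R :> R.
  have bn0 : (b ^ n)%N%:R != 0 :> R by rewrite pnatr_eq0 -lt0n expn_gt0 (ltnW b_gt1).
  apply: (mulIf bn0); rewrite mulfVK// -[in RHS](modn_small (ltn_ord i)) -sum_base_digits.
  rewrite natr_sum mulr_suml (reindex_inj rev_ord_inj) /=; apply: eq_bigr => j _.
  rewrite DE natrM -mulrA; congr (_ * _)%R.
    by rewrite subnSK ?subKn// ltnW.
  have E : b%:R ^+ n = b%:R ^+ (n - j) * b%:R ^+ j :> R by rewrite -exprD subnK// ltnW.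
  by rewrite subnSK// !natrX E mulKf// expf_neq0// gt_eqF.
pose h (i : 'I_(b ^ n)) : {ffun 'I_n -> 'F_b} := [ffun j => D i j - eta j].
have hi : injective h.
  move=> i i' /ffunP e.
  have DD j : D i j = D i' j by have := e j; rewrite !ffunE => /addIr.
  have := DS i; under eq_bigr do rewrite DD; rewrite DS.
  have bn0 : (b ^ n)%N%:R != 0 :> R by rewrite pnatr_eq0 -lt0n expn_gt0 (ltnW b_gt1).
  by move/(mulIf (invr_neq0 bn0)) => /eqP; rewrite eqr_nat => /eqP /val_inj.
have hb : bijective h.
  by apply: inj_card_bij => //; rewrite card_ffun !card_ord Fp_cast.
rewrite (reindex h); last exact: onW_bij.
apply: eq_bigr => i _; rewrite -DS; congr psi; apply: eq_bigr => j _.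
have -> : (eta j + h i j)%R = D i j by rewrite ffunE addrCA subrr addr0.
by [].
Qed.

End Digits.

(** All that the probabilistic arguments use of a component, with a single constant for its size and
    its modulus of continuity. *)
Record regular_on {R : realType} (w : {fset nat}) (M : R) (G : (nat -> R) -> R) : Prop := RegularOn {
  reg_ge0 : 0 <= M;
  reg_local : forall x y, @cube R x -> cube y -> (forall j, j \in w -> x j = y j) -> G x = G y;
  reg_bounded : forall x, cube x -> `|G x| <= M;
  reg_holder : forall x y, cube x -> cube y ->
    (G x - G y) ^+ 2 <= M * \sum_(j <- w) `|x j - y j|
}.

(** Constants are regular on no coordinate at all, so that a vanishing mean becomes orthogonality to
    the constant 1. *)
Lemma regular_cst {R : realType} (c : R) : regular_on fset0 `|c| (fun=> c).
Proof.
by split => // x y _ _; rewrite big_seq_fset0 mulr0 subrr expr0n.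
Qed.

(** The constant serves twice: it majorizes the square root of [ip G G], which bounds G, and the
    Hoelder factor [2 * ip G G]. *)
Lemma component_regular {R : realType} (w : {fset nat}) H ip (G : (nat -> R) -> R) :
  is_rkhs (@cube R) (kern_prod w) H ip -> H G -> regular_on w (2 * ip G G + 1) G.
Proof.
move=> rk HG; have i0 := rkhs_ip_ge0 rk HG.
have i1 : 0 <= 2 * ip G G + 1 by lra.
split => //.
- by move=> x y hx hy; exact: (component_local rk HG hx hy).
- move=> x hx; have h := component_bounded rk HG hx.
  rewrite -(@ler_pXn2r _ 2)// ?nnegrE//.
  rewrite real_normK ?num_real//; apply: le_trans h _.
  by move: (ip G G) i0 => a a0; have := sqr_ge0 a; rewrite !expr2; nra.
- move=> x y hx hy; apply: le_trans (component_holder rk HG hx hy) _.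
  rewrite mulrA ler_wpM2r//; first by rewrite sumr_ge0.
  by move: (ip G G) i0 => a a0; lra.
Qed.

Section Orthogonality.
Context {R : realType} {d : measure_display} {Omega : measurableType d}.
Context (P : probability Omega R) (b : nat).
Hypothesis b_prime : prime b.
Context (perms : nat -> nat -> seq 'F_b -> Omega -> {perm 'F_b}).
Hypothesis perms_uniform : uniform_scrambling P perms.
Local Notation idx := (nat * nat * seq 'F_b)%type.
Implicit Types (x y : nat -> R) (w : {fset nat}) (G : (nat -> R) -> R).

Definition prefix_of (t : R) (i : nat) : seq 'F_b := [seq digit b t l | l <- iota 1 i].

Definition scrambled_digit (k : nat) (sigma : idx -> {perm 'F_b}) (t : R) (j i : nat) : 'F_b :=
  sigma (k, j, prefix_of t i) (digit b t i.+1).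

(** Keeping n digits involves finitely many permutations only. *)
Definition truncated_point (n k L : nat) x (sigma : idx -> {perm 'F_b}) : nat -> R :=
  splice (initseg L) (fun j => digit_sum (scrambled_digit k sigma (x j) j) n) (fun=> 0).

Definition full_point (k L : nat) x (om : Omega) : nat -> R :=
  splice (initseg L) (fun j => scramble (fun s => perms k j s om) (x j)) (fun=> 0).

Lemma scramble_digit_sum (k j n : nat) (t : R) om :
  `|digit_sum (scrambled_digit k (family perms om) t j) n - scramble (fun s => perms k j s om) t|
    <= b%:R ^- n /\ 0 <= scramble (fun s => perms k j s om) t <= 1.
Proof.
have [l [hl l01 hb]] := @digit_sum_cvg R _ b_prime (scrambled_digit k (family perms om) t j).
have -> : scramble (fun s => perms k j s om) t = l.
  by rewrite /scramble; apply: cvg_lim => //; exact: hl.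
by split.
Qed.

Lemma cube_truncated n k L x sigma : cube (truncated_point n k L x sigma).
Proof.
move=> j; rewrite /truncated_point /splice; case: ifP => _; last by rewrite lexx ler01.
have := digit_sum_le b_prime (scrambled_digit k sigma (x j) j) (leq0n n) (R := R).
have -> : digit_sum (scrambled_digit k sigma (x j) j) 0 = 0 :> R by rewrite /digit_sum big_geq.
rewrite expr0 invr1 add0r => /andP[-> h]/=.
have : 0 <= b%:R ^- n :> R by rewrite invr_ge0 exprn_ge0.
by lra.
Qed.

Lemma cube_full k L x om : cube (full_point k L x om).
Proof.
move=> j; rewrite /full_point /splice; case: ifP => _; last by rewrite lexx ler01.
by have [] := scramble_digit_sum k j 0 (x j) om.
Qed.

Lemma truncated_cvg w M G k L x om : regular_on w M G ->
  (fun n => G (truncated_point n k L x (family perms om))) @ \oo --> G (full_point k L x om).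
Proof.
move=> rG.
have c0 : (fun n => G (truncated_point n k L x (family perms om)) - G (full_point k L x om))
    @ \oo --> (0 : R).
  apply: cvgn_sqr0.
  apply: (@cvgn_squeeze0 _ _ (fun n => (M * (size w)%:R) * b%:R ^- n)) => [n|];
    last exact: inv_expn_cvg0.
  rewrite ger0_norm ?sqr_ge0//.
  apply: le_trans (reg_holder rG (cube_truncated _ _ _ _ _) (cube_full _ _ _ _)) _.
  rewrite -mulrA ler_wpM2l ?(reg_ge0 rG)// -sum1_size natr_sum mulr_suml.
  apply: ler_sum => j _; rewrite mul1r /truncated_point /full_point /splice.
  case: ifP => _; first by have [] := scramble_digit_sum k j n (x j) om.
  by rewrite subrr normr0 invr_ge0 exprn_ge0.
rewrite -[X in _ --> X]add0r.
under eq_fun do rewrite -[G (truncated_point _ _ _ _ _)](subrK (G (full_point k L x om))).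
by apply: cvgD => //; exact: cvg_cst.
Qed.

Definition used_indices (n k L : nat) x : seq idx :=
  [seq (k, j, prefix_of (x j) i) | j <- iota 0 L, i <- iota 0 n].

Lemma truncated_point_eq n k L x sigma sigma' :
  (forall i, i \in used_indices n k L x -> sigma i = sigma' i) ->
  truncated_point n k L x sigma = truncated_point n k L x sigma'.
Proof.
move=> h; apply/funext => j; rewrite /truncated_point /splice mem_initseg.
case: ifPn => // jL; rewrite /digit_sum big_nat [RHS]big_nat; apply: eq_bigr => i /andP[_ i_n].
rewrite /scrambled_digit h//; apply/allpairsP; exists (j, i).
by rewrite !mem_iota.
Qed.

(** Acting after a scrambling permutation, it adds [delta] to the scrambled digit; the length of the
    prefix tells the position of that digit. *)
Definition translation_by (k j : nat) (delta : nat -> 'F_b) (i : idx) : {perm 'F_b} :=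
  if (i.1.1 == k) && (i.1.2 == j) then perm (addIr (delta (size i.2))) else 1%g.

Lemma truncated_shift n k L x j delta sigma : (j < L)%N ->
  truncated_point n k L x (fun i => sigma i * translation_by k j delta i)%g =
  upd (truncated_point n k L x sigma) j
    (digit_sum (fun i => (scrambled_digit k sigma (x j) j i + delta i)%R) n).
Proof.
move=> jL; apply/funext => j'; rewrite /upd /truncated_point /splice mem_initseg.
have [->|jj'] := eqVneq j' j.
  rewrite jL; congr digit_sum; apply/funext => i.
  by rewrite /scrambled_digit permM /translation_by /= !eqxx /= permE size_map size_iota.
case: ifPn => // _; congr digit_sum; apply/funext => i.
by rewrite /scrambled_digit permM /translation_by /= (negbTE jj') andbF perm1.
Qed.

Lemma truncated_shift_other n k L x k' j delta sigma : k' != k ->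
  truncated_point n k L x (fun i => sigma i * translation_by k' j delta i)%g =
  truncated_point n k L x sigma.
Proof.
move=> kk'; apply/funext => j'; rewrite /truncated_point /splice.
case: ifPn => // _; congr digit_sum; apply/funext => i.
by rewrite /scrambled_digit permM /translation_by /= eq_sym (negbTE kk') perm1.
Qed.

Lemma truncated_shift_local n k L x k' j delta sigma w M G : regular_on w M G ->
  (k' != k) || (j \notin w) ->
  G (truncated_point n k L x (fun i => sigma i * translation_by k' j delta i)%g) =
  G (truncated_point n k L x sigma).
Proof.
move=> rG; have [->/=|kk' _] := eqVneq k' k; last by rewrite truncated_shift_other.
move=> jw; apply: (reg_local rG); try exact: cube_truncated.
move=> j' j'w; rewrite /truncated_point /splice.
case: ifPn => // _; congr digit_sum; apply/funext => i.
rewrite /scrambled_digit permM /translation_by /= eqxx /=.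
have -> : (j' == j) = false by apply/eqP => e; rewrite -e j'w in jw.
by rewrite perm1.
Qed.

Lemma full_bounded_rv w M G k L x : regular_on w M G ->
  bounded_rv (fun om => G (full_point k L x om)).
Proof.
move=> rG.
have [] := @mean_bounded_cvg _ _ _ P (probability_setT P)
  (fun n om => G (truncated_point n k L x (family perms om)))
  (fun om => G (full_point k L x om)) M => //.
- move=> n; apply: (family_bounded_rv perms_uniform
    (J := [fset i in used_indices n k L x]%fset)
    (G := fun sigma => G (truncated_point n k L x sigma))).
  by move=> s s' h; rewrite (@truncated_point_eq n k L x s s')// => i iu; apply: h; rewrite inE.
- by move=> n om; apply: (reg_bounded rG); exact: cube_truncated.
- by move=> om; apply: truncated_cvg rG.
Qed.

(** Adding a vector of digits in coordinate j of summand k preserves the mean and, by the last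
    hypothesis, the second factor. Averaged over all vectors, the first factor becomes a mean over
    the grid of step b^-n in coordinate j, which is small by assumption. The nodes x and x' are
    arbitrary. *)
Lemma mean_orthogonal w w' M M' G G' k k' L L' x x' j :
  regular_on w M G -> regular_on w' M' G' ->
  (forall y n, cube y -> (0 < n)%N ->
     (n%:R^-1 * \sum_(i < n) G (upd y j (i%:R / n%:R))) ^+ 2 <= M * n%:R^-1) ->
  (j < L)%N -> (k != k') || (j \notin w') ->
  mean P (fun om => G (full_point k L x om) * G' (full_point k' L' x' om)) = 0.
Proof.
move=> rG rG' mG jL kj.
pose X n om := G (truncated_point n k L x (family perms om)) *
  G' (truncated_point n k' L' x' (family perms om)).
pose J n := [fset i in used_indices n k L x ++ used_indices n k' L' x']%fset.
pose Phi n sigma := G (truncated_point n k L x sigma) * G' (truncated_point n k' L' x' sigma).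
have dPhi n : depends_on (J n) (Phi n).
  move=> s s' h; rewrite /Phi (@truncated_point_eq n k L x s s'); last first.
    by move=> i iu; apply: h; rewrite !inE iu.
  rewrite (@truncated_point_eq n k' L' x' s s')// => i iu.
  by apply: h; rewrite !inE iu orbT.
have bX n : bounded_rv (X n) by exact: (family_bounded_rv perms_uniform (dPhi n)).
have Xle n om : `|X n om| <= M * M'.
  rewrite normrM ler_pM//.
    by apply: (reg_bounded rG); exact: cube_truncated.
  by apply: (reg_bounded rG'); exact: cube_truncated.
have Xcvg om : (fun n => X n om) @ \oo --> G (full_point k L x om) * G' (full_point k' L' x' om).
  by apply: cvgM; [apply: truncated_cvg rG|apply: truncated_cvg rG'].
have [_ hm] := mean_bounded_cvg (probability_setT P) bX Xle Xcvg.
have b0 : (0 < b)%N by exact: prime_gt0.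
have bR0 : 0 < b%:R :> R by rewrite ltr0n.
have Xbound n : mean P (X n) ^+ 2 <= M' ^+ 2 * M * b%:R ^- n.
  pose D := {ffun 'I_n -> 'F_b}.
  pose ext (delta : D) (l : nat) : 'F_b := if insub l is Some o then delta o else 0.
  have shift (delta : D) : mean P (X n) =
      mean P (fun om => G (upd (truncated_point n k L x (family perms om)) j
         (digit_sum (fun i => (scrambled_digit k (family perms om) (x j) j i + ext delta i)%R) n)) *
         G' (truncated_point n k' L' x' (family perms om))).
    rewrite /X (family_mean_shift perms_uniform (translation_by k j (ext delta)) (dPhi n)).
    congr mean; apply/funext => om; rewrite /Phi truncated_shift//.
    by rewrite (truncated_shift_local _ _ _ _ _ rG').
  have D0 : (0 < #|{: D}|)%N by rewrite card_ffun card_ord expn_gt0.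
  have DR : #|{: D}|%:R = (b ^ n)%N%:R :> R by rewrite card_ffun !card_ord Fp_cast.
  have bshift (delta : D) : bounded_rv (fun om => G (upd (truncated_point n k L x (family perms om)) j
         (digit_sum (fun i => (scrambled_digit k (family perms om) (x j) j i + ext delta i)%R) n)) *
         G' (truncated_point n k' L' x' (family perms om))).
    have := family_bounded_rv perms_uniform (J := J n)
      (G := fun sigma => Phi n (fun i => sigma i * translation_by k j (ext delta) i)%g).
    have hd : depends_on (J n) (fun sigma => Phi n (fun i => sigma i * translation_by k j (ext delta) i)%g).
      by move=> s s' h; apply: dPhi => i iJ; rewrite h.
    move=> /(_ hd); congr bounded_rv; apply/funext => om; rewrite /Phi truncated_shift//.
    by rewrite (truncated_shift_local _ _ _ _ _ rG').
  pose Y om := (b ^ n)%N%:R^-1 *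
     (\sum_(i < b ^ n) G (upd (truncated_point n k L x (family perms om)) j (i%:R / (b ^ n)%N%:R))) *
     G' (truncated_point n k' L' x' (family perms om)).
  pose Z (delta : D) om := G (upd (truncated_point n k L x (family perms om)) j
         (digit_sum (fun i => (scrambled_digit k (family perms om) (x j) j i + ext delta i)%R) n)) *
         G' (truncated_point n k' L' x' (family perms om)).
  have EZ : Y = fun om => (b ^ n)%N%:R^-1 * \sum_(delta : D) Z delta om.
    apply/funext => om; rewrite /Y /Z -mulr_suml mulrA; congr (_ * _ * _).
    rewrite -(sum_digit_shift b_prime (scrambled_digit k (family perms om) (x j) j) n
         (fun t => G (upd (truncated_point n k L x (family perms om)) j t))).
    apply: eq_bigr => delta _; congr (G (upd _ _ _)).
    rewrite /digit_sum big_mkord; apply: eq_bigr => i _.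
    by rewrite /ext valK.
  have bZ : bounded_rv (fun om => \sum_(delta : D) Z delta om) by exact: bounded_rv_sum.
  have bE : bounded_rv Y by rewrite EZ; exact: bounded_rvZ.
  have E : mean P (X n) = mean P Y.
    rewrite EZ (meanZ (probability_setT P))// (mean_sum (probability_setT P))//.
    rewrite -(eq_bigr _ (fun delta _ => shift delta)).
    rewrite sumr_const -[X in _ = _ * X]mulr_natl mulrA -DR mulVf ?mul1r//.
    by rewrite pnatr_eq0 -lt0n.
  have aG om : `|(b ^ n)%N%:R^-1 * (\sum_(i < b ^ n)
      G (upd (truncated_point n k L x (family perms om)) j (i%:R / (b ^ n)%N%:R)))| ^+ 2 <=
      M * b%:R ^- n.
    rewrite real_normK ?num_real//.
    have := mG _ (b ^ n)%N (cube_truncated n k L x (family perms om)).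
    by rewrite expn_gt0 b0 => /(_ isT); rewrite natrX.
  have M'0 := reg_ge0 rG'.
  have q0 : 0 <= M * b%:R ^- n.
    by rewrite mulr_ge0 ?(reg_ge0 rG)// invr_ge0 exprn_ge0.
  rewrite E -(real_normK (num_real _)).
  apply: (@le_trans _ _ ((Num.sqrt (M * b%:R ^- n) * M') ^+ 2)); last first.
    by rewrite exprMn sqr_sqrtr// mulrC mulrA.
  rewrite ler_pXn2r ?nnegrE// ?mulr_ge0 ?sqrtr_ge0//.
  apply: (mean_norm_le (probability_setT P)) => // om.
  rewrite normrM ler_pM//; last by apply: (reg_bounded rG'); exact: cube_truncated.
  by rewrite -(@ler_pXn2r _ 2) ?nnegrE ?sqrtr_ge0// sqr_sqrtr.
apply/eqP; rewrite -sqrf_eq0 eq_le sqr_ge0 andbT.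
have h1 : (fun n => mean P (X n) ^+ 2) @ \oo -->
   mean P (fun om => G (full_point k L x om) * G' (full_point k' L' x' om)) ^+ 2 by exact: cvgM.
exact: (cvgn_le (n0 := 0) (fun n _ => Xbound n) h1 (inv_expn_cvg0 b_prime _)).
Qed.

End Orthogonality.

(** * The integral over the infinite cube *)

Section GridCells.
Context {R : realType} (B : nat).
Local Notation Bp := B.+1.

(** The end cells are unbounded: negative numbers fall into cell 0 and numbers from 1 on into cell
    [B], so every real number has a cell. *)
Definition grid_cell (r : R) : 'I_Bp := inord (minn (Num.truncn (Bp%:R * r)) B).

Let grid_cellE r : (grid_cell r : nat) = minn (Num.truncn (Bp%:R * r)) B.
Proof. by rewrite /grid_cell inordK// ltnS geq_minr. Qed.

Let cell_itv (v : nat) : interval R := Interval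
  (if v == 0%N then -oo%O else BLeft (v%:R / Bp%:R))
  (if v == B then +oo%O else BLeft (v.+1%:R / Bp%:R)).

Let cell_itvP (v : 'I_Bp) r : (grid_cell r == v) = (r \in cell_itv v).
Proof.
rewrite -val_eqE /= grid_cellE in_itv /=.
have lo : (if v == 0%N :> nat then true else v%:R / Bp%:R <= r) = (v <= Num.truncn (Bp%:R * r))%N.
  case: (nat_of_ord v) => [|n] //=.
  by rewrite truncn_gt_nat ler_pdivrMr// mulrC.
have hi : (if v == B :> nat then true else r < v.+1%:R / Bp%:R) =
    (v == B :> nat) || (Num.truncn (Bp%:R * r) <= v)%N.
  by case: eqVneq => //= _; rewrite truncn_le_nat ltr_pdivlMr// mulrC.
have vB : (v <= B)%N by rewrite -ltnS ltn_ord.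
transitivity ((v <= Num.truncn (Bp%:R * r))%N && ((v == B :> nat) || (Num.truncn (Bp%:R * r) <= v)%N)).
  case: (eqVneq (v : nat) B) => [->|nB] /=.
    by rewrite andbT eqn_leq geq_minr /= leq_min leqnn andbT.
  rewrite minnE; have vB' : (v < B)%N by rewrite ltn_neqAle nB.
  by case: (leqP (Num.truncn (Bp%:R * r)) B) => tB; apply/eqP/andP => [h|[h1 h2]]; lia.
rewrite -lo -hi; case: (v == 0%N :> nat); case: (v == B :> nat) => //=.
Qed.

Lemma grid_cell_measurable (v : 'I_Bp) : measurable [set r | grid_cell r = v].
Proof.
rewrite (_ : [set r | _] = [set` cell_itv v]); first exact: measurable_itv.
by apply/seteqP; split=> r /=; rewrite -cell_itvP => /eqP.
Qed.

Lemma grid_cell_measure (v : 'I_Bp) :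
  lebesgue_measure ([set r | grid_cell r = v] `&` `[0%R, 1%R]) = (Bp%:R^-1 : R)%:E.
Proof.
have vB : (v <= B)%N by rewrite -ltnS ltn_ord.
rewrite (_ : _ `&` _ = [set` Interval (BLeft (v%:R / Bp%:R))
   (if v == B :> nat then BRight 1 else BLeft (v.+1%:R / Bp%:R) : itv_bound R)]).
  rewrite lebesgue_measure_itv /=; case: eqVneq => [->|nB] /=.
    rewrite lte_fin ltr_pdivrMr// mul1r ltr_nat ltnSn -EFinD; congr (_%:E).
    by rewrite -natr1; field; rewrite natr1 pnatr_eq0.
  rewrite lte_fin ltr_pM2r ?invr_gt0// ltr_nat ltnSn -EFinD; congr (_%:E).
  by rewrite -mulrBl -natr1 addrAC subrr add0r mul1r.
have v0 : 0 <= v%:R / Bp%:R :> R by rewrite divr_ge0.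
have v1 : v.+1%:R / Bp%:R <= 1 :> R by rewrite ler_pdivrMr// mul1r ler_nat.
apply/seteqP; split=> r /=.
  move=> [/eqP]; rewrite cell_itvP !in_itv /=.
  case: (eqVneq (v : nat) 0%N) => [->|_] /=; case: (eqVneq _ B) => //= _;
    rewrite ?andbT ?mul0r => a /andP[c e]; by rewrite ?c ?e ?a.
move=> h; split.
  apply/eqP; rewrite cell_itvP; move: h; rewrite !in_itv /=.
  by case: (eqVneq (v : nat) 0%N) => _ /=; case: (eqVneq _ B) => //= _ /andP[c e]; rewrite ?c ?e.
move: h; rewrite !in_itv /= => /andP[h1 h2]; rewrite (le_trans v0 h1)/=.
by move: h2; case: ifP => _ //= /ltW /le_trans; apply.
Qed.

Definition clamp (r : R) : R := Num.min (Num.max r 0) 1.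

Lemma clamp01 r : 0 <= clamp r <= 1.
Proof. by rewrite /clamp le_min ler01 le_max lexx orbT ge_min lexx orbT. Qed.

Lemma clamp_id r : 0 <= r <= 1 -> clamp r = r.
Proof. by move=> /andP[r0 r1]; rewrite /clamp (max_idPl r0) (min_idPl r1). Qed.

Lemma grid_cell_dist r : `|(grid_cell r)%:R / Bp%:R - clamp r| <= Bp%:R^-1.
Proof.
rewrite grid_cellE /clamp.
have BV : 0 <= Bp%:R^-1 :> R by rewrite invr_ge0.
have BB : B%:R / Bp%:R = 1 - Bp%:R^-1 :> R.
  by rewrite -natr1; field; rewrite natr1 pnatr_eq0.
case: (leP r 0) => [r0|r0].
  have -> : Num.truncn (Bp%:R * r) = 0%N.
    by apply/eqP; rewrite -leqn0 truncn_le_nat (le_lt_trans _ ltr01)// mulr_ge0_le0.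
  by rewrite min0n mul0r (min_idPl ler01) subr0 normr0.
have t0 : 0 <= Bp%:R * r by rewrite mulr_ge0// ltW.
case: (leqP (Num.truncn (Bp%:R * r)) B) => h.
  have rlt : r < 1.
    by move: h; rewrite truncn_le_nat -[ltRHS]mulr1 ltr_pM2l.
  rewrite (min_idPl (ltW rlt)).
  have /andP[h1 h2] := truncn_itv t0.
  have {}h1 : (Num.truncn (Bp%:R * r))%:R / Bp%:R <= r by rewrite ler_pdivrMr// [r * _]mulrC.
  have {}h2 : r < (Num.truncn (Bp%:R * r))%:R / Bp%:R + Bp%:R^-1.
    by rewrite -[X in _ + X]mul1r -mulrDl natr1 ltr_pdivlMr// [r * _]mulrC.
  rewrite ler_norml; apply/andP; split; last by rewrite (le_trans _ BV)// subr_le0.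
  by rewrite lerNl opprB lerBlDl ltW.
have r1 : 1 <= r.
  by move: h; rewrite truncn_gt_nat -[leLHS]mulr1 ler_pM2l.
by rewrite (min_idPr r1) BB addrAC subrr sub0r normrN ger0_norm.
Qed.

End GridCells.

Section CubeMean.
Context {R : realType} (g : nat -> R).
Hypothesis g_ge0 : forall j, 0 <= g j.
Hypothesis g_summable : (\esum_(u in [set: {fset nat}]) (weight g u)%:E < +oo)%E.
Context (mu : {measure set (g_sigma_algebraType (@cylinders R)) -> \bar R}).
Hypothesis mu_product : is_product_lebesgue mu.
Local Notation T := (g_sigma_algebraType (@cylinders R)).
Local Notation U := {x : nat -> R | @cube R x}.

Lemma mu_setT : mu setT = 1%E.
Proof.
have := @mu_product 0 (fun=> setT) (fun=> measurableT); rewrite big_ord0 => <-.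
by congr (mu _); apply/seteqP; split.
Qed.

Lemma cylinder_measurable n (A : nat -> set R) : (forall i, measurable (A i)) ->
  measurable ([set x : nat -> R | forall i, (i < n)%N -> A i (x i)] : set T).
Proof.
move=> mA.
rewrite (_ : [set x | _] = \bigcap_(i in `I_n) [set x : nat -> R | A i (x i)]).
  apply: fin_bigcap_measurable => [|i _]; first exact: finite_II.
  by apply: sub_sigma_algebra; exists i, (A i).
by apply/seteqP; split.
Qed.

(** Composition with [clampx] extends a function on the cube to all sequences without changing it on
    the cube, which has full measure. *)
Definition clampx (x : nat -> R) : nat -> R := fun j => clamp (x j).

Lemma cube_clampx x : cube (clampx x).
Proof. by move=> j; exact: clamp01. Qed.

Lemma clampx_id x : cube x -> clampx x = x.
Proof. by move=> hx; apply/funext => j; exact: clamp_id. Qed.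

Section Grid.
Context (n B : nat).
Definition grid_index (x : nat -> R) : {ffun 'I_n -> 'I_B.+1} := [ffun i : 'I_n => grid_cell B (x i)].

Let grid_set (t : {ffun 'I_n -> 'I_B.+1}) (i : nat) : set R :=
  if insub i is Some k then [set r | grid_cell B r = t k] else setT.

Let grid_setP t : [set x : nat -> R | grid_index x = t] =
  [set x | forall i, (i < n)%N -> grid_set t i (x i)].
Proof.
apply/seteqP; split=> x /=.
  by move=> <- i i_n; rewrite /grid_set insubT /= ffunE.
move=> h; apply/ffunP => k; rewrite ffunE.
by have := h k (ltn_ord k); rewrite /grid_set valK.
Qed.

Let grid_set_measurable t i : measurable (grid_set t i).
Proof.
by rewrite /grid_set; case: insubP => [k _ _|_]; [exact: grid_cell_measurable|exact: measurableT].
Qed.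

Lemma grid_index_measurable t : measurable ([set x | grid_index x = t] : set T).
Proof. by rewrite grid_setP; apply: cylinder_measurable. Qed.

Lemma grid_index_uniform t : mu [set x | grid_index x = t] = (B.+1%:R^-1 ^+ n)%:E.
Proof.
rewrite grid_setP mu_product//.
rewrite (eq_bigr (fun=> (B.+1%:R^-1)%:E)).
  by rewrite prodEFin prodr_const card_ord.
by move=> i _; rewrite /grid_set valK grid_cell_measure.
Qed.
End Grid.

Let wprod n (x y : nat -> R) : R := \prod_(j < n) (1 + g j * kern (x j) (y j)).

(** The infinite product of the 1 + g_j, a common bound for all partial products and for K(x, x) on
    the cube. *)
Let Gbound : R := ssum (weight g).

Let wprod_le n x y : cube x -> cube y -> `|wprod n x y| <= Gbound.
Proof.
move=> hx hy.
apply: (@le_trans _ _ (\prod_(j < n) (1 + g j))).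
  rewrite normr_prod; apply: ler_prod => j _; rewrite normr_ge0/=.
  apply: le_trans (ler_normD _ _) _; rewrite normr1 lerD2l normrM ger0_norm//.
  by rewrite ler_piMr// (le_trans (kern_le (hx j) (hy j)))//; lra.
have h := ssum_prod_cvg g_summable (fun j => eq_ind_r (fun z => z <= g j) (lexx _) (ger0_norm (g_ge0 j))).
apply: (cvgn_geP (n0 := n) _ h) => m nm.
rewrite -!(big_mkord xpredT (fun j => 1 + g j)) (big_cat_nat (n := n) (p := m))//=.
rewrite ler_peMr//; first by rewrite prodr_ge0// => j _; rewrite addr_ge0.
rewrite big_seq; apply: (big_ind (fun z => 1 <= z)) => // [a c a1 c1|j _].
  by rewrite -[1]mulr1 ler_pM.
by rewrite lerDl.
Qed.

Let grid_point (n B : nat) (x : nat -> R) (j : nat) : R :=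
  if insub j : option 'I_n is Some k then (grid_index n B x k)%:R / B.+1%:R else 0.

(** The grid indices are uniform on a finite product of sets, so the mean factors by
    distributivity. *)
Let grid_mean_wprod n B y : cube y -> mean mu (fun x : T => wprod n (grid_point n B x) y) =
  \prod_(j < n) (1 + g j * (B.+1%:R^-1 * \sum_(i < B.+1) kern (i%:R / B.+1%:R) (y j))).
Proof.
move=> hy.
pose phi (t : {ffun 'I_n -> 'I_B.+1}) := \prod_(j < n) (1 + g j * kern ((t j)%:R / B.+1%:R) (y j)).
rewrite (_ : (fun x => _) = (fun x => phi (grid_index n B x))); last first.
  by apply/funext => x; apply: eq_bigr => j _; rewrite /grid_point valK.
rewrite (mean_finite mu_setT (@grid_index_measurable n B) (@grid_index_uniform n B) phi).
rewrite -(bigA_distr_bigA (fun (j : 'I_n) (i : 'I_B.+1) => 1 + g j * kern (i%:R / B.+1%:R) (y j))).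
have -> : B.+1%:R^-1 ^+ n = \prod_(j < n) B.+1%:R^-1 :> R by rewrite prodr_const card_ord.
rewrite -big_split; apply: eq_bigr => j _ /=.
rewrite big_split /= sumr_const card_ord -mulr_sumr mulrDr mulrCA; congr (_ + _).
by rewrite -[1 *+ _]/(B.+1%:R) mulVf// pnatr_eq0.
Qed.

(** As the grid is refined, each factor tends to 1 because the grid means of k tend to 0; bounded
    convergence identifies the limit. *)
Let mean_wprod_clamp n y : cube y ->
  bounded_rv (fun x : T => wprod n (clampx x) y) /\
  mean mu (fun x : T => wprod n (clampx x) y) = 1.
Proof.
move=> hy.
have gp x B j : (j < n)%N -> `|grid_point n B x j - clamp (x j)| <= B.+1%:R^-1.
  by move=> jn; rewrite /grid_point insubT ffunE; exact: grid_cell_dist.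
have gp01 x B : cube (grid_point n B x).
  move=> j; rewrite /grid_point; case: insubP => [k _ _|_]; last by rewrite lexx ler01.
  by rewrite divr_ge0//= ler_pdivrMr// mul1r ler_nat ltnW.
have bgrid B : bounded_rv (fun x : T => wprod n (grid_point n B x) y).
  pose phi (t : {ffun 'I_n -> 'I_B.+1}) :=
    \prod_(j < n) (1 + g j * kern ((t j)%:R / B.+1%:R) (y j)).
  rewrite (_ : (fun x => _) = (fun x => phi (grid_index n B x))).
    exact: (finite_bounded_rv (@grid_index_measurable n B) phi).
  by apply/funext => x; apply: eq_bigr => j _; rewrite /grid_point valK.
have cgrid x : (fun B => wprod n (grid_point n B x) y) @ \oo --> wprod n (clampx x) y.
  apply: cvgn_prod => j; apply: cvgD; first exact: cvg_cst.
  apply: cvgM; first exact: cvg_cst.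
  apply/cvgnP => e e0; have [n0 hn0] := harmonic_small e0; exists n0 => B /hn0 hB.
  apply: le_lt_trans (kern_lip (gp01 x B j) (clamp01 (x j)) (hy j)) _.
  exact: le_lt_trans (gp x B j (ltn_ord j)) hB.
have [bX hm] := mean_bounded_cvg mu_setT bgrid (fun B x => wprod_le n (gp01 x B) hy) cgrid.
split => //; apply: (cvgn_unique hm).
apply: (cvgn_ext (u := fun B => \prod_(j < n) (1 + g j *
   (B.+1%:R^-1 * \sum_(i < B.+1) kern (i%:R / B.+1%:R) (y j))))) => [B|].
  by rewrite grid_mean_wprod.
rewrite [X in _ --> X](_ : 1 = \prod_(j < n) (1 + g j * 0)); last first.
  by rewrite big1// => j _; rewrite mulr0 addr0.
apply: cvgn_prod => j; apply: cvgD; first exact: cvg_cst.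
apply: cvgM; first exact: cvg_cst.
apply: (@cvgn_squeeze0 _ _ harmonic) => [B|]; last exact: cvg_harmonic.
exact: kern_grid_mean.
Qed.

Let wprod_cvg x y : cube x -> cube y -> (fun n => wprod n x y) @ \oo --> kernK g x y.
Proof.
move=> hx hy; have := @kernK_cvg _ _ g_ge0 g_summable 0 _ _ hx hy.
by rewrite tailw0; under eq_fun do rewrite big_mkord.
Qed.

Let mean_kernK_clamp y : cube y ->
  bounded_rv (fun x : T => kernK g (clampx x) y) /\
  mean mu (fun x : T => kernK g (clampx x) y) = 1.
Proof.
move=> hy.
have [bX hm] := @mean_bounded_cvg _ _ _ mu mu_setT
  (fun n (x : T) => wprod n (clampx x) y) (fun x => kernK g (clampx x) y) Gbound
  (fun n => (mean_wprod_clamp n hy).1)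
  (fun n x => wprod_le n (cube_clampx x) hy) (fun x => wprod_cvg (cube_clampx x) hy).
split => //; apply: (cvgn_unique hm).
by under eq_fun do rewrite (mean_wprod_clamp _ hy).2; exact: cvg_cst.
Qed.

Let kernK_diag_le x : cube x -> kernK g x x <= Gbound.
Proof.
move=> hx; have h := @wprod_cvg _ _ hx hx; apply: (cvgn_leP (n0 := 0) _ h) => n _.
exact: le_trans (ler_norm _) (wprod_le n hx hx).
Qed.

(** The cube is the intersection of a decreasing sequence of cylinders of mass 1. *)
Let mean_indic_cube : bounded_rv (\1_(@cube R) : T -> R) /\ mean mu (\1_(@cube R) : T -> R) = 1.
Proof.
pose C n : set T := [set x : nat -> R | forall i, (i < n)%N -> `[0%R, 1%R]%classic (x i)].
have m01 (i : nat) : measurable (`[0%R, 1%R]%classic : set R) by exact: measurable_itv.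
have mC n : measurable (C n) by exact: (cylinder_measurable n m01).
have C1 n : mean mu (\1_(C n)) = 1.
  rewrite mean_indic// (mu_product n m01) big1// => i _.
  by rewrite setIid lebesgue_measure_itv /= lte_fin ltr01 -EFinD subr0.
have C_le n x : `|\1_(C n) x : R| <= 1 by rewrite indicE normr_nat lern1 leq_b1.
have C_cvg x : (fun n => \1_(C n) x : R) @ \oo --> (\1_(@cube R) x : R).
  have [hx|hx] := pselect (@cube R x).
    rewrite indicE mem_set//; apply: (cvgn_ext (u := fun=> 1)) => [n|]; last exact: cvg_cst.
    by rewrite indicE mem_set// => i _ /=; rewrite in_itv /=; exact: hx.
  rewrite indicE memNset//; move/existsNP: hx => [j hj].
  apply/cvgnP => e e0; exists j.+1 => n jn; rewrite indicE memNset ?subrr ?normr0// => h.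
  by apply: hj; have := h j jn; rewrite /= in_itv.
have [bX hm] := mean_bounded_cvg mu_setT (fun n => bounded_rv_indic (mC n)) C_le C_cvg.
split => //; apply: (cvgn_unique hm).
by under eq_fun do rewrite C1; exact: cvg_cst.
Qed.

Context (H : set ((nat -> R) -> R)) (ip : ((nat -> R) -> R) -> ((nat -> R) -> R) -> R).
Hypothesis rk : is_rkhs (@cube R) (kernK g) H ip.

(** Every section of K has integral 1, and convergence in the space is uniform on the cube because
    K(x, x) is bounded there. The same limit provides the measurability of [f] composed with
    [clampx]. *)
Lemma integral_mu_approximates f (s : nat -> seq (R * U)) : H f -> approximates (kernK g) ip s f ->
  (fun n => \sum_(p <- s n) p.1) @ \oo --> integral_mu g mu f.
Proof.
move=> Hf sf.
pose F n := felem (kernK g) (s n).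
have HF n : H (F n) by exact: (rkhs_felem rk).
have FE n x : F n (clampx x) = \sum_(p <- s n) p.1 * kernK g (clampx x) (sval p.2).
  by apply: eq_bigr => p _; rewrite ksectionE//; exact: cube_clampx.
have FEf n : (fun x : T => F n (clampx x)) =
    (fun x : T => \sum_(p <- s n) p.1 * kernK g (clampx x) (sval p.2)).
  by apply/funext => x; exact: FE.
have bF n : bounded_rv (fun x : T => F n (clampx x)).
  rewrite FEf; apply: bounded_rv_sum => p; apply: bounded_rvZ.
  exact: (mean_kernK_clamp (svalP p.2)).1.
have mF n : mean mu (fun x : T => F n (clampx x)) = \sum_(p <- s n) p.1.
  rewrite FEf (mean_sum mu_setT) => [|p]; last first.
    by apply: bounded_rvZ; exact: (mean_kernK_clamp (svalP p.2)).1.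
  apply: eq_bigr => p _; rewrite (meanZ mu_setT) ?(mean_kernK_clamp (svalP p.2)).2 ?mulr1//.
  exact: (mean_kernK_clamp (svalP p.2)).1.
have G0 : 0 <= Gbound by apply: le_trans (wprod_le 0 (@cube_halves R) (@cube_halves R)).
have bf : bounded_rv (fun x : T => f (clampx x)).
  split.
    apply: (measurable_fun_cvg (h := fun n (x : T) => F n (clampx x))) => [n|x _].
      exact: (bF n).1.
    exact: (rkhs_cvg_eval rk HF Hf (cube_clampx x) sf).
  exists (Num.sqrt (ip f f * Gbound)) => x.
  have q0 : 0 <= ip f f * Gbound by rewrite mulr_ge0// (rkhs_ip_ge0 rk).
  rewrite -(@ler_pXn2r _ 2)// ?nnegrE ?sqrtr_ge0// sqr_sqrtr// real_normK ?num_real//.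
  apply: le_trans (rkhs_eval_le rk Hf (cube_clampx x)) _.
  by rewrite ler_wpM2l ?(rkhs_ip_ge0 rk)//; exact: kernK_diag_le (cube_clampx x).
have c1 : (fun n => mean mu (fun x : T => F n (clampx x))) @ \oo --> mean mu (fun x : T => f (clampx x)).
  have bd n : bounded_rv (fun x : T => F n (clampx x) + -1 * f (clampx x)).
    by apply: bounded_rvD => //; exact: bounded_rvZ.
  have c0 : (fun n => mean mu (fun x : T => F n (clampx x)) - mean mu (fun x : T => f (clampx x)))
      @ \oo --> (0 : R).
    apply: cvgn_sqr0.
    apply: (@cvgn_squeeze0 _ _ (fun n => ip (F n \- f) (F n \- f) * Gbound)) => [n|]; last first.
      by rewrite -[X in _ --> X](mul0r Gbound); apply: cvgM => //; exact: cvg_cst.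
    have q0 : 0 <= ip (F n \- f) (F n \- f) * Gbound.
      by rewrite mulr_ge0// (rkhs_ip_ge0 rk)//; exact: (rkhs_sub rk).
    rewrite ger0_norm ?sqr_ge0// -mulN1r -(meanZ mu_setT)// -(meanD mu_setT)//; last exact: bounded_rvZ.
    rewrite -(real_normK (num_real _)) -[leRHS]sqr_sqrtr//.
    rewrite ler_pXn2r ?nnegrE ?sqrtr_ge0//; apply: (mean_norm_le mu_setT) => // x.
    rewrite -(@ler_pXn2r _ 2)// ?nnegrE ?sqrtr_ge0// sqr_sqrtr// real_normK ?num_real// mulN1r.
    apply: le_trans (rkhs_eval_le rk (rkhs_sub rk (HF n) Hf) (cube_clampx x)) _.
    rewrite ler_wpM2l//; first by apply: (rkhs_ip_ge0 rk); exact: (rkhs_sub rk).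
    exact: kernK_diag_le (cube_clampx x).
  rewrite -[X in _ --> X]add0r.
  under eq_fun do rewrite -[mean mu (fun x : T => F _ _)](subrK (mean mu (fun x : T => f (clampx x)))).
  by apply: cvgD => //; exact: cvg_cst.
have -> : integral_mu g mu f = mean mu (fun x : T => f (clampx x)).
  rewrite /integral_mu domK_cube// Rintegral_mkcond.
  have -> : f \_ (@cube R) = (fun x : T => \1_(@cube R) x * f (clampx x)).
    apply/funext => x; rewrite /patch indicE; case: ifPn => [xc|_]; last by rewrite mul0r.
    by rewrite mul1r clampx_id//; exact: set_mem.
  have [bC mC] := mean_indic_cube.
  have [_ [M hM]] := bf.
  have bd : bounded_rv (fun x : T => f (clampx x) + -1 * (\1_(@cube R) x * f (clampx x))).
    by apply: bounded_rvD => //; apply: bounded_rvZ; exact: bounded_rvM.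
  (* This majorant of the difference is 0 on the cube and [M] off it, hence of mean 0. *)
  have bM : bounded_rv (fun x : T => M + - M * \1_(@cube R) x).
    by apply: bounded_rvD; [exact: bounded_rv_cst|exact: bounded_rvZ].
  have M0 : mean mu (fun x : T => M + - M * \1_(@cube R) x) = 0.
    rewrite (meanD mu_setT) ?(mean_cst mu_setT) ?(meanZ mu_setT)//; last exact: bounded_rvZ.
      by rewrite mC; ring.
    exact: bounded_rv_cst.
  have hle x : `|f (clampx x) + -1 * (\1_(@cube R) x * f (clampx x))| <= M + - M * \1_(@cube R) x.
    rewrite indicE; case: (x \in @cube R) => /=.
      by rewrite mul1r mulN1r subrr normr0 mulr1 subrr.
    by rewrite mul0r !mulr0 !addr0.
  have d0 : mean mu (fun x : T => f (clampx x) + -1 * (\1_(@cube R) x * f (clampx x))) = 0.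
    apply/eqP; rewrite eq_le; apply/andP; split.
      rewrite -M0; apply: (mean_le mu_setT) => // x; exact: le_trans (ler_norm _) (hle x).
    rewrite -[X in 0 <= X]opprK oppr_ge0 -[X in X <= 0]mulN1r -(meanZ mu_setT)// -M0.
    apply: (mean_le mu_setT) => //.
      exact: bounded_rvZ.
    by move=> x; rewrite [leLHS]mulN1r; apply: le_trans (hle x); rewrite -normrN ler_norm.
  move: d0; rewrite (meanD mu_setT)//; last by apply: bounded_rvZ; exact: bounded_rvM.
  rewrite (meanZ mu_setT); last exact: bounded_rvM.
  by rewrite [X in _ + X]mulN1r => /eqP; rewrite subr_eq0 => /eqP ->.
by under eq_fun do rewrite -mF.
Qed.

End CubeMean.

(** * Consequences of the decay of the weights *)

Section DecayEstimates.
Context {R : realType}.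
Implicit Types (g : nat -> R) (p q r : R).

Lemma hat_weight1 g j : hat_weight g [fset j]%fset = g j / 12.
Proof. by rewrite /hat_weight /weight big_seq_fset1 cardfs1 expr1 kern_half. Qed.

(* Among the [j.+1] distinct singletons [{l}], [l <= j], one has index at least [j] in the
   enumeration. *)
Lemma decay_bound g u q : (forall j, 0 <= g j) -> (forall i j, (i <= j)%N -> g j <= g i) ->
  decreasing_enum g u -> 0 <= q -> (q%:E < decay g u)%E ->
  exists2 C : R, 0 < C & forall j, g j <= C * j.+1%:R `^ (- q).
Proof.
move=> g0 gd [uinj urange ud] q0 /ereal_sup_gt[_ [q' hq' <-]]; rewrite lte_fin => qq'.
have [M [_ hM]] := cvg_seq_bounded (cvgP _ hq').
have {}hM i : `|hat_weight g (u i) * i.+1%:R `^ q'| <= `|M| + 1.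
  apply: hM => //; apply: le_lt_trans (ler_norm M) _; by rewrite ltrDl.
(* 12 is the inverse of k(1/2, 1/2), the factor between g_j and the modified weight of {j}. *)
pose C := 12 * (`|M| + 1).
have C0 : 0 < C by rewrite mulr_gt0// ltr_wpDl.
exists C => // j; have [gj|gj] := leP (g j) 0.
  by rewrite (le_trans gj)// mulr_ge0 ?powR_ge0// ltW.
have /choice[idx hidx] (l : nat) : exists i, (l <= j)%N -> u i = [fset l]%fset.
  have [lj|] := leqP l j; last by exists 0%N.
  have : range u [fset l]%fset.
    rewrite urange; split; first by apply/eqP; rewrite -cardfs_eq0 cardfs1.
    by rewrite /weight big_seq_fset1 (lt_le_trans gj)// gd.
  by move=> [i _ ui]; exists i.
have [l lj jl] : exists2 l, (l <= j)%N & (j <= idx l)%N.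
  apply: contrapT => hno.
  have lt_j (l : 'I_j.+1) : (idx l < j)%N.
    rewrite ltnNge; apply/negP => h; apply: hno; exists (l : nat) => //.
    by rewrite -ltnS.
  pose h (l : 'I_j.+1) : 'I_j := Ordinal (lt_j l).
  have hl (l : 'I_j.+1) : u (idx l) = [fset (l : nat)]%fset by apply: hidx; rewrite -ltnS.
  have hi : injective h.
    move=> l l' /(congr1 val) /= e; apply/val_inj/fset1_inj.
    by rewrite -!hl e.
  by have := leq_card h hi; rewrite !card_ord ltnn.
have h1 : g j / 12 <= hat_weight g (u (idx l)).
  by rewrite hidx// hat_weight1 ler_pM2r ?invr_gt0// gd.
have h0 : 0 <= hat_weight g (u (idx l)) by apply: le_trans h1; rewrite divr_ge0// ltW.
have := hM (idx l); rewrite (ger0_norm (mulr_ge0 h0 (powR_ge0 _ _))) => h2.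
have h3 : hat_weight g (u (idx l)) <= (`|M| + 1) * j.+1%:R `^ (- q).
  have jq0 : 0 < j.+1%:R `^ q :> R by rewrite powR_gt0// ltr0n.
  rewrite powRN -ler_pdivrMr ?invr_gt0// invrK; apply: le_trans h2.
  rewrite ler_wpM2l//; apply: (@le_trans _ _ ((idx l).+1%:R `^ q)).
    by rewrite ge0_ler_powR ?nnegrE// ler_nat ltnS.
  by rewrite ler_powR ?ler1n// ltW.
by rewrite /C -mulrA; move: h1 h3; rewrite ler_pdivrMr//; lra.
Qed.

Lemma powR_natX (a x : R) k : 0 < a -> (a ^+ k) `^ x = (a `^ x) ^+ k.
Proof.
by move=> /ltW a0; rewrite -(powR_mulrn k a0) -(powR_mulrn k (powR_ge0 a x)); exact: powRAC.
Qed.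

(* Cauchy condensation. *)
Lemma pseries_bound r : 1 < r -> exists2 S : R, 0 < S &
  forall n, \sum_(0 <= j < n) j.+1%:R `^ (- r) <= S.
Proof.
move=> r1; have two0 : 0 < 2 :> R by [].
pose rho : R := 2 `^ (1 - r).
have rho0 : 0 < rho by rewrite powR_gt0.
have rho1 : rho < 1.
  rewrite /rho /powR gt_eqF// -[ltRHS]expR0 ltr_expR nmulr_rlt0 ?subr_lt0//.
  by rewrite ln_gt0// ltr1n.
pose A k : R := \sum_(0 <= j < 2 ^ k) j.+1%:R `^ (- r).
have AS k : A k.+1 <= A k + rho ^+ k.
  rewrite /A (big_cat_nat (n := 2 ^ k))//=; last by rewrite leq_exp2l.
  rewrite lerD2l; apply: (@le_trans _ _ (\sum_(2 ^ k <= j < 2 ^ k.+1) (2 ^+ k) `^ (- r))).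
    rewrite big_nat [leRHS]big_nat; apply: ler_sum => j /andP[kj _].
    rewrite !powRN lef_pV2 ?posrE ?powR_gt0 ?exprn_gt0//.
    rewrite ge0_ler_powR ?nnegrE ?exprn_ge0//; first by lra.
    by rewrite -natrX ler_nat ltnW.
  rewrite sumr_const_nat expnS mul2n -addnn addnK -[leLHS]mulr_natl natrX.
  rewrite powR_natX// -exprMn /rho powRB ?implybE ?pnatr_eq0 ?orbT// powRr1// powRN.
  by [].
have AK k : A k <= 1 + \sum_(i < k) rho ^+ i.
  elim: k => [|k IH]; first by rewrite /A expn0 big_nat1 powR1 big_ord0 addr0.
  by rewrite big_ord_recr /= addrA (le_trans (AS k))// lerD2r.
exists (1 + (1 - rho)^-1) => [|n].
  by rewrite ltr_wpDr// invr_ge0 subr_ge0 ltW.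
apply: (@le_trans _ _ (A n)).
  rewrite /A [leRHS](big_cat_nat (n := n))//=; last by rewrite ltnW// ltn_expl.
  by rewrite lerDl sumr_ge0// => j _; exact: powR_ge0.
apply: le_trans (AK n) _; rewrite lerD2l.
have r0 : 0 < 1 - rho by rewrite subr_gt0.
rewrite -(ler_pM2l r0) mulfV ?gt_eqF// -opprB mulNr -subrX1 opprB.
by rewrite lerBlDr lerDl exprn_ge0// ltW.
Qed.

End DecayEstimates.

Section PowerDecay.
Context {R : realType} (g : nat -> R) (C p : R).
Hypothesis g_ge0 : forall j, 0 <= g j.
Hypothesis C_gt0 : 0 < C.
Hypothesis g_le : forall j, g j <= C * j.+1%:R `^ (- p).

Lemma sum_powR_bound (e : R) : 0 < e -> 1 < p * e -> exists2 S : R, 0 < S &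
  forall n, \sum_(0 <= j < n) g j `^ e <= S.
Proof.
move=> e0 pe1; have [S S0 hS] := pseries_bound pe1.
exists (C `^ e * S) => [|n]; first by rewrite mulr_gt0 ?powR_gt0.
apply: (@le_trans _ _ (C `^ e * \sum_(0 <= j < n) j.+1%:R `^ (- (p * e)))); last first.
  by rewrite ler_wpM2l ?powR_ge0.
rewrite mulr_sumr; apply: ler_sum => j _.
rewrite -mulNr powRrM -powRM ?powR_ge0 ?(ltW C_gt0)//.
rewrite ge0_ler_powR ?nnegrE ?(ltW e0)// mulr_ge0 ?powR_ge0//; exact: ltW.
Qed.

(** Splitting off (j+1)^(-al) <= (L+1)^(-al) leaves the exponent p - al > 1, whose series
    converges. *)
Lemma tail_sum_bound (al : R) : 0 <= al -> al < p - 1 -> exists2 S : R, 0 < S &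
  forall L n, \sum_(L <= j < n) g j <= S * L.+1%:R `^ (- al).
Proof.
move=> al0 alp; have pal : 1 < p - al by lra.
have [S S0 hS] := pseries_bound pal.
exists (C * S) => [|L n]; first by rewrite mulr_gt0.
apply: (@le_trans _ _ (C * L.+1%:R `^ (- al) * \sum_(L <= j < n) j.+1%:R `^ (- (p - al)))).
  rewrite mulr_sumr big_nat [leRHS]big_nat; apply: ler_sum => j /andP[Lj _].
  apply: le_trans (g_le j) _; rewrite -mulrA ler_wpM2l ?(ltW C_gt0)//.
  rewrite (_ : - p = - al + - (p - al)); last by ring.
  rewrite powRD; last by rewrite pnatr_eq0 implybT.
  rewrite ler_wpM2r ?powR_ge0// !powRN lef_pV2 ?posrE ?powR_gt0 ?ltr0n//.
  by rewrite ge0_ler_powR ?nnegrE// ler_nat ltnS.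
rewrite mulrAC ler_wpM2r ?powR_ge0// ler_wpM2l ?(ltW C_gt0)//.
apply: le_trans (hS n); have [Ln|nL] := leqP L n.
  rewrite [leRHS](big_cat_nat (n := L))//= lerDr sumr_ge0// => j _; exact: powR_ge0.
by rewrite big_geq ?(ltnW nL)// sumr_ge0// => j _; exact: powR_ge0.
Qed.

Lemma prod_le_expR (z : nat -> R) l n : (forall j, 0 <= z j) ->
  \prod_(l <= j < n) (1 + z j) <= expR (\sum_(l <= j < n) z j).
Proof.
move=> z0; rewrite expR_sum; apply: ler_prod => j _.
by rewrite addr_ge0//= expR_ge1Dx.
Qed.

Lemma expR_sub1_le (x : R) : expR x - 1 <= x * expR x.
Proof.
have := expR_ge1Dx (- x); rewrite -(ler_pM2r (expR_gt0 x)) expRN mulVf ?gt_eqF ?expR_gt0//.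
lra.
Qed.

Hypothesis g_summable : (\esum_(u in [set: {fset nat}]) (weight g u)%:E < +oo)%E.

(** A product of factors 1 + x_j is at most e^x, x being the sum of the x_j, and e^x - 1 <= x e^x;
    here x is a twelfth of a tail sum of the weights. *)
Lemma kconst_bound (al : R) : 0 <= al -> al < p - 1 -> exists2 S : R, 0 < S &
  forall L, kconst g L - 1 <= S * L.+1%:R `^ (- al).
Proof.
move=> al0 alp; have [S S0 hS] := tail_sum_bound al0 alp.
exists (S * expR S) => [|L]; first by rewrite mulr_gt0 ?expR_gt0.
rewrite lerBlDr.
apply: (cvgn_leP (n0 := 0) _ (@kernK_midprod_cvg _ _ g_ge0 g_summable L _ _
  (@cube_halves R) (@cube_halves R))) => n _.
rewrite midprod_halves -lerBlDr.
pose x := \sum_(L <= j < maxn L n) g j / 12.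
have x0 : 0 <= x by rewrite sumr_ge0// => j _; rewrite divr_ge0.
have xS : x <= S * L.+1%:R `^ (- al).
  apply: le_trans (hS L (maxn L n)); apply: ler_sum => j _.
  by rewrite ler_pdivrMr// ler_peMr// ler1n.
have L1 : L.+1%:R `^ (- al) <= 1 :> R.
  rewrite powRN invf_le1 ?powR_gt0 ?ltr0n// -[leLHS](powRr0 L.+1%:R).
  by rewrite ler_powR// ler1n.
have h := @prod_le_expR (fun j => g j / 12) L (maxn L n) (fun j => divr_ge0 (g_ge0 j) (ler0n _ _)).
apply: (@le_trans _ _ (expR x - 1)); first by rewrite lerD2r.
apply: le_trans (expR_sub1_le x) _.
rewrite mulrAC; apply: ler_pM; rewrite ?expR_ge0// ler_expR.
by rewrite (le_trans xS)// ler_piMr// ltW.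
Qed.

Lemma constC_gt0 (b : nat) (lam : R) : (0 < b)%N -> 0 < constC b lam.
Proof.
move=> b0; rewrite /constC lt_max; apply/orP; right.
by rewrite divr_gt0 ?mulr_gt0 ?powR_gt0 ?ltr0n// ?addr_gt0 ?ltr0n.
Qed.

(** In the closed form of [weight_sum], [tau < p] bounds the product by exp(c S) for all z at once;
    the remaining g_z^(1/tau) is raised to the power tau. *)
Lemma weight_sum_bound (b : nat) (tau : R) : (0 < b)%N -> 1 <= tau -> tau < p ->
  exists2 D : R, 0 < D & forall w : {fset nat},
    weight_sum g b tau w `^ tau <= D * g (\max_(j <- w) j).
Proof.
move=> b0 tau1 taup; have tau0 : 0 < tau by lra.
have pt : 1 < p * tau^-1 by rewrite ltr_pdivlMr// mul1r.
have ti0 : 0 < tau^-1 by rewrite invr_gt0.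
have [S S0 hS] := sum_powR_bound ti0 pt.
have c0 := constC_gt0 (tau^-1) b0.
set c := constC b tau^-1 in c0.
exists ((c * expR (c * S)) `^ tau) => [|w].
  by rewrite powR_gt0// mulr_gt0 ?expR_gt0.
rewrite weight_sumE// -/c; set z := \max_(j <- w) j.
have gz : g z = (g z `^ tau^-1) `^ tau by rewrite -powRrM mulVf ?powRr1// gt_eqF.
rewrite [in leRHS]gz -[leRHS]powRM ?powR_ge0 ?mulr_ge0 ?expR_ge0 ?(ltW c0)//.
have pr0 : 0 <= \prod_(j < z) (1 + c * g j `^ tau^-1).
  by apply: prodr_ge0 => j _; rewrite addr_ge0// mulr_ge0 ?powR_ge0// ltW.
rewrite ge0_ler_powR ?nnegrE ?mulr_ge0 ?powR_ge0 ?expR_ge0 ?(ltW c0) ?(ltW tau0)//.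
rewrite mulrAC ler_wpM2r ?powR_ge0// ler_wpM2l ?(ltW c0)//.
rewrite -(big_mkord xpredT (fun j => 1 + c * g j `^ tau^-1)).
apply: le_trans (prod_le_expR _ _ _) _ => [j|]; first by rewrite mulr_ge0 ?powR_ge0// ltW.
by rewrite ler_expR -mulr_sumr ler_wpM2l// ltW.
Qed.

End PowerDecay.

(** * The error of the multilevel algorithm *)

Section SecondMoment.
Context {d} {T : measurableType d} {R : realType} (m : {measure set T -> \bar R}).
Hypothesis m1 : m setT = 1%E.
Context {I : eqType} (X : I -> T -> R).

Lemma bounded_rv_sum_in (l : seq I) : (forall i, i \in l -> bounded_rv (X i)) ->
  bounded_rv (fun w => \sum_(i <- l) X i w).
Proof.
elim: l => [|i l IH] h; first by under eq_fun do rewrite big_nil; exact: bounded_rv_cst.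
under eq_fun do rewrite big_cons; apply: bounded_rvD; first by apply: h; rewrite inE eqxx.
by apply: IH => j jl; apply: h; rewrite inE jl orbT.
Qed.

(** Pythagoras for centred, pairwise uncorrelated variables around the constant [c]. *)
Lemma second_moment (l : seq I) (c : R) : uniq l ->
  (forall i, i \in l -> bounded_rv (X i)) ->
  (forall i, i \in l -> mean m (X i) = 0) ->
  (forall i j, i \in l -> j \in l -> i != j -> mean m (fun w => X i w * X j w) = 0) ->
  mean m (fun w => (c - \sum_(i <- l) X i w) ^+ 2) =
  c ^+ 2 + \sum_(i <- l) mean m (fun w => X i w ^+ 2).
Proof.
have bs := bounded_rv_sum_in.
have orth i (l' : seq I) : bounded_rv (X i) ->
    (forall j, j \in l' -> bounded_rv (X j) /\ mean m (fun w => X i w * X j w) = 0) ->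
    mean m (fun w => X i w * \sum_(j <- l') X j w) = 0.
  move=> bi; elim: l' => [|j l' IH] h.
    by rewrite -[RHS](mean_cst m1); congr mean; apply/funext => w; rewrite big_nil mulr0.
  have [bj hj] := h j (mem_head _ _).
  have h' a : a \in l' -> bounded_rv (X a) /\ mean m (fun w => X i w * X a w) = 0.
    by move=> al; apply: h; rewrite inE al orbT.
  rewrite (_ : (fun w => _) = (fun w => X i w * X j w + X i w * \sum_(j <- l') X j w)); last first.
    by apply/funext => w; rewrite big_cons mulrDr.
  rewrite (meanD m1) ?hj ?add0r; first exact: IH.
    exact: bounded_rvM.
  by apply: bounded_rvM => //; apply: bs => a /h'[].
elim: l => [|i l IH] /= ul hb h0 ho.
  by rewrite big_nil addr0 -[RHS](mean_cst m1); congr mean; apply/funext => w; rewrite big_nil subr0.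
case/andP: ul => il ul.
have hil : i \in i :: l by rewrite inE eqxx.
have hl j : j \in l -> j \in i :: l by rewrite inE => ->; rewrite orbT.
have bX := hb i hil.
have bS : bounded_rv (fun w => \sum_(i <- l) X i w) by apply: bs => j /hl; exact: hb.
have bc : bounded_rv (fun w => c - \sum_(i <- l) X i w).
  under eq_fun do rewrite -mulN1r.
  by apply: bounded_rvD; [exact: bounded_rv_cst|exact: bounded_rvZ].
have XS0 : mean m (fun w => X i w * \sum_(j <- l) X j w) = 0.
  apply: orth => // j jl; split; first exact/hb/hl.
  by apply: ho => //; [exact: hl|apply: contraNneq il => ->].
rewrite big_cons addrCA -IH//; last by move=> a a' /hl ha /hl ha'; exact: ho.
- rewrite (_ : (fun w => _) = (fun w => X i w ^+ 2 + (2 * (X i w * \sum_(j <- l) X j w) +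
     ((- 2 * c) * X i w + (c - \sum_(j <- l) X j w) ^+ 2)))); last first.
    by apply/funext => w; rewrite big_cons; ring.
  have b1 : bounded_rv (fun w => X i w ^+ 2) by exact: bounded_rvM.
  have b2 : bounded_rv (fun w => 2 * (X i w * \sum_(j <- l) X j w)).
    by apply: bounded_rvZ; exact: bounded_rvM.
  have b3 : bounded_rv (fun w => (- 2 * c) * X i w) by exact: bounded_rvZ.
  have b4 : bounded_rv (fun w => (c - \sum_(j <- l) X j w) ^+ 2) by exact: bounded_rvM.
  rewrite (meanD m1)//; last by do 2! apply: bounded_rvD => //.
  rewrite (meanD m1)//; last by apply: bounded_rvD.
  rewrite (meanD m1)// (meanZ m1) ?XS0 ?mulr0 ?add0r; last exact: bounded_rvM.
  by rewrite (meanZ m1)// h0// mulr0 add0r.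
- by move=> a /hl; exact: hb.
- by move=> a /hl; exact: h0.
Qed.

End SecondMoment.

Section ComponentRule.
Context {R : realType} {d : measure_display} {Omega : measurableType d}.
Context (P : probability Omega R) (b : nat).
Hypothesis b_prime : prime b.
Context (perms : nat -> nat -> seq 'F_b -> Omega -> {perm 'F_b}).
Hypothesis perms_uniform : uniform_scrambling P perms.
Context (Hk : {fset nat} -> set ((nat -> R) -> R)).
Context (ipk : {fset nat} -> ((nat -> R) -> R) -> ((nat -> R) -> R) -> R).
Hypothesis rkk : forall w, is_rkhs (@cube R) (kern_prod w) (Hk w) (ipk w).

Definition rule_rv (k L M : nat) (pq : {poly 'F_b} * (nat -> {poly 'F_b}))
    (G : (nat -> R) -> R) (om : Omega) : R :=
  rule_value L M pq (fun j s => perms k j s om) G.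

Lemma rule_rvE k L M pq G om : rule_rv k L M pq G om =
  (b ^ M)%N%:R^-1 * \sum_(h < b ^ M) G (full_point perms k L (lattice_point R M pq.1 pq.2 h) om).
Proof. by []. Qed.

Lemma rule_rv_bounded k L M pq w G : Hk w G -> bounded_rv (rule_rv k L M pq G).
Proof.
move=> HG.
rewrite (_ : rule_rv k L M pq G = (fun om => (b ^ M)%N%:R^-1 *
  \sum_(h < b ^ M) G (full_point perms k L (lattice_point R M pq.1 pq.2 h) om)))//.
apply: bounded_rvZ; apply: bounded_rv_sum => h.
exact: (full_bounded_rv b_prime perms_uniform k L _ (component_regular (rkk w) HG)).
Qed.

Let grid_small w G j : Hk w G -> j \in w -> forall y n, cube y -> (0 < n)%N ->
  (n%:R^-1 * \sum_(i < n) G (upd y j (i%:R / n%:R))) ^+ 2 <= (2 * ipk w G G + 1) * n%:R^-1.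
Proof.
move=> HG jw y n hy n0; apply: le_trans (component_grid_mean (rkk w) HG hy jw n0) _.
have := rkhs_ip_ge0 (rkk w) HG; have : 0 <= n%:R^-1 :> R by rewrite invr_ge0.
by move: (ipk w G G) => a *; rewrite ler_wpM2r//; lra.
Qed.

Lemma rule_rv_mean0 k L M pq w G : Hk w G -> w != fset0 -> (w `<=` initseg L)%fset ->
  mean P (rule_rv k L M pq G) = 0.
Proof.
move=> HG /fset0Pn[j jw] wL.
have P1 := probability_setT P.
have rG := component_regular (rkk w) HG.
have jL : (j < L)%N by rewrite -mem_initseg; exact: (fsubsetP wL).
have bG x := full_bounded_rv b_prime perms_uniform k L x rG.
rewrite (_ : rule_rv k L M pq G = (fun om => (b ^ M)%N%:R^-1 *
  \sum_(h < b ^ M) G (full_point perms k L (lattice_point R M pq.1 pq.2 h) om)))//.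
rewrite (meanZ P1); last by apply: bounded_rv_sum.
rewrite (mean_sum P1)// big1 ?mulr0// => h _.
have := mean_orthogonal b_prime perms_uniform L (lattice_point R M pq.1 pq.2 h)
  (lattice_point R M pq.1 pq.2 h) rG (regular_cst (1 : R)) (grid_small HG jw) jL
  (k := k) (k' := k).
rewrite in_fset0 orbT => /(_ isT) <-; congr mean; apply/funext => om.
by rewrite mulr1.
Qed.

Let rule_rv_orth1 k k' L L' M M' pq pq' w w' G G' j : Hk w G -> Hk w' G' -> j \in w ->
  (w `<=` initseg L)%fset -> (k != k') || (j \notin w') ->
  mean P (fun om => rule_rv k L M pq G om * rule_rv k' L' M' pq' G' om) = 0.
Proof.
move=> HG HG' jw wL kj.
have P1 := probability_setT P.
have rG := component_regular (rkk w) HG; have rG' := component_regular (rkk w') HG'.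
have jL : (j < L)%N by rewrite -mem_initseg; exact: (fsubsetP wL).
have bG x := full_bounded_rv b_prime perms_uniform k L x rG.
have bG' x := full_bounded_rv b_prime perms_uniform k' L' x rG'.
rewrite (_ : (fun om => _) = (fun om => ((b ^ M)%N%:R^-1 * (b ^ M')%N%:R^-1) *
  \sum_(h < b ^ M) \sum_(h' < b ^ M')
    G (full_point perms k L (lattice_point R M pq.1 pq.2 h) om) *
    G' (full_point perms k' L' (lattice_point R M' pq'.1 pq'.2 h') om))); last first.
  apply/funext => om; rewrite !rule_rvE mulrACA; congr (_ * _).
  by rewrite mulr_suml; apply: eq_bigr => h _; rewrite mulr_sumr.
have bGG x x' := bounded_rvM (bG x) (bG' x').
rewrite (meanZ P1); last by do 2! apply: bounded_rv_sum => ?.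
rewrite (mean_sum P1) ?big1 ?mulr0// => [h _|h]; last exact: bounded_rv_sum.
rewrite (mean_sum P1)// big1// => h' _.
exact: (mean_orthogonal b_prime perms_uniform _ _ _ rG rG' (grid_small HG jw) jL kj).
Qed.

(** Different summands use independent permutations, and any coordinate of w serves. Within one
    summand, one of the sets has a coordinate that the other lacks; if that set is w', the two
    factors exchange their roles. *)
Lemma rule_rv_orth k k' L L' M M' pq pq' w w' G G' : Hk w G -> Hk w' G' ->
  (w `<=` initseg L)%fset -> (w' `<=` initseg L')%fset -> w != fset0 ->
  (k, w) != (k', w') ->
  mean P (fun om => rule_rv k L M pq G om * rule_rv k' L' M' pq' G' om) = 0.
Proof.
move=> HG HG' wL wL' /fset0Pn[j jw]; rewrite xpair_eqE negb_and => /orP[kk'|ww'].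
  by apply: (rule_rv_orth1 L' M M' pq pq' HG HG' jw wL); rewrite kk'.
have [ww|/fsubsetPn[i iw iw']] := boolP (w `<=` w')%fset; last first.
  by apply: (rule_rv_orth1 L' M M' pq pq' HG HG' iw wL); rewrite iw' orbT.
have /fsubsetPn[i iw' iw] : ~~ (w' `<=` w)%fset.
  by apply: contra ww' => h; rewrite eqEfsubset ww.
under eq_fun do rewrite mulrC.
by apply: (rule_rv_orth1 L M' M pq' pq HG' HG iw' wL'); rewrite iw orbT.
Qed.

Lemma rule_rv_variance k L M pq w G : Hk w G -> w != fset0 -> (w `<=` initseg L)%fset ->
  variance P (rule_rv k L M pq G) = (mean P (fun om => rule_rv k L M pq G om ^+ 2))%:E.
Proof.
move=> HG w0 wL.
have P1 := probability_setT P.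
have bZ := rule_rv_bounded k L M pq HG.
rewrite /variance unlock !unlock (mean_EFin P1 bZ) (rule_rv_mean0 k M pq HG w0 wL) /=.
rewrite -(mean_EFin P1); last exact: bounded_rvM.
apply: eq_integral => om _; congr EFin.
rewrite -[LHS]/((rule_rv k L M pq G om - 0) * (rule_rv k L M pq G om - 0)).
by rewrite subr0 expr2.
Qed.

End ComponentRule.

Section AlgorithmError.
Context {R : realType} (g : nat -> R).
Hypothesis g_ge0 : forall j, 0 <= g j.
Hypothesis g_decr : forall i j, (i <= j)%N -> g j <= g i.
Hypothesis g_summable : (\esum_(u in [set: {fset nat}]) (weight g u)%:E < +oo)%E.
Context (mu : {measure set (g_sigma_algebraType (@cylinders R)) -> \bar R}).
Hypothesis mu_product : is_product_lebesgue mu.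
Context (b : nat).
Hypothesis b_prime : prime b.
Context {d : measure_display} {Omega : measurableType d} (P : probability Omega R).
Context (perms : nat -> nat -> seq 'F_b -> Omega -> {perm 'F_b}).
Hypothesis perms_uniform : uniform_scrambling P perms.
Context (rule : nat -> nat -> {poly 'F_b} * (nat -> {poly 'F_b})).
Hypothesis rule_good : forall L M k, (0 < L)%N -> (0 < M)%N ->
  good_rule g P L M (perms k) (rule L M).
Context (tau D S Cg al : R).
Hypothesis tau_itv : 1 <= tau < 3.
Hypothesis D_gt0 : 0 < D.
Hypothesis Cg_gt0 : 0 < Cg.
Hypothesis weight_sum_le : forall w : {fset nat},
  weight_sum g b tau w `^ tau <= D * g (\max_(j <- w) j).
Hypothesis kconst_le : forall L, kconst g L - 1 <= S * L.+1%:R `^ (- al).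
Hypothesis g_le : forall L, g L <= Cg * L.+1%:R `^ (- al).
Context (m : nat) (L n : nat -> nat).
Hypothesis m_gt0 : (0 < m)%N.
Hypothesis L1_gt0 : (0 < L 1)%N.
Hypothesis L_n_mono : forall k, (1 <= k < m)%N -> (L k < L k.+1)%N /\ (n k.+1 <= n k)%N.
Hypothesis n_ge : (b <= n m)%N.

(** Below the first level lies the empty set of coordinates, with the constant f(a) as anchored
    function, whereas [L 0] is arbitrary. *)
Definition previous_level (k : nat) : nat := if k is 0 then 0%N else L k.

Definition log_points (k : nat) : nat := trunc_log b (n k).

(** Sets inside the previous level contribute [D * (g 0 + 1)] times a difference of values of
    [kconst], at most S times the rate; the new sets contribute [D * Cg] times the rate, times
    [kconst g 0]. *)
Definition level_const : R := D * (g 0 + 1) * S + D * Cg * kconst g 0.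

Let L_mono k : (1 <= k <= m)%N -> (previous_level k.-1 <= L k)%N /\ (0 < L k)%N.
Proof.
move=> /andP[]; elim: k => // -[_ _ _|k IH _ km]; first by split.
have [h1 _] := @L_n_mono k.+1 km.
by split; [exact: ltnW|exact: leq_trans h1].
Qed.

Let log_gt0 k : (1 <= k <= m)%N -> (0 < log_points k)%N.
Proof.
move=> /andP[k1 km].
have step i : (k + i <= m)%N -> (n (k + i) <= n k)%N.
  elim: i => [|i IH] h; first by rewrite addn0.
  rewrite addnS in h *; have [|_] := L_n_mono (k := (k + i)%N); first by rewrite h addn_gt0 k1.
  by move=> /leq_trans; apply; apply: IH; exact: ltnW.
have nk := step (m - k)%N; rewrite subnKC// leqnn in nk.
rewrite /log_points trunc_log_gt0 prime_gt1//=.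
by apply: leq_trans (nk isT); apply: leq_trans n_ge; rewrite ltn_predL prime_gt0.
Qed.

Context (H : set ((nat -> R) -> R)) (ip : ((nat -> R) -> R) -> ((nat -> R) -> R) -> R).
Hypothesis rk : is_rkhs (@cube R) (kernK g) H ip.
Context (f : (nat -> R) -> R).
Hypothesis Hf : H f.
Hypothesis f_le1 : ip f f <= 1.

Let rate (k : nat) : R := (previous_level k.-1).+1%:R `^ (- al).
Let points (k : nat) : R := ((b ^ log_points k)%N%:R - 1) `^ (- tau).

Lemma algorithm_error :
  (expectation P (fun w => (integral_mu g mu f - multilevel perms rule halves m L n f w) ^+ 2)%R <=
   (S * (L m).+1%:R `^ (- al) +
    \sum_(1 <= k < m.+1) level_const * (previous_level k.-1).+1%:R `^ (- al) *
      ((b ^ trunc_log b (n k))%N%:R - 1) `^ (- tau))%:E)%E.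
Proof.
have P1 := probability_setT P.
have [s sf] := rkhs_dense rk Hf.
have /choice[Hi rki] (w : {fset nat}) : exists Hi : set ((nat -> R) -> R) *
    (((nat -> R) -> R) -> ((nat -> R) -> R) -> R), is_rkhs (@cube R) (kern_prod w) Hi.1 Hi.2.
  have [H0 [ip0 rk0]] := moore_aronszajn (psd_kern_prod (R := R) w).
  by exists (H0, ip0).
pose Hk w := (Hi w).1; pose ipk w := (Hi w).2.
have rkk w : is_rkhs (@cube R) (kern_prod w) (Hk w) (ipk w) by exact: rki.
(* The factor in the variance bound is at most D g_z with z = max w: always at most [o1], where the
   added 1 ensures positivity, and at most [o2 k] if w is not inside the previous level, for then z
   is at least the size of that level. *)
pose o1 : R := D * (g 0 + 1).
have o1_gt0 : 0 < o1 by rewrite mulr_gt0// ltr_wpDl.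
pose o2 k := D * (Cg * rate k).
have rate_gt0 k : 0 < rate k by rewrite /rate powR_gt0.
have o2_gt0 k : 0 < o2 k by rewrite mulr_gt0// mulr_gt0.
pose omega k (w : {fset nat}) := if (w `<=` initseg (previous_level k.-1))%fset then o1 else o2 k.
have /choice[G hG] (k : nat) : exists G : {fset nat} -> (nat -> R) -> R, (1 <= k <= m)%N ->
  [/\ forall w, w \in levellist g (L k) -> Hk w (G w),
      forall x, cube x ->
        f (splice (initseg (L k)) x halves) - f (splice (initseg (previous_level k.-1)) x halves) =
        \sum_(w <- levellist g (L k)) weight g w * G w x,
      \sum_(w <- levellist g (L k)) weight g w * omega k w * ipk w (G w) (G w) <=
       (o1 * (kconst g (previous_level k.-1) - kconst g (L k)) + o2 k * kconst g (L k)) * ip f f &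
      forall x, cube x ->
        (fun N => \sum_(p <- s N) p.1 * (kappa g (L k) p.2 - kappa g (previous_level k.-1) p.2))
        @ \oo --> G fset0 x].
  have [hk|hk] := boolP (1 <= k <= m)%N; last by exists (fun _ _ => 0).
  have [Lk _] := L_mono hk.
  by have [G hG] := level_decomposition g_ge0 g_summable rk rkk Hf sf Lk o1_gt0 (o2_gt0 k); exists G.
pose Z (i : nat * {fset nat}) om := weight g i.2 *
  rule_rv perms i.1 (L i.1) (log_points i.1) (rule (L i.1) (log_points i.1)) (G i.1 i.2) om.
have k_in k : k \in iota 1 m -> (1 <= k <= m)%N by rewrite mem_iota add1n ltnS.
have in_level k w : w \in levellist g (L k) -> (w `<=` initseg (L k))%fset /\ 0 < weight g w.
  by rewrite mem_filter fpowersetE => /andP[].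
(* The empty sets are excluded: their components are constants, which the rules integrate exactly
   and which go into [beta]. *)
pose l := [seq (k, w) | k <- iota 1 m, w <- [seq w <- levellist g (L k) | w != fset0]].
have lP k w : (k, w) \in l ->
    [/\ (1 <= k <= m)%N, w != fset0, w \in levellist g (L k), (w `<=` initseg (L k))%fset &
        0 < weight g w].
  move=> /allpairsPdep[k' [w' [kk' ww' [-> ->]]]].
  move: ww'; rewrite mem_filter => /andP[w0 wl]; have [] := in_level _ _ wl.
  by split => //; exact: k_in.
have ul : uniq l.
  apply: allpairs_uniq_dep => //; first exact: iota_uniq.
    by move=> k _; do 2! apply: filter_uniq; exact: fset_uniq.
  by move=> [k w] [k' w'] _ _ /= [-> ->].
have Hl k w : (k, w) \in l -> Hk w (G k w).
  by move=> /lP[hk _ wl _ _]; have [hG1 _ _ _] := hG k hk; exact: hG1.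
have bZ i : i \in l -> bounded_rv (Z i).
  case: i => k w il; apply: bounded_rvZ.
  exact: (rule_rv_bounded b_prime perms_uniform rkk _ _ _ _ (Hl _ _ il)).
have Z0 i : i \in l -> mean P (Z i) = 0.
  case: i => k w il; have [_ w0 _ wL _] := lP _ _ il; have HG := Hl _ _ il.
  rewrite /Z (meanZ P1)/=; last exact: (rule_rv_bounded b_prime perms_uniform rkk _ _ _ _ HG).
  by rewrite (rule_rv_mean0 b_prime perms_uniform rkk _ _ _ HG)// mulr0.
have Zorth i j : i \in l -> j \in l -> i != j -> mean P (fun om => Z i om * Z j om) = 0.
  case: i => k w il; case: j => k' w' jl ij.
  have [_ w0 _ wL _] := lP _ _ il; have HG := Hl _ _ il.
  have [_ w0' _ wL' _] := lP _ _ jl; have HG' := Hl _ _ jl.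
  under eq_fun do rewrite /Z /= mulrACA.
  rewrite (meanZ P1); last first.
    by apply: bounded_rvM;
      [exact: (rule_rv_bounded b_prime perms_uniform rkk _ _ _ _ HG)
      |exact: (rule_rv_bounded b_prime perms_uniform rkk _ _ _ _ HG')].
  by rewrite (rule_rv_orth b_prime perms_uniform rkk _ _ _ _ HG HG')// mulr0.
have Zvar k w : (k, w) \in l -> mean P (fun om => Z (k, w) om ^+ 2) <=
    points k * (weight g w * omega k w * ipk w (G k w) (G k w)).
  move=> il; have [hk w0 wl wL wpos] := lP _ _ il; have HG := Hl _ _ il.
  have [_ Lk0] := L_mono hk.
  have [_ hgood] := rule_good k Lk0 (log_gt0 hk).
  have := hgood tau w (Hk w) (ipk w) (G k w) tau_itv (elimN eqP w0) wL wpos (rkk w) HG.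
  rewrite -/(rule_rv perms k (L k) (log_points k) (rule (L k) (log_points k)) (G k w)).
  rewrite (rule_rv_variance b_prime perms_uniform rkk _ _ _ HG)// lee_fin -/(points k) => hv.
  have bR := rule_rv_bounded b_prime perms_uniform rkk k (L k) (log_points k)
    (rule (L k) (log_points k)) HG.
  under eq_fun do rewrite /Z /= exprMn.
  rewrite (meanZ P1); last exact: bounded_rvM.
  apply: le_trans (ler_wpM2l (sqr_ge0 (weight g w)) hv) _.
  have ip0 : 0 <= ipk w (G k w) (G k w) by exact: (rkhs_ip_ge0 (rkk w)).
  have p0 : 0 <= points k by exact: powR_ge0.
  (* The squared weight, from scaling the component, absorbs the inverse weight of the variance
     bound and leaves one weight, as in the domination inequality. *)
  rewrite [leLHS](_ : _ = points k * (weight g w * weight_sum g b tau w `^ tau *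
    ipk w (G k w) (G k w))); last by field; rewrite gt_eqF.
  rewrite ler_wpM2l// ler_wpM2r// ler_wpM2l ?(ltW wpos)//.
  apply: le_trans (weight_sum_le w) _; rewrite /omega.
  case: ifPn => [_|/fsubsetPn[j jw]].
    rewrite ler_wpM2l ?(ltW D_gt0)// (le_trans (g_decr (leq0n _)))//.
    by rewrite lerDl.
  rewrite mem_initseg -leqNgt => Lj.
  rewrite ler_wpM2l ?(ltW D_gt0)// (le_trans _ (g_le _))// g_decr// (leq_trans Lj)//.
  exact: (leq_bigmax_seq (F := id) j jw).
(* The deterministic part of the error. *)
pose beta := integral_mu g mu f - f halves - \sum_(k <- iota 1 m) G k fset0 halves.
have Qdec om : integral_mu g mu f - multilevel perms rule halves m L n f om =
    beta - \sum_(i <- l) Z i om.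
  (* In the first summand [Psi] at 0 is 0 and not the constant f(a); hence the extra [f halves] for
     k = 1. *)
  have rule_level k : (1 <= k <= m)%N ->
      rule_value (L k) (log_points k) (rule (L k) (log_points k)) (fun j s => perms k j s om)
        (Psi halves L k (f \- Psi halves L k.-1 f)) =
      (if k == 1%N then f halves else 0) + \sum_(w <- levellist g (L k)) Z (k, w) om.
    move=> hk; have [_ hx _ _] := hG k hk; have [Lk _] := L_mono hk.
    have E x : cube x -> Psi halves L k (f \- Psi halves L k.-1 f) x =
        (if k == 1%N then f halves else 0) + \sum_(w <- levellist g (L k)) weight g w * G k w x.
      move=> xc; rewrite -hx//; move: hk Lk; case: (k) => // -[_ _|k' _ /= Lk] /=.
        have -> : splice (initseg 0) x halves = halves.
          by apply/funext => j; rewrite /splice initseg0 in_fset0.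
        by rewrite subr0 [RHS]addrC subrK.
      rewrite add0r; congr (_ - f _); apply/funext => j; rewrite /splice !mem_initseg.
      by case: ifPn => // jL; rewrite (leq_trans jL Lk).
    rewrite /rule_value.
    rewrite (eq_bigr (fun h : 'I_(b ^ log_points k) => (if k == 1%N then f halves else 0) +
      \sum_(w <- levellist g (L k)) weight g w * G k w (full_point perms k (L k)
        (lattice_point R (log_points k) (rule (L k) (log_points k)).1
           (rule (L k) (log_points k)).2 h) om))); last first.
      by move=> h _; rewrite -E//; exact: (cube_full b_prime).
    rewrite big_split /= sumr_const card_ord mulrDr; congr (_ + _).
      by rewrite -[X in _ * X = _]mulr_natl mulKf// pnatr_eq0 -lt0n expn_gt0 prime_gt0.
    rewrite exchange_big mulr_sumr; apply: eq_bigr => w _ /=.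
    by rewrite /Z /= rule_rvE -mulr_sumr mulrCA.
  have bn0 k : (b ^ log_points k)%N%:R != 0 :> R by rewrite pnatr_eq0 -lt0n expn_gt0 prime_gt0.
  have Z_empty k : (1 <= k <= m)%N -> Z (k, fset0) om = G k fset0 halves.
    move=> hk; have [hG1 _ _ _] := hG k hk.
    have e0 : fset0 \in levellist g (L k).
      by rewrite mem_filter fpowersetE fsub0set /weight big_seq_fset0 ltr01.
    rewrite /Z /= {1}/weight big_seq_fset0 mul1r rule_rvE.
    rewrite (eq_bigr (fun=> G k fset0 halves)); last first.
      move=> h _; apply: (component_local (rkk fset0) (hG1 _ e0) (cube_full b_prime _ _ _ _ _)) => //.
      exact: cube_halves.
    by rewrite sumr_const card_ord -[X in _ * X = _]mulr_natl mulKf.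
  rewrite /multilevel /index_iota subn1 /= big_seq.
  rewrite (eq_bigr (fun k => (if k == 1%N then f halves else 0) +
     \sum_(w <- levellist g (L k)) Z (k, w) om)); last by move=> k /k_in /rule_level.
  rewrite -big_seq big_split /= -big_mkcond /=.
  have -> : \sum_(k <- iota 1 m | k == 1%N) f halves = f halves.
    rewrite -(prednK m_gt0) /= big_cons eqxx big_seq_cond big1 ?addr0// => k.
    by rewrite mem_iota => /andP[/andP[k2 _] /eqP k1]; rewrite k1 in k2.
  have -> : \sum_(k <- iota 1 m) \sum_(w <- levellist g (L k)) Z (k, w) om =
      \sum_(k <- iota 1 m) G k fset0 halves + \sum_(i <- l) Z i om.
    rewrite /l big_allpairs_dep /= -big_split /= big_seq [RHS]big_seq.
    apply: eq_bigr => k /k_in hk; rewrite -(Z_empty k hk) big_filter.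
    rewrite [LHS](bigD1_seq fset0)//; last by apply: filter_uniq; exact: fset_uniq.
    by rewrite mem_filter fpowersetE fsub0set /weight big_seq_fset0 ltr01.
  by rewrite /beta; ring.
have beta_le : beta ^+ 2 <= S * (L m).+1%:R `^ (- al).
  (* On the approximating combinations the differences of the [kappa] telescope: with [kappa g 0]
     from f(a) and 1 from the integral, only [kappa g (L m) - 1] remains. *)
  have lim : (fun N => \sum_(p <- s N) p.1 * (kappa g (L m) p.2 - 1)) @ \oo --> - beta.
    have c1 : (fun N => \sum_(p <- s N) p.1 * kappa g 0 p.2) @ \oo --> f halves.
      have := @approximates_eval _ g _ _ rk f s Hf sf (exist _ halves (@cube_halves R)).
      by rewrite /kappa tailw0.
    have c2 : (fun N => \sum_(k <- iota 1 m | k \in iota 1 m)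
        \sum_(p <- s N) p.1 * (kappa g (L k) p.2 - kappa g (previous_level k.-1) p.2)) @ \oo -->
        \sum_(k <- iota 1 m | k \in iota 1 m) G k fset0 halves.
      apply: cvgn_sum => k /k_in hk; have [_ _ _ h4] := hG k hk.
      by apply: h4; exact: cube_halves.
    have c3 := integral_mu_approximates g_ge0 g_summable mu_product rk Hf sf.
    rewrite (_ : - beta = f halves + \sum_(k <- iota 1 m | k \in iota 1 m) G k fset0 halves -
      integral_mu g mu f); last by rewrite /beta -big_seq; ring.
    have c4 : (fun N => \sum_(p <- s N) p.1 * kappa g 0 p.2 +
        \sum_(k <- iota 1 m | k \in iota 1 m)
          \sum_(p <- s N) p.1 * (kappa g (L k) p.2 - kappa g (previous_level k.-1) p.2) -
        \sum_(p <- s N) p.1) @ \oo -->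
        f halves + \sum_(k <- iota 1 m | k \in iota 1 m) G k fset0 halves - integral_mu g mu f.
      exact: cvgB (cvgD c1 c2) c3.
    apply: (cvgn_ext _ c4) => N.
    rewrite -big_seq exchange_big -big_split -sumrB /=; apply: eq_bigr => p _.
    rewrite -mulr_sumr -mulrDr -[X in _ - X]mulr1 -mulrBr; congr (_ * (_ - _)).
    have -> : iota 1 m = index_iota 1 m.+1 by rewrite /index_iota subn1.
    rewrite big_add1 /=.
    rewrite (telescope_sumr (fun k => kappa g (previous_level k) p.2))//.
    by rewrite addrC subrK; case: (m) m_gt0.
  rewrite -sqrrN; apply: le_trans (bias_bound g_ge0 g_summable rk Hf sf lim) _.
  apply: le_trans (kconst_le (L m)); rewrite ler_piMr// subr_ge0.
  exact: kconst_ge1.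
rewrite unlock.
have bQ : bounded_rv (fun om => (beta - \sum_(i <- l) Z i om) ^+ 2).
  have h : bounded_rv (fun om => beta - \sum_(i <- l) Z i om).
    under eq_fun do rewrite -mulN1r.
    apply: bounded_rvD; first exact: bounded_rv_cst.
    by apply: bounded_rvZ; exact: bounded_rv_sum_in.
  exact: bounded_rvM.
under eq_integral do rewrite Qdec.
rewrite (mean_EFin P1 bQ) lee_fin (second_moment P1)//.
rewrite lerD//.
rewrite /l big_allpairs_dep /= /index_iota subn1 /=.
rewrite big_seq [leRHS]big_seq; apply: ler_sum => k /k_in hk.
have [_ _ hB _] := hG k hk.
have ip0 w : w \in levellist g (L k) -> 0 <= weight g w * omega k w * ipk w (G k w) (G k w).
  move=> wl; have [hG1 _ _ _] := hG k hk; have [_ wpos] := in_level _ _ wl.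
  apply: mulr_ge0; last by apply: (rkhs_ip_ge0 (rkk w)); exact: hG1.
  by apply: mulr_ge0; [exact: ltW|rewrite /omega; case: ifP => _; exact: ltW].
apply: (@le_trans _ _ (points k * \sum_(w <- levellist g (L k))
    weight g w * omega k w * ipk w (G k w) (G k w))).
  rewrite big_filter big_mkcond mulr_sumr big_seq [leRHS]big_seq; apply: ler_sum => w wl.
  case: ifPn => w0; last by rewrite mulr_ge0 ?powR_ge0// ip0.
  apply: Zvar; apply/allpairsPdep; exists k, w; split => //.
    by rewrite mem_iota add1n ltnS.
  by rewrite mem_filter w0.
rewrite [leRHS]mulrC ler_wpM2l ?powR_ge0//; apply: le_trans hB _.
have kc := kconst_ge1 g_ge0 g_summable.
have [Lk _] := L_mono hk.
apply: (@le_trans _ _ (o1 * (kconst g (previous_level k.-1) - kconst g (L k)) +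
    o2 k * kconst g (L k))).
  rewrite ler_piMr// addr_ge0// mulr_ge0 ?(ltW o1_gt0) ?(ltW (o2_gt0 _))//.
    by rewrite subr_ge0; exact: kconst_anti.
  exact: le_trans (kc _).
have -> : level_const * (previous_level k.-1).+1%:R `^ (- al) =
    o1 * (S * rate k) + o2 k * kconst g 0 by rewrite /level_const /o1 /o2 /rate; ring.
apply: lerD.
  rewrite ler_wpM2l ?(ltW o1_gt0)// (le_trans _ (kconst_le _))// lerD2l lerN2.
  exact: kc.
by rewrite ler_wpM2l ?(ltW (o2_gt0 _))//; exact: kconst_anti.
Qed.

End AlgorithmError.

(** * Cost and choice of the parameters *)

Section Cost.
Context {R : realType} (g : nat -> R).
Hypothesis g_ge0 : forall j, 0 <= g j.
Hypothesis g_summable : (\esum_(u in [set: {fset nat}]) (weight g u)%:E < +oo)%E.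
Context (b : nat) {d : measure_display} {Omega : measurableType d} (P : probability Omega R).
Context (perms : nat -> nat -> seq 'F_b -> Omega -> {perm 'F_b}).
Context (rule : nat -> nat -> {poly 'F_b} * (nat -> {poly 'F_b})).
Context (dollar : nat -> R).
Hypothesis dollar_ge0 : forall i, 0 <= dollar i.
Hypothesis dollar_incr : {homo dollar : i j / (i <= j)%N >-> i <= j}.

Import HBNNSimple.

(** The bound holds for every simple function below [h], hence for their supremum; it thus covers
    costs whose measurability is not established. *)
Lemma integral_le_cst (h : Omega -> \bar R) (c : R) : (forall w, (0 <= h w <= c%:E)%E) ->
  (\int[P]_w h w <= c%:E)%E.
Proof.
move=> hc; rewrite ge0_integralTE; last by move=> w; case/andP: (hc w).
apply: ge_ereal_sup => _ [k kh <-].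
rewrite -integralT_nnsfun.
rewrite -[leRHS]mule1 -(probability_setT P) -integral_cst//.
apply: ge0_le_integral => //.
- by move=> w _; rewrite lee_fin.
- exact/measurable_EFinP.
- by move=> w _; apply: le_trans (kh w) _; case/andP: (hc w).
Qed.

(** The sets must be nonempty, so the segment of length L has index L - 1. *)
Let v (i : nat) : {fset nat} := initseg i.+1.

Let v_increasing : strictly_increasing_sets v.
Proof.
split=> i; first by apply/eqP; rewrite -cardfs_eq0 card_initseg.
by rewrite fproperEneq initseg_sub leqnSn andbT; apply/eqP => /(congr1 (fun A : {fset nat} => #|` A|%fset));
  rewrite !card_initseg => /n_Sn.
Qed.

Let point_cost_le L x : (0 < L)%N ->
  (point_cost dollar v halves (splice (initseg L) x halves) <= (dollar L)%:E)%E.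
Proof.
move=> L0; apply: ereal_inf_lbound; exists L.-1 => /=; last by rewrite card_initseg prednK.
by move=> j; rewrite /v prednK// /splice => /negbTE ->.
Qed.

Let point_cost_ge0 x : (0 <= point_cost dollar v halves x)%E.
Proof. by apply: le_ereal_inf_tmp => _ [i _ <-]; rewrite lee_fin. Qed.

Context (m : nat) (L n : nat -> nat).
Hypothesis L1_gt0 : (0 < L 1)%N.
Hypothesis L_mono : forall k, (1 <= k < m)%N -> (L k < L k.+1)%N.

(** The choice of nested segments and of the algorithm's own anchor bounds the infimum. A node of
    level k causes at most two evaluations, in dimensions L_k and L_(k-1), each of cost at most
    [dollar (L k)]. *)
Lemma cost_bound :
  (var_cost g P dollar (multilevel_points perms rule halves m L n) <=
   (\sum_(1 <= k < m.+1) (b ^ trunc_log b (n k))%N%:R * (2 * dollar (L k)))%:E)%E.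
Proof.
apply: le_trans.
  apply: ereal_inf_lbound; exists v, halves; split; [exact: v_increasing| |reflexivity].
  by rewrite domK_cube//; exact: cube_halves.
apply: ge_ereal_sup => _ [f _ <-]; apply: integral_le_cst => w.
rewrite sume_ge0 => [|x _]; last exact: point_cost_ge0.
rewrite /multilevel_points big_flatten /= big_map /index_iota subn1 /=.
rewrite -sumEFin big_seq [leRHS]big_seq; apply: lee_sum => k.
rewrite mem_iota add1n ltnS => hk.
have L0 i : (1 <= i <= m)%N -> (0 < L i)%N.
  move=> /andP[]; elim: i => // -[//|i IH] _ im.
  by apply: leq_trans (@L_mono i.+1 im).
rewrite big_flatten /= big_map.
have -> : (b ^ trunc_log b (n k))%N%:R * (2 * dollar (L k)) =
    \sum_(h <- iota 0 (b ^ trunc_log b (n k))) 2 * dollar (L k).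
  by rewrite big_const_seq count_predT size_iota iter_addr_0 mulr_natl.
rewrite -sumEFin; apply: lee_sum => h _; rewrite big_cons mulrDl mul1r EFinD.
apply: leeD; first by apply: point_cost_le; exact: L0.
case: ifPn => k1; last by rewrite big_nil lee_fin.
rewrite big_seq1; apply: (@le_trans _ _ (dollar (L k.-1))%:E).
  apply: point_cost_le; apply: L0; case/andP: hk => _ km.
  by case: k k1 km => // k' k1 km /=; rewrite -ltnS k1/= ltnW.
rewrite lee_fin dollar_incr// ltnW//.
case: k hk k1 {h} => // -[//|k] /= km _; exact: L_mono.
Qed.

End Cost.

(* the weights of the two rates add up to [1 - 1 / c] *)
Lemma weighted_rate_le {R : realType} (a c rho tau r : R) : 0 <= a -> a + 1 <= c -> 1 < c ->
  r <= rho * (1 - c^-1) -> r <= tau * (1 - c^-1) ->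
  r <= a / c * rho + (c - (a + 1)) / c * tau.
Proof.
move=> a0 ac c1 r1 r2; have c0 : 0 < c by lra.
have c10 : 0 < c - 1 by lra.
have E t : c * (t * (1 - c^-1)) = (c - 1) * t by field; rewrite gt_eqF.
rewrite -(ler_pM2l c0) E in r1; rewrite -(ler_pM2l c0) E in r2; rewrite -(ler_pM2l c0).
have -> : c * (a / c * rho + (c - (a + 1)) / c * tau) = a * rho + (c - 1 - a) * tau.
  by field; rewrite gt_eqF.
rewrite -(ler_pM2l c10).
have h1 : a * (c * r) <= a * ((c - 1) * rho) by rewrite ler_wpM2l.
have h2 : (c - 1 - a) * (c * r) <= (c - 1 - a) * ((c - 1) * tau).
  by rewrite ler_wpM2l//; lra.
by move: (lerD h1 h2); rewrite -mulrDl; lra.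
Qed.

Section LevelParameters.
Context {R : realType} (b : nat).
Hypothesis b_gt1 : (1 < b)%N.
Context (s : R).
Hypothesis s_gt0 : 0 < s.
Context (m : nat).
Hypothesis m_gt0 : (0 < m)%N.
Context (X : R).
Hypothesis X_ge1 : 1 <= X.
Hypothesis X_ge2 : 2 `^ (s * m%:R) <= X.

(** The cost of one point at level k is then of order X^(k/m), which balances X^(1 - k/m) points. *)
Definition levels (k : nat) : nat := Num.truncn (X `^ (k%:R / (s * m%:R))).

(** The factor b compensates the rounding down to a power of b, strictly enough to absorb also the 1
    subtracted in the variance bound; the successor makes up for the truncation. *)
Definition points (k : nat) : nat := (b * (Num.truncn (X `^ (1 - k%:R / m%:R))).+1)%N.

Let mR : 0 < m%:R :> R. Proof. by rewrite ltr0n. Qed.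

Let X_gt0 : 0 < X. Proof. exact: lt_le_trans ltr01 X_ge1. Qed.

Let powX_ge1 (e : R) : 0 <= e -> 1 <= X `^ e.
Proof. by move=> e0; rewrite -(powRr0 X) ler_powR. Qed.

Let level_ge1 k : 1 <= X `^ (k%:R / (s * m%:R)).
Proof. by apply: powX_ge1; rewrite divr_ge0// mulr_ge0// ltW. Qed.

Lemma levels_gt0 k : (0 < levels k)%N.
Proof. by rewrite truncn_gt0. Qed.

(** As X >= 2^(s m), consecutive values before truncation have ratio at least 2, and doubling a
    number z >= 1 raises its integer part. *)
Lemma levels_incr k : (levels k < levels k.+1)%N.
Proof.
rewrite /levels truncn_gt_nat.
have -> : X `^ (k.+1%:R / (s * m%:R)) = X `^ (s * m%:R)^-1 * X `^ (k%:R / (s * m%:R)).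
  rewrite -powRD; last by rewrite (gt_eqF X_gt0) implybT.
  by congr (_ `^ _); rewrite -natr1 mulrDl mul1r addrC.
have h2 : 2 <= X `^ (s * m%:R)^-1.
  have sm : 0 < s * m%:R by rewrite mulr_gt0.
  have -> : 2 = (2 `^ (s * m%:R)) `^ (s * m%:R)^-1 :> R.
    by rewrite -powRrM mulfV ?gt_eqF// powRr1.
  by rewrite ge0_ler_powR// ?nnegrE ?powR_ge0 ?invr_ge0 ?(ltW sm) ?(ltW X_gt0).
have h1 := level_ge1 k; have := truncn_itv (le_trans ler01 h1).
move/andP => [+ _]; rewrite -natr1.
move: (X `^ (k%:R / _)) h1 => z h1 h; apply: (@le_trans _ _ (2 * z)); first by lra.
by rewrite ler_wpM2r//; lra.
Qed.

Lemma levels_le k : (levels k)%:R `^ s <= X `^ (k%:R / m%:R).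
Proof.
have -> : k%:R / m%:R = k%:R / (s * m%:R) * s :> R by field; rewrite !gt_eqF.
rewrite powRrM ge0_ler_powR ?nnegrE ?powR_ge0 ?(ltW s_gt0)//.
by rewrite truncn_le powR_ge0.
Qed.

Lemma levels_ge k : X `^ (k%:R / (s * m%:R)) <= (levels k).+1%:R.
Proof. by apply: ltW; exact: truncnS_gt. Qed.

Lemma points_decr k : (points k.+1 <= points k)%N.
Proof.
rewrite leq_pmul2l ?(ltnW b_gt1)// ltnS le_truncn// ler_powR// lerD2l lerN2.
by rewrite ler_pM2r ?invr_gt0// ler_nat.
Qed.

Lemma points_ge k : (b <= points k)%N.
Proof. by rewrite leq_pmulr. Qed.

Lemma points_used_ge k : X `^ (1 - k%:R / m%:R) <= (b ^ trunc_log b (points k))%N%:R - 1.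
Proof.
apply: le_trans (ltW (truncnS_gt _)) _; rewrite lerBrDr natr1 ler_nat.
by have := trunc_log_ltn (points k) b_gt1; rewrite expnS ltn_pmul2l ?(ltnW b_gt1).
Qed.

Lemma points_used_le k : (k <= m)%N ->
  (b ^ trunc_log b (points k))%N%:R <= 2 * b%:R * X `^ (1 - k%:R / m%:R).
Proof.
move=> km; have := trunc_logP b_gt1 (leq_trans (ltnW b_gt1) (points_ge k)).
rewrite -(ler_nat R) => /le_trans; apply; rewrite natrM -mulrA mulrCA ler_wpM2l//.
have h1 : 1 <= X `^ (1 - k%:R / m%:R).
  by apply: powX_ge1; rewrite subr_ge0 ler_pdivrMr// mul1r ler_nat.
have := truncn_itv (le_trans ler01 h1); move/andP => [+ _]; rewrite -natr1.
by move: (X `^ _) h1 => z h1; lra.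
Qed.

Lemma cost_le (dollar : nat -> R) (D : R) : 0 <= D ->
  (forall i, (0 < i)%N -> dollar i <= D * i%:R `^ s) ->
  \sum_(1 <= k < m.+1) (b ^ trunc_log b (points k))%N%:R * (2 * dollar (levels k)) <=
  4 * b%:R * D * m%:R * X.
Proof.
move=> D0 hD.
apply: (@le_trans _ _ (\sum_(1 <= k < m.+1) (4 * b%:R * D * X))); last first.
  by rewrite sumr_const_nat subn1 /= -mulr_natr; lra.
rewrite big_nat [leRHS]big_nat; apply: ler_sum => k /andP[_ km].
have dk : dollar (levels k) <= D * X `^ (k%:R / m%:R).
  by apply: le_trans (hD _ (levels_gt0 k)) _; rewrite ler_wpM2l// levels_le.
have -> : 4 * b%:R * D * X = 2 * b%:R * X `^ (1 - k%:R / m%:R) * (2 * (D * X `^ (k%:R / m%:R))).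
  have {1}-> : X = X `^ (1 - k%:R / m%:R) * X `^ (k%:R / m%:R).
    by rewrite -powRD ?subrK ?powRr1 ?(ltW X_gt0)// (gt_eqF X_gt0) implybT.
  by ring.
apply: (@le_trans _ _ ((b ^ trunc_log b (points k))%N%:R * (2 * (D * X `^ (k%:R / m%:R))))).
  by rewrite ler_wpM2l// ler_wpM2l.
by rewrite ler_wpM2r ?points_used_le// mulr_ge0// mulr_ge0// powR_ge0.
Qed.

(** The final bias has the full rate al / s. Summand k combines the rate al / s of the previous
    level, with weight (k - 1) / m, and the rate tau of its rule, with weight 1 - k / m. *)
Lemma error_le (S E al tau r : R) : 0 <= S -> 0 <= E -> 0 <= al -> 0 <= tau ->
  r <= al / s -> r <= al / s * (1 - m%:R^-1) -> r <= tau * (1 - m%:R^-1) ->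
  S * (levels m).+1%:R `^ (- al) +
  \sum_(1 <= k < m.+1) E * (previous_level levels k.-1).+1%:R `^ (- al) *
    ((b ^ trunc_log b (points k))%N%:R - 1) `^ (- tau) <=
  (S + E * m%:R) * X `^ (- r).
Proof.
move=> S0 E0 al0 tau0 r1 r2 r3.
have powN (x e t : R) : 0 <= t -> X `^ e <= x -> x `^ (- t) <= X `^ (- (e * t)).
  move=> t0 hx; rewrite !powRN lef_pV2 ?posrE ?powR_gt0//; last first.
    by apply: lt_le_trans hx; exact: powR_gt0.
  have x0 : 0 <= x by apply: le_trans hx; exact: powR_ge0.
  by rewrite powRrM ge0_ler_powR// nnegrE powR_ge0.
rewrite mulrDl; apply: lerD.
  rewrite ler_wpM2l//; apply: le_trans (powN _ _ _ al0 (levels_ge m)) _.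
  rewrite ler_powR// lerN2; apply: le_trans r1 _.
  by rewrite le_eqVlt; apply/orP; left; apply/eqP; field; rewrite !gt_eqF.
apply: (@le_trans _ _ (\sum_(1 <= k < m.+1) E * X `^ (- r))); last first.
  by rewrite sumr_const_nat subn1 /= -[leLHS]mulr_natr; lra.
rewrite big_nat [leRHS]big_nat; apply: ler_sum => k /andP[k1 km].
rewrite -mulrA ler_wpM2l//.
have hk : (previous_level levels k.-1).+1%:R `^ (- al) <=
    X `^ (- ((k.-1)%:R / (s * m%:R) * al)).
  apply: powN => //; case: k k1 {km} => // -[|k] _ /=; last exact: levels_ge.
  by rewrite mul0r powRr0.
have hp := powN _ _ _ tau0 (points_used_ge k).
apply: le_trans (ler_pM (powR_ge0 _ _) (powR_ge0 _ _) hk hp) _.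
rewrite -powRD; last by rewrite (gt_eqF X_gt0) implybT.
rewrite ler_powR// -opprD lerN2.
have -> : (k.-1)%:R / (s * m%:R) * al + (1 - k%:R / m%:R) * tau =
   (k.-1)%:R / m%:R * (al / s) + (m%:R - k%:R) / m%:R * tau.
  by field; rewrite !gt_eqF.
(* For m = 1 both weights are 0, and the hypotheses force r <= 0. *)
have [mE|m1] := eqVneq m 1%N.
  have -> : k = 1%N by apply/eqP; rewrite eqn_leq k1 -ltnS -mE km.
  by move: r3; rewrite mE /= mulr1n invr1 subrr !mulr0 !mul0r addr0.
have kE : k%:R = k.-1%:R + 1 :> R by rewrite natr1 prednK.
rewrite kE; apply: weighted_rate_le => //; rewrite -?kE ?ler_nat// ltr1n.
by rewrite ltn_neqAle eq_sym m1.
Qed.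

End LevelParameters.

Section WorstError.
Context {R : realType}.

(** The supremum of the empty set is -oo, with power 0; hence the separate case. *)
Lemma poweR_half_sqr_le (A : set (\bar R)) (B : R) : 0 <= B ->
  (forall x, A x -> (0 <= x <= B%:E)%E) ->
  (poweR (ereal_sup A) 2^-1 ^+ 2 <= B%:E)%E.
Proof.
move=> B0 hA.
have supB : (ereal_sup A <= B%:E)%E by apply: ge_ereal_sup => x /hA /andP[].
have [A0|/set0P[x Ax]] := eqVneq A set0.
  by rewrite A0 ereal_sup0 poweRNyr ?invr_neq0// expe2 mul0e lee_fin.
have sup0 : (0 <= ereal_sup A)%E.
  by apply: le_trans (ereal_sup_ubound Ax); case/andP: (hA _ Ax).
move: supB sup0; case: (ereal_sup A) => // v; rewrite !lee_fin => vB v0.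
by rewrite -expr2 powR12_sqrt// sqr_sqrtr.
Qed.

(** The asymptotic bound holds from some i0 on; before it, monotonicity and i^s >= 1 give the
    constant [dollar i0]. *)
Lemma bigO_powR_le (dollar : nat -> R) (s : R) : 0 < s -> (forall i, 0 <= dollar i) ->
  {homo dollar : i j / (i <= j)%N >-> i <= j} ->
  (dollar : nat -> R^o) =O_\oo (fun i => i%:R `^ s : R^o) ->
  exists2 D : R, 0 < D & forall i, (0 < i)%N -> dollar i <= D * i%:R `^ s.
Proof.
move=> s0 d0 dincr /eqO_exP[k k0 [i0 _ hk]].
exists (k + dollar i0) => [|i i1]; first by rewrite ltr_wpDr.
have i1s : 1 <= i%:R `^ s :> R.
  by rewrite -[leLHS](powRr0 i%:R) ler_powR ?ler1n// ltW.
have [ii0|ii0] := leqP i0 i.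
  have := hk i ii0; rewrite /= !ger0_norm ?powR_ge0// => /le_trans; apply.
  by rewrite ler_wpM2r ?powR_ge0// lerDl.
apply: le_trans (dincr _ _ (ltnW ii0)) _; apply: (@le_trans _ _ (dollar i0 * i%:R `^ s)).
  by rewrite ler_peMr.
by rewrite ler_wpM2r ?powR_ge0// lerDr ltW.
Qed.

End WorstError.

Section Rate.
Context {R : realType} (g : nat -> R).
Hypothesis g_ge0 : forall j, 0 <= g j.
Hypothesis g_decr : forall i j, (i <= j)%N -> g j <= g i.
Hypothesis g_summable : (\esum_(u in [set: {fset nat}]) (weight g u)%:E < +oo)%E.
Context (u : nat -> {fset nat}).
Hypothesis u_enum : decreasing_enum g u.
Context (mu : {measure set (g_sigma_algebraType (@cylinders R)) -> \bar R}).
Hypothesis mu_product : is_product_lebesgue mu.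
Context (b : nat).
Hypothesis b_prime : prime b.
Context {d : measure_display} {Omega : measurableType d} (P : probability Omega R).
Context (perms : nat -> nat -> seq 'F_b -> Omega -> {perm 'F_b}).
Hypothesis perms_uniform : uniform_scrambling P perms.
Context (rule : nat -> nat -> {poly 'F_b} * (nat -> {poly 'F_b})).
Hypothesis rule_good : forall L M k, (0 < L)%N -> (0 < M)%N ->
  good_rule g P L M (perms k) (rule L M).
Context (dollar : nat -> R).
Hypothesis dollar_ge0 : forall i, 0 <= dollar i.
Hypothesis dollar_incr : {homo dollar : i j / (i <= j)%N >-> i <= j}.
Context (s : R).
Hypothesis s_gt0 : 0 < s.
Context (D : R).
Hypothesis D_gt0 : 0 < D.
Hypothesis dollar_le : forall i, (0 < i)%N -> dollar i <= D * i%:R `^ s.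

Definition valid_parameters (m : nat) (L n : nat -> nat) : Prop :=
  [/\ (0 < m)%N, (0 < L 1)%N,
      forall k, (1 <= k < m)%N -> (L k < L k.+1)%N /\ (n k.+1 <= n k)%N &
      (b <= n m)%N].

(** The constant of [cost_le]: the budget divided by it is the parameter X. *)
Definition cost_scale (m : nat) : R := 4 * b%:R * D * m%:R.

(** From this budget on, X is at least 1 and at least 2^(s m). *)
Definition threshold (m : nat) : R := cost_scale m * Num.max 1 (2 `^ (s * m%:R)).

Let b_gt1 : (1 < b)%N := prime_gt1 b_prime.

Lemma cost_scale_gt0 m : (0 < m)%N -> 0 < cost_scale m.
Proof.
by move=> m0; rewrite !mulr_gt0// ltr0n// ltnW.
Qed.

Lemma scaled_budget m N : (0 < m)%N -> threshold m <= N ->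
  1 <= N / cost_scale m /\ 2 `^ (s * m%:R) <= N / cost_scale m.
Proof.
move=> m0; rewrite /threshold mulrC -ler_pdivlMr ?cost_scale_gt0// ge_max.
by move/andP.
Qed.

Lemma parameters_valid m N : (0 < m)%N -> threshold m <= N ->
  let L := levels s m (N / cost_scale m) in
  let n := points b m (N / cost_scale m) in
  valid_parameters m L n /\
  (var_cost g P dollar (multilevel_points perms rule halves m L n) <= N%:E)%E.
Proof.
move=> m0 hN; have [X1 X2] := scaled_budget m0 hN => L n.
have Lincr k : (L k < L k.+1)%N by exact: levels_incr.
split.
  split => //; [exact: levels_gt0|by move=> k _; split => //; exact: points_decr|].
  exact: points_ge.
apply: le_trans (cost_bound g_ge0 g_summable P perms rule dollar_ge0 dollar_incr n _ _) _ => //.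
  exact: levels_gt0.
rewrite lee_fin; apply: le_trans (cost_le b_gt1 s_gt0 m0 X1 (ltW D_gt0) dollar_le) _.
by rewrite -/(cost_scale m) mulrC divfK// gt_eqF// cost_scale_gt0.
Qed.

(** The strict inequalities leave room for an exponent q below the decay, for tau < min(3, q) in the
    rules and for al < q - 1 in the tails. With growing m the rate approaches t = min(al / s, tau) >
    r. *)
Lemma worst_error_rate (r : R) : r < 3 -> (r%:E < decay g u)%E ->
  ((1 + r * s)%:E < decay g u)%E -> (1 < decay g u)%E ->
  exists C : R, exists2 m, (0 < m)%N & forall N, threshold m <= N ->
    (worst_error g mu P (multilevel perms rule halves m
       (levels s m (N / cost_scale m)) (points b m (N / cost_scale m))) ^+ 2 <=
     (C * N `^ (- r))%:E)%E.
Proof.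
move=> r3 rdec rsdec dec1.
have [q [q1 qr qrs qdec]] : exists q : R, [/\ 1 < q, r < q, 1 + r * s < q & (q%:E < decay g u)%E].
  pose a : R := Num.max 1 (Num.max r (1 + r * s)).
  have adec : (a%:E < decay g u)%E by rewrite /a !EFin_max !gt_max dec1 rdec.
  have [_ [q' hq' <-]] := ereal_sup_gt adec; rewrite lte_fin => aq'.
  (* [q'] itself may equal the supremum, whereas the midpoint stays below it. *)
  pose q := (a + q') / 2.
  have : a < q by rewrite /q; lra.
  rewrite /a !gt_max => /and3P[q1 qr qrs]; exists q; split => //.
  apply: (@lt_le_trans _ _ q'%:E); first by rewrite lte_fin /q; lra.
  by apply: ereal_sup_ubound; exists q'.
have [C0 C0_gt0 g_le] := decay_bound g_ge0 g_decr u_enum (ltW (lt_trans ltr01 q1)) qdec.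
have [tau [tau1 taur tau3 tauq]] : exists tau : R, [/\ 1 < tau, r < tau, tau < 3 & tau < q].
  have : Num.max 1 r < Num.min 3 q by rewrite gt_max !lt_min q1 r3 qr !andbT ltr1n.
  move=> /midf_lt[]; rewrite gt_max lt_min => /andP[? ?] /andP[? ?].
  by eexists; split; eassumption.
have [al [al0 alr alq]] : exists al : R, [/\ 0 < al, r * s < al & al < q - 1].
  have : Num.max 0 (r * s) < q - 1 by rewrite gt_max; apply/andP; split; lra.
  move=> /midf_lt[]; rewrite gt_max => /andP[? ?] ?.
  by eexists; split; eassumption.
have [S S_gt0 kconst_le] := kconst_bound g_ge0 C0_gt0 g_le g_summable (ltW al0) alq.
have [Dw Dw_gt0 weight_sum_le] :=
  weight_sum_bound g_ge0 C0_gt0 g_le (ltnW b_gt1) (ltW tau1) tauq.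
have g_le_al L : g L <= C0 * L.+1%:R `^ (- al).
  apply: le_trans (g_le L) _; rewrite ler_wpM2l ?(ltW C0_gt0)// ler_powR ?ler1n//.
  by rewrite lerN2; lra.
pose t := Num.min (al / s) tau.
have t0 : 0 < t by rewrite lt_min divr_gt0//=; lra.
have tr : r < t by rewrite lt_min ltr_pdivlMr// alr.
(* m > t / (t - r) means t (1 - 1/m) > r; this choice does not depend on N. *)
pose m := (Num.truncn (t / (t - r))).+1.
have mR : 0 < m%:R :> R by rewrite ltr0n.
have rm : r <= t * (1 - m%:R^-1).
  have : t / (t - r) < m%:R by exact: truncnS_gt.
  rewrite ltr_pdivrMr ?subr_gt0// -ltr_pdivrMl// mulrBr mulr1 [_^-1 * t]mulrC.
  by move: (t / m%:R) => z; lra.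
have m1 : 0 <= 1 - m%:R^-1 :> R by rewrite subr_ge0 invf_le1// ler1n.
pose E := level_const g Dw S C0.
have E_ge0 : 0 <= E.
  have k0 := le_trans ler01 (kconst_ge1 g_ge0 g_summable 0).
  have g1 : 0 <= g 0 + 1 by rewrite addr_ge0.
  apply: addr_ge0.
    by apply: mulr_ge0 (ltW S_gt0); apply: mulr_ge0 g1; exact: ltW.
  by apply: mulr_ge0 k0; apply: mulr_ge0; exact: ltW.
have c0 := cost_scale_gt0 (isT : (0 < m)%N).
(* The power of [cost_scale m] turns X^(-r) into N^(-r). *)
exists ((S + E * m%:R) * cost_scale m `^ r), m => // N hN.
have [X1 X2] := scaled_budget (isT : (0 < m)%N) hN.
have [[_ L1 Ln nm] _] := parameters_valid (isT : (0 < m)%N) hN.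
have XN : (N / cost_scale m) `^ (- r) = cost_scale m `^ r * N `^ (- r).
  have N0 : 0 <= N.
    by apply: le_trans hN; rewrite mulr_ge0 ?(ltW c0)// le_max ler01.
  rewrite powRM ?invr_ge0 ?(ltW c0)// mulrC; congr (_ * _).
  by rewrite -powR_inv1 ?(ltW c0)// -powRrM mulN1r opprK.
rewrite /worst_error; apply: poweR_half_sqr_le.
  by rewrite mulr_ge0 ?powR_ge0// mulr_ge0 ?powR_ge0// addr_ge0 ?(ltW S_gt0)// mulr_ge0// ltW.
move=> _ [f [H [ip [rk Hf f1]]] <-]; rewrite expectation_ge0 /=; last by move=> w; exact: sqr_ge0.
rewrite (domK_cube g_ge0 g_summable) in rk.
apply: le_trans (algorithm_error g_ge0 g_decr g_summable mu_product b_prime perms_uniform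
  rule_good (tau := tau) _ Dw_gt0 C0_gt0 weight_sum_le kconst_le g_le_al _ L1 Ln nm rk Hf f1) _.
- by rewrite (ltW tau1).
- by [].
rewrite lee_fin -mulrA -XN; apply: error_le => //; try exact: ltW.
- by lra.
- by rewrite ler_pdivlMr// ltW.
- by apply: le_trans rm _; rewrite ler_wpM2r// ge_min lexx.
- by apply: le_trans rm _; rewrite ler_wpM2r// ge_min lexx orbT.
Qed.

End Rate.

(** The error claims with decay, constant, budget and squared error as variables, which makes the
    case distinction pure arithmetic. *)
Definition rate_clauses {R : realType} (s delta : R) (dec : \bar R) (C N : R)
    (err2 : \bar R) : Prop :=
  (2 / 3 <= s ->
     (((1 + 3 * s)%:E <= dec)%E -> (err2 <= (C * N `^ (- 3 + delta))%:E)%E) /\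
     ((1 < dec)%E -> (dec < (1 + 3 * s)%:E)%E ->
        (err2 <= (C * N `^ (- ((fine dec - 1) / s) + delta))%:E)%E)) /\
  (s < 2 / 3 ->
     ((3%:E <= dec)%E -> (err2 <= (C * N `^ (- 3 + delta))%:E)%E) /\
     (((1 - s)^-1%:E < dec)%E -> (dec < 3%:E)%E ->
        (err2 <= (C * N `^ (- fine dec + delta))%:E)%E) /\
     ((1 < dec)%E -> (dec <= (1 - s)^-1%:E)%E ->
        (err2 <= (C * N `^ (- ((fine dec - 1) / s) + delta))%:E)%E)).

(** In every range the claimed exponent is min(3, dec, (dec - 1) / s) - delta; the ranges above 1
    meet where two of the three terms coincide. If dec <= 1, all premises fail. *)
Lemma rate_cases {R : realType} (s delta : R) (dec : \bar R) : 0 < s -> 0 < delta ->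
  (dec <= 1)%E /\ (forall C N err2, rate_clauses s delta dec C N err2) \/
  exists2 r : R, [/\ r < 3, (r%:E < dec)%E, ((1 + r * s)%:E < dec)%E & (1 < dec)%E] &
    forall C N err2, (err2 <= (C * N `^ (- r))%:E)%E -> rate_clauses s delta dec C N err2.
Proof.
move=> s0 d0; have ds : 0 < delta * s by rewrite mulr_gt0.
have inv_s : s < 2 / 3 -> 1 < (1 - s)^-1 /\ (1 - s)^-1 < 3.
  move=> s23; have s1 : 0 < 1 - s by lra.
  by split; [rewrite invf_gt1//|rewrite -ltf_pV2 ?posrE ?invr_gt0// invrK]; lra.
have [dec1|dec1] := leP dec 1%E.
  left; split => // C N err2; split => hs.
    split=> [h|/lt_le_trans/(_ dec1)]; last by rewrite ltxx.
    by move: (le_trans h dec1); rewrite lee_fin => ?; exfalso; lra.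
  have [i1 i3] := inv_s hs; split; [|split].
  - by move=> h; move: (le_trans h dec1); rewrite lee_fin => ?; exfalso; lra.
  - by move/lt_le_trans/(_ dec1); rewrite lte_fin => ?; exfalso; lra.
  - by move/lt_le_trans/(_ dec1); rewrite ltxx.
right; have [hs|hs] := leP (2 / 3) s.
  have [hd|hd] := leP (1 + 3 * s)%:E dec.
    exists (3 - delta).
      split => //; first lra.
        by apply: lt_le_trans hd; rewrite lte_fin; lra.
      by apply: lt_le_trans hd; rewrite lte_fin mulrBl; lra.
    move=> C N err2; rewrite opprB addrC => h; split=> // h'; last by exfalso; lra.
    by split=> // _ /lt_le_trans/(_ hd); rewrite ltxx.
  case: dec dec1 hd => // v; rewrite !lte_fin => v1 hd.
  have vs : (v - 1) / s < 3 by rewrite ltr_pdivrMr//; lra.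
  (* Amounts to v (1 - s) <= 1; for s < 1 it follows from v < 1 + 3 s, since (1 + 3 s) (1 - s) <= 1
     when s >= 2/3. *)
  have vv : (v - 1) / s <= v.
    rewrite ler_pdivrMr//; have [s1|s1] := leP 1 s; first by nra.
    by nra.
  exists ((v - 1) / s - delta).
    rewrite !lte_fin; split => //; [by lra|by lra|].
    by rewrite mulrBl divfK ?gt_eqF//; lra.
  move=> C N err2; rewrite opprB addrC => h; split=> // h'; last by exfalso; lra.
  by split=> //; rewrite lee_fin => ?; exfalso; lra.
have [i1 i3] := inv_s hs.
have [hd|hd] := leP 3%:E dec.
  exists (3 - delta).
    split => //; first lra.
      by apply: lt_le_trans hd; rewrite lte_fin; lra.
    by apply: lt_le_trans hd; rewrite lte_fin mulrBl; lra.
  move=> C N err2; rewrite opprB addrC => h; split=> [h'|_]; first by exfalso; lra.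
  split=> //; split=> [_ /lt_le_trans/(_ hd)|_ h']; first by rewrite ltxx.
  by move: (le_trans hd h'); rewrite lee_fin => ?; exfalso; lra.
case: dec dec1 hd => // v; rewrite !lte_fin => v1 hd.
have [hv|hv] := ltP (1 - s)^-1 v.
  have vs : 1 < v * (1 - s) by rewrite -ltr_pdivrMr ?mul1r//; lra.
  exists (v - delta).
    by rewrite !lte_fin; split => //; [lra|lra|rewrite mulrBl; lra].
  move=> C N err2; rewrite opprB addrC => h; split=> [h'|_]; first by exfalso; lra.
  split; first by rewrite lee_fin => ?; exfalso; lra.
  by split=> // _; rewrite lee_fin leNgt hv.
have vs : v * (1 - s) <= 1 by rewrite -ler_pdivlMr ?mul1r//; lra.
have vv : (v - 1) / s <= v by rewrite ler_pdivrMr//; lra.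
exists ((v - 1) / s - delta).
  rewrite !lte_fin; split => //; [by lra|by lra|].
  by rewrite mulrBl divfK ?gt_eqF//; lra.
move=> C N err2; rewrite opprB addrC => h; split=> [h'|_]; first by exfalso; lra.
split; first by rewrite lee_fin => ?; exfalso; lra.
by split=> //; rewrite lte_fin ltNge hv.
Qed.

Theorem corollary5p4 (R : realType)
  (g : nat -> R)
  (g_ge0 : forall j, 0 <= g j)
  (g_decr : forall i j, (i <= j)%N -> g j <= g i)
  (g_summable : (\esum_(u in [set: {fset nat}]) (weight g u)%:E < +oo)%E)
  (u : nat -> {fset nat}) (u_enum : decreasing_enum g u)
  (mu : {measure set (g_sigma_algebraType (@cylinders R)) -> \bar R})
  (mu_product : is_product_lebesgue mu)
  (b : nat) (b_prime : prime b)
  (d : measure_display) (Omega : measurableType d) (P : probability Omega R)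
  (perms : nat -> nat -> seq 'F_b -> Omega -> {perm 'F_b})
  (perms_uniform : uniform_scrambling P perms)
  (rule : nat -> nat -> {poly 'F_b} * (nat -> {poly 'F_b}))
  (rule_good : forall L M k, (0 < L)%N -> (0 < M)%N ->
     good_rule g P L M (perms k) (rule L M))
  (dollar : nat -> R)
  (dollar_ge0 : forall i, 0 <= dollar i)
  (dollar_incr : {homo dollar : i j / (i <= j)%N >-> i <= j})
  (s : R) (s_gt0 : 0 < s)
  (dollar_bigO : (dollar : nat -> R^o) =O_\oo (fun i => i%:R `^ s : R^o)) :
  forall delta : R, 0 < delta ->
  exists C N0 : R, forall N : R, N0 <= N ->
  exists (m : nat) (L n : nat -> nat),
    [/\ (0 < m)%N,
        (0 < L 1)%N,
        forall k, (1 <= k < m)%N -> (L k < L k.+1)%N /\ (n k.+1 <= n k)%N &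
        (b <= n m)%N]
    /\
    let dec := decay g u in
    let a : nat -> R := fun=> 2^-1 in
    let err2 := (worst_error g mu P (multilevel perms rule a m L n) ^+ 2)%E in
    (var_cost g P dollar (multilevel_points perms rule a m L n) <= N%:E)%E
    /\
    (2 / 3 <= s ->
       (((1 + 3 * s)%:E <= dec)%E ->
          (err2 <= (C * N `^ (- 3 + delta))%:E)%E)
       /\
       ((1 < dec)%E -> (dec < (1 + 3 * s)%:E)%E ->
          (err2 <= (C * N `^ (- ((fine dec - 1) / s) + delta))%:E)%E))
    /\
    (s < 2 / 3 ->
       ((3%:E <= dec)%E ->
          (err2 <= (C * N `^ (- 3 + delta))%:E)%E)
       /\
       (((1 - s)^-1%:E < dec)%E -> (dec < 3%:E)%E ->
          (err2 <= (C * N `^ (- fine dec + delta))%:E)%E)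
       /\
       ((1 < dec)%E -> (dec <= (1 - s)^-1%:E)%E ->
          (err2 <= (C * N `^ (- ((fine dec - 1) / s) + delta))%:E)%E)).
Proof.
move=> delta delta_gt0.
have [D D_gt0 dollar_le] := bigO_powR_le s_gt0 dollar_ge0 dollar_incr dollar_bigO.
have valid := parameters_valid g_ge0 g_summable b_prime P perms rule dollar_ge0 dollar_incr
  s_gt0 D_gt0 dollar_le.
have [[_ clauses]|[r [r3 rdec rsdec dec1] clauses]] := rate_cases (decay g u) s_gt0 delta_gt0.
  (* With decay at most 1 the error claims are vacuous, and a single level within the budget
     suffices. *)
  exists 0, (threshold b s D 1) => N hN; exists 1%N, (levels s 1 (N / cost_scale b D 1)),
    (points b 1 (N / cost_scale b D 1)).
  have [v1 v2] := valid 1%N N isT hN.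
  by split=> //; split; [exact: v2|exact: clauses].
have [C [m m_gt0 err_le]] := worst_error_rate g_ge0 g_decr g_summable u_enum mu_product
  b_prime perms_uniform rule_good dollar_ge0 dollar_incr s_gt0 D_gt0 dollar_le r3 rdec rsdec dec1.
exists C, (threshold b s D m) => N hN; exists m, (levels s m (N / cost_scale b D m)),
  (points b m (N / cost_scale b D m)).
have [v1 v2] := valid m N m_gt0 hN.
by split=> //; split; [exact: v2|apply: clauses; exact: err_le].
Qed.
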